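(* Given a positive integer $d$ and $1 > \varepsilon > 0$, there is a constant $n_2(d,\varepsilon)$ such that the following holds. Let $p \ge q \ge n_2(d,\varepsilon)$ be positive integers. Then there is a constant $c_{\mathrm{surf}} = c_{\mathrm{surf}}(p,q,d,\varepsilon)$ such that the following is true. For any finite family $\mathcal{F}$ of convex sets in $\mathbb{R}^d$, each of surface area at least one, and such that among every $p$ sets in $\mathcal{F}$ there are $q$ whose intersection has surface area at least one, we can find $c_{\mathrm{surf}}$ convex sets $C_1, C_2, \ldots, C_{c_{\mathrm{surf}}}$, each of surface area $1-\varepsilon$, such that every $F \in \mathcal{F}$ contains at least one $C_i$ (that is, $C_i \subset F$ for some $i$).
   Context: For a convex set $K \subset \mathbb{R}^d$, $\mathrm{surf}(K)$ denotes its surface area.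
   Formalization: For d = 1 the surface area of a convex set counts endpoints (0, 1 or 2), so no set has surface area exactly 1−ε; in that dimension the sets C_i are only claimed to have surface area at least 1−ε. For d ≥ 2 the equality is as stated. *)

(* Defs.v *)
From HB Require Import structures.
From mathcomp Require Import all_boot all_order all_algebra finmap.
From mathcomp Require Import all_classical all_reals all_analysis.

Set Implicit Arguments.
Unset Strict Implicit.
Unset Printing Implicit Defensive.

Import Order.TTheory GRing.Theory Num.Theory.
Import numFieldNormedType.Exports.

Local Open Scope classical_set_scope.
Local Open Scope ring_scope.

(* The library norm on row vectors is the sup norm; surface area needs the
   Euclidean metric. The topology is the same for both. *)
Definition euclid_dist (R : realType) (d : nat) (x y : 'rV[R]_d) : R :=
  Num.sqrt (\sum_(i < d) (x ord0 i - y ord0 i) ^+ 2).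

Definition diam (R : realType) (d : nat) (U : set 'rV[R]_d) : \bar R :=
  ereal_sup [set (euclid_dist x y)%:E | x in U & y in U].

(* Volume of the Euclidean unit ball of R^n, by the recurrence
   omega_n = (2 pi / n) omega_(n-2). *)
Fixpoint ball_volume (R : realType) (n : nat) : R :=
  match n with
  | 0 => 1
  | 1 => 2
  | n'.+2 => 2 * pi / n%:R * ball_volume R n'
  end.

(* omega_s (diam U / 2)^s. The empty set is separated because its [diam] is
   -oo, and because it must weigh 0 also for s = 0. *)
Definition hausdorff_weight (R : realType) (d s : nat) (U : set 'rV[R]_d) :
    \bar R :=
  if `[< U = set0 >] then 0%E
  else ((ball_volume R s)%:E * (diam U * (2^-1)%:E) ^+ s)%E.

Definition hausdorff_content (R : realType) (d s : nat) (delta : R)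
    (A : set 'rV[R]_d) : \bar R :=
  ereal_inf [set (\sum_(0 <= i <oo) hausdorff_weight s (U i))%E |
    U in [set U : nat -> set 'rV[R]_d |
            A `<=` \bigcup_i U i /\ forall i, (diam (U i) <= delta%:E)%E]].

(* s-dimensional Hausdorff outer measure, normalised so that it is
   s-dimensional volume on s-dimensional subspaces. *)
Definition hausdorff_measure (R : realType) (d s : nat) (A : set 'rV[R]_d) :
    \bar R :=
  ereal_sup [set hausdorff_content s delta A |
    delta in [set delta : R | 0 < delta]].

Definition boundary (T : topologicalType) (A : set T) : set T :=
  closure A `\` interior A.

(* Surface area is (d-1)-dimensional measure of the boundary, possibly +oo.
   A convex set contained in a hyperplane has its (d-1)-volume counted once. *)
Definition surf (R : realType) (d : nat) (K : set 'rV[R]_d) : \bar R :=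
  hausdorff_measure d.-1 (boundary K).

(* Main.v *)
Require Import Defs.
From HB Require Import structures.
From mathcomp Require Import all_boot all_order all_algebra finmap.
From mathcomp Require Import all_classical all_reals all_analysis.
From mathcomp Require Import perm ring lra zify.

Set Implicit Arguments.
Unset Strict Implicit.
Unset Printing Implicit Defensive.

Import Order.TTheory GRing.Theory Num.Theory.
Import numFieldNormedType.Exports.

Local Open Scope classical_set_scope.
Local Open Scope ring_scope.

(** The proof reduces the theorem to a (p,q) theorem about ordinary convex
    sets in a parameter space.

    The geometric half is [covering_family]: there are finitely many families
    of convex pieces [C j x] in R^d, with [x] in a convex subset [S j] of R^D,
    D = d^2 + d, such that every piece has finite surface area at least
    1 - eps, every convex set of surface area at least 1 contains a piece, and
    the parameters [x] in [S j] with [C j x] inside a given convex [F] form a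
    convex set [G F j].  If q members of the family have an intersection of
    surface area at least 1, this intersection contains a piece, so their sets
    [G F j] have a common point for some [j].  The combinatorial half,
    [pq_coloured], then gives boundedly many pairs (j, x) such that for every
    member [F] one of them has [x] in [G F j].  The corresponding pieces,
    shrunk if d > 1 by a homothety to area exactly 1 - eps [shrink_exact], are
    the sets asked for.

    [pq_coloured] follows Alon and Kleitman.  Every weighting of the family
    has a coloured point that carries a fixed fraction of the weight
    [frac_helly]; hence some finite sequence of coloured points hits every
    member in a fixed proportion [mult_weights], a finite form of linear
    programming duality; and a weak net of that sequence [weak_net] hits every
    member and has bounded size.  Weak nets come from Tverberg's theorem
    through the selection lemma [selection].

    For [covering_family], cut an unbounded K down to a bounded part of almost
    the same area [truncation].  A bounded convex K has an adapted frame
    [adaptable_all]: up to translation it is the image, under a matrix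
    diag(a) N f, of a convex set K0 lying between two fixed balls of the span
    of the first k coordinates, where f belongs to a finite list of orthogonal
    matrices and N is unitriangular and close to the identity.  If k = d, then
    K0 is well approximated from inside by one of finitely many polytopes P
    [polytope_approx], and P diag(a) N f loses little of the area of K.  The
    pieces are the images of the polytopes P under the matrices M f, with M
    upper triangular with small off-diagonal entries, followed by a
    translation; they depend linearly on M and the translation, which makes
    the sets [G F j] convex.

    What remains is to express by a convex condition on M that the area of the
    piece is large.  The area of P diag(a) is a sum over the facets of
    constants times |(m_1 n_1, ..., m_d n_d)|, where n is the normal of the
    facet and m_i is the product of the a_j with j <> i [polytope_surface].
    This sum increases with the m_i, so a grid of finitely many thresholds z
    replaces the condition that it is large by one of the conditions
    [m_i >= z_i for all i] [facet_grid], and each of these is convex in a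
    because the logarithm is concave [prod_concave].  If k = d - 1, the set K
    lies in a hyperplane and the same argument applies with flat polytopes,
    whose area is governed by m_d alone.  If k < d - 1, the area of K is zero.

    All areas are computed relative to the measure of the unit cube of R^s,
    s = d - 1: a linear map multiplies the s-dimensional measure of all
    bounded convex bodies of R^s by one factor [flat_law], the factors of
    diagonal maps and of graphs follow by symmetry [area_dg, area_graph], and
    if the cube is null then so is the boundary of every polytope
    [H_bnd_null]. *)

(** * Convex sets: Radon, Helly, Tverberg *)

(** The property [convex_set] with a plain real coefficient, so that proofs
    of convexity need no elements of the unit interval type. *)
Definition cvx (R : realType) (V : lmodType R) (G : set V) :=
  forall x y (t : R), G x -> G y -> 0 <= t -> t <= 1 ->
    G (t *: x + (1 - t) *: y).

Section Convexity.
Context {R : realType} {V : lmodType R}.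
Implicit Types (G : set V).

Lemma cvxP G : convex_set G <-> cvx G.
Proof.
split=> [cG x y t Gx Gy t0 t1|cG x y t].
  have t01 : 0%R <= t <= 1%R by rewrite t0 t1.
  have := cG x y (Itv01 t0 t1).
  rewrite !inE; exact.
rewrite !inE => Gx Gy; exact: (cG x y t%:num).
Qed.

Lemma cvx_bigcap (I : Type) (D : set I) (F : I -> set V) :
  (forall i, D i -> cvx (F i)) -> cvx (\bigcap_(i in D) F i).
Proof. by move=> cF x y t Fx Fy t0 t1 i Di; apply: cF => //; [exact: Fx|exact: Fy]. Qed.

Lemma cvxI G1 G2 : cvx G1 -> cvx G2 -> cvx (G1 `&` G2).
Proof. by move=> c1 c2 x y t [? ?] [? ?] t0 t1; split; [exact: c1|exact: c2]. Qed.

Lemma cvx_mix G x y (a b : R) : cvx G -> G x -> G y -> 0 <= a -> 0 <= b ->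
  a + b = 1 -> G (a *: x + b *: y).
Proof.
move=> cG Gx Gy a0 b0 ab; have -> : b = 1 - a by rewrite -ab addrC addKr.
by apply: cG => //; rewrite -ab lerDl.
Qed.

(** Convex hull of the subfamily [A] of [v]. The coefficients live on the
    whole index type, so that Radon and Tverberg partitions are partitions
    of indices. *)
Definition hull_on (I : finType) (A : {set I}) (v : I -> V) : set V :=
  [set z | exists c : I -> R, [/\ forall i, 0 <= c i,
     forall i, i \notin A -> c i = 0, \sum_i c i = 1 & z = \sum_i c i *: v i]].

(** Normalising by the partial sums lets the convex combination be built up
    one term at a time from combinations of two points. *)
Lemma cvx_seq_sum (I : Type) (r : seq I) (c : I -> R) (v : I -> V) G :
  cvx G -> (forall i, 0 <= c i) -> (forall i, c i != 0 -> G (v i)) ->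
  0 < \sum_(i <- r) c i ->
  G ((\sum_(i <- r) c i)^-1 *: \sum_(i <- r) c i *: v i).
Proof.
move=> cG c0 Gv; elim: r => [|i r IH]; first by rewrite big_nil ltxx.
rewrite !big_cons => pos.
have [s0|s0] := eqVneq (\sum_(j <- r) c j) 0.
  have cv0 : \sum_(j <- r) c j *: v j = 0.
    elim: r s0 {IH pos} => [|j r IH]; first by rewrite !big_nil.
    rewrite !big_cons => /eqP; rewrite paddr_eq0 ?sumr_ge0//.
    by move=> /andP[/eqP -> /eqP /IH ->]; rewrite scale0r addr0.
  rewrite s0 addr0 in pos *; rewrite cv0 addr0 scalerA mulVf ?gt_eqF// scale1r.
  by apply: Gv; rewrite gt_eqF.
have sp : 0 < \sum_(j <- r) c j by rewrite lt_neqAle eq_sym s0 sumr_ge0.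
have [ci0|ci0] := eqVneq (c i) 0.
  by rewrite ci0 scale0r !add0r; exact: IH.
set s := \sum_(j <- r) c j in pos sp s0 IH *.
have -> : (c i + s)^-1 *: (c i *: v i + \sum_(j <- r) c j *: v j) =
    (c i / (c i + s)) *: v i + (s / (c i + s)) *: (s^-1 *: \sum_(j <- r) c j *: v j).
  by rewrite scalerDr !scalerA mulrAC mulfV// mul1r mulrC.
apply: cvx_mix => //.
- exact: Gv.
- exact: IH.
- by rewrite divr_ge0// ltW.
- by rewrite divr_ge0// ltW.
- by rewrite -mulrDl mulfV// gt_eqF.
Qed.

Lemma cvx_sum (I : finType) (c : I -> R) (v : I -> V) G :
  cvx G -> (forall i, 0 <= c i) -> (forall i, c i != 0 -> G (v i)) ->
  \sum_i c i = 1 -> G (\sum_i c i *: v i).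
Proof.
move=> cG c0 Gv c1; have := @cvx_seq_sum I (index_enum I) c v G cG c0 Gv.
by rewrite c1 invr1 scale1r; apply.
Qed.

Lemma hull_on_sub (I : finType) (A : {set I}) (v : I -> V) G :
  cvx G -> (forall i, i \in A -> G (v i)) -> hull_on A v `<=` G.
Proof.
move=> cG Gv z [c [c0 cA c1 ->]]; apply: cvx_sum => // i ci.
by apply: Gv; apply: contraNT ci => /cA ->.
Qed.

Lemma hull_on_cvx (I : finType) (A : {set I}) (v : I -> V) : cvx (hull_on A v).
Proof.
move=> _ _ t [c [c0 cA c1 ->]] [d [d0 dA d1 ->]] t0 t1.
have t1' : 0 <= 1 - t by rewrite subr_ge0.
exists (fun i => t * c i + (1 - t) * d i); split.
- by move=> i; rewrite addr_ge0// mulr_ge0.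
- by move=> i iA; rewrite cA// dA// !mulr0 addr0.
- by rewrite big_split/= -!mulr_sumr c1 d1; ring.
- rewrite !scaler_sumr -big_split/=; apply: eq_bigr => i _ /=.
  by rewrite [RHS]scalerDl !scalerA.
Qed.

Lemma hull_on_mem (I : finType) (A : {set I}) (v : I -> V) i :
  i \in A -> hull_on A v (v i).
Proof.
move=> iA; exists (fun j => (j == i)%:R); split.
- by move=> j; rewrite ler0n.
- by move=> j jA; case: eqP => // ji; rewrite ji iA in jA.
- by rewrite (bigD1 i)//= eqxx big1 ?addr0// => j /negbTE ->.
- rewrite (bigD1 i)//= eqxx scale1r big1 ?addr0// => j /negbTE ->.
  by rewrite scale0r.
Qed.

Lemma hull_on_subset (I : finType) (A B : {set I}) (v : I -> V) :
  A \subset B -> hull_on A v `<=` hull_on B v.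
Proof.
move=> AB; apply: hull_on_sub; first exact: hull_on_cvx.
by move=> i iA; apply: hull_on_mem; apply: (fintype.subsetP AB).
Qed.

End Convexity.

Section Radon.
Context {R : realType} {n : nat}.
Let V := 'rV[R]_n.

(** The n + 2 vectors (v i, 1) of R^(n+1) are linearly dependent. [A]
    collects the positive coefficients of a dependency; after normalisation
    the two sides of the dependency are the same point, written as a convex
    combination twice. *)
Lemma radon (v : 'I_n.+2 -> V) : exists (A : {set 'I_n.+2}) (z : V),
  hull_on A v z /\ hull_on (~: A) v z.
Proof.
pose M : 'M[R]_(n.+2, n + 1) := row_mx (\matrix_i v i) (const_mx 1).
have : kermx M != 0.
  by rewrite kermx_eq0 /row_free; apply/eqP => rM; have := rank_leq_col M; rewrite rM; lia.
move=> /rowV0Pn[c /sub_kermxP cM c0].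
have [cv cs] : \sum_i c 0 i *: v i = 0 /\ \sum_i c 0 i = 0.
  move: cM; rewrite mul_mx_row => /eqP; rewrite row_mx_eq0 => /andP[/eqP h1 /eqP h2].
  split.
    by rewrite -[RHS]h1 mulmx_sum_row; apply: eq_bigr => i _; rewrite rowK.
  have /matrixP/(_ 0 0) := h2; rewrite !mxE => {2}<-.
  by apply: eq_bigr => i _; rewrite mxE mulr1.
(* the coefficients sum to 0, so the positive ones balance the others *)
pose A := [set i | 0 < c 0 i]%SET.
pose s := \sum_(i in A) c 0 i.
have sN : s = \sum_(i in ~: A) - c 0 i.
  rewrite sumrN; apply/eqP; rewrite -subr_eq0 opprK -[X in _ == X]cs /s.
  rewrite [X in _ == X](bigID (fun i => i \in A))/=; apply/eqP; congr (_ + _).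
  by apply: eq_bigl => i; rewrite !inE.
have s0 : 0 < s.
  rewrite lt_neqAle sumr_ge0 ?andbT; last by move=> i; rewrite inE => /ltW.
  apply: contra c0; rewrite eq_sym => /eqP s0.
  apply/eqP/rowP => i; rewrite mxE.
  have [iA|iA] := boolP (i \in A).
    move: s0; rewrite /s => /psumr_eq0P -> //.
    by move=> j; rewrite inE => /ltW.
  move: s0; rewrite sN => /psumr_eq0P/(_ i).
  rewrite inE iA => h; apply/eqP; rewrite -oppr_eq0 h// => j.
  by rewrite !inE oppr_ge0 -leNgt.
pose z := \sum_(i in A) (c 0 i / s) *: v i.
exists A, z; split.
  exists (fun i => if i \in A then c 0 i / s else 0); split.
  - by move=> i; case: ifP; rewrite // inE => h; rewrite divr_ge0// ltW.
  - by move=> i /negbTE ->.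
  - by rewrite -big_mkcond -mulr_suml mulfV// gt_eqF.
  - by rewrite /z big_mkcond; apply: eq_bigr => i _; case: ifP; rewrite ?scale0r.
exists (fun i => if i \in ~: A then - c 0 i / s else 0); split.
- move=> i; case: ifP => //; rewrite !inE -leNgt => h.
  by rewrite divr_ge0 ?oppr_ge0// ltW.
- by move=> i /negbTE ->.
- by rewrite -big_mkcond -mulr_suml -sN mulfV// gt_eqF.
- apply/eqP; rewrite -subr_eq0 -[X in _ == X](scaler0 _ s^-1) -[X in _ == _ *: X]cv scaler_sumr.
  rewrite [X in _ == X](bigID (fun i => i \in A))/= /z; apply/eqP; congr (_ + _).
    by apply: eq_bigr => i _; rewrite scalerA mulrC.
  rewrite [RHS]big_mkcond -sumrN; apply: eq_bigr => i _.
  rewrite inE; case: (i \in A); rewrite /= ?scale0r ?oppr0//.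
  by rewrite scalerA mulNr scaleNr opprK mulrC.
Qed.

(** Radon's theorem for points [x i] that lie in all the sets but the i-th:
    the sets of one side of the partition contain the points of the other
    side. *)
Lemma helly (G : 'I_n.+2 -> set V) : (forall i, cvx (G i)) ->
  (forall i, exists x, forall j, j != i -> G j x) ->
  exists x, forall j, G j x.
Proof.
move=> cG /choice[x xP]; have [A [z [h1 h2]]] := radon x.
exists z => j; have [jA|jA] := boolP (j \in A).
  apply: hull_on_sub h2 => // i; rewrite inE => iA.
  by apply: xP; apply: contraNneq iA => <-.
apply: hull_on_sub h1 => // i iA.
by apply: xP; apply: contraNneq jA => ->.
Qed.

Lemma hull_on_comp (I J : finType) (B : {set J}) (w : J -> V) (A : J -> {set I})
  (v : I -> V) (C : {set I}) z :
  (forall j, j \in B -> A j \subset C /\ hull_on (A j) v (w j)) ->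
  hull_on B w z -> hull_on C v z.
Proof.
move=> h; apply: hull_on_sub; first exact: hull_on_cvx.
by move=> j /h[AC]; exact: hull_on_subset.
Qed.

(** Radon's theorem, iterated, gives partitions into 2^k classes: take n + 2
    blocks, a point [w i] common to the 2^k hulls of block i, and a Radon
    partition of these points. The side on which a block lies is one more
    bit. *)
Lemma tverberg_pow (k : nat) : exists N : finType, forall v : N -> V,
  exists (g : N -> {ffun 'I_k -> bool}) z,
    forall r, hull_on [set l | g l == r]%SET v z.
Proof.
elim: k => [|k [N IH]].
  exists unit => v; exists (fun=> [ffun=> false]), (v tt) => r.
  apply: hull_on_mem; rewrite inE; apply/eqP/ffunP => -[]//.
exists ('I_n.+2 * N)%type => v.
have /choice[g /choice[w wP]] i := IH (fun l => v (i, l)).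
have [A [z [h1 h2]]] := radon w.
exists (fun p => [ffun j : 'I_k.+1 => if unlift ord0 j is Some j' then g p.1 p.2 j' else p.1 \in A]), z.
move=> r; pose r' := [ffun j : 'I_k => r (lift ord0 j)].
pose B := if r ord0 then A else ~: A.
have hB : hull_on B w z by rewrite /B; case: (r ord0).
apply: (hull_on_comp (A := fun i => [set p | (p.1 == i) && (g p.1 p.2 == r')]%SET)) hB.
move=> i iB; split.
  apply/fintype.subsetP => -[i' l]; rewrite !inE/= => /andP[/eqP -> /eqP gr].
  apply/eqP/ffunP => j; rewrite ffunE; case: unliftP => [j' ->|->].
    by rewrite gr ffunE.
  by move: iB; rewrite /B; case: (r ord0) => [->//|]; rewrite inE => /negbTE ->.
have [c [c0 cA c1 wE]] := wP i r'.
exists (fun p => if p.1 == i then c p.2 else 0); split.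
- by move=> p; case: ifP.
- move=> [i' l]; rewrite inE/=; case: eqP => //= ->; by move=> /= h; apply: cA; rewrite inE.
- rewrite -(pair_bigA _ (fun i' l => if i' == i then c l else 0))/=.
  rewrite (bigD1 i)//= eqxx c1 big1 ?addr0// => i' /negbTE ->.
  by rewrite big1.
- rewrite wE.
  transitivity (\sum_i' \sum_l (if i' == i then c l else 0) *: v (i', l)); last first.
    by rewrite pair_bigA/=; apply: eq_bigr => -[].
  rewrite [RHS](bigD1 i)//= eqxx [X in _ + X]big1 ?addr0// => i' /negbTE ->.
  by rewrite big1// => l _; rewrite scale0r.
Qed.

(** A partition into 2^(k+1) classes has at least k + 1 classes; class [r]
    is the one labelled by the indicator function of [r]. *)
Lemma tverberg (k : nat) : exists N : finType, forall v : N -> V,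
  exists (g : {ffun N -> 'I_k.+1}) z, forall r, hull_on [set l | g l == r]%SET v z.
Proof.
have [N H] := tverberg_pow k.+1.
exists N => v; have [g [z h]] := H v.
pose b (f : {ffun 'I_k.+1 -> bool}) : 'I_k.+1 := odflt ord0 [pick r | f r].
exists [ffun l => b (g l)], z => r.
apply: (hull_on_subset _ (h [ffun j => j == r])).
apply/fintype.subsetP => l; rewrite !inE ffunE => /eqP ->; rewrite /b.
by case: pickP => [r'|/(_ r)]; rewrite ffunE ?eqxx// => /eqP ->.
Qed.

End Radon.

(** * Euclidean geometry of row vectors *)

Lemma sum_cont (R : realType) (T : topologicalType) (W : normedModType R)
    (I : finType) (f : I -> T -> W) :
  (forall i, continuous (f i)) -> continuous (fun x => \sum_i f i x).
Proof. by move=> fc x; apply: cvg_big => [|i _]; [exact: add_continuous|exact: fc]. Qed.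

Lemma mul_cont (R : realType) (T : topologicalType) (f g : T -> R) :
  continuous f -> continuous g -> continuous (fun x => f x * g x).
Proof. by move=> fc gc x; apply: cvgM; [exact: fc|exact: gc]. Qed.

Lemma scale_cont (R : realType) (T : topologicalType) (W : normedModType R)
  (f : T -> R) (w : W) : continuous f -> continuous (fun x => f x *: w).
Proof. by move=> fc x; apply: cvgZr_tmp; exact: fc. Qed.

Section Euclid.
Context {R : realType} {n : nat}.
Implicit Types x y z : 'rV[R]_n.

Definition dotv x y : R := \sum_i x 0 i * y 0 i.
Definition enorm x : R := Num.sqrt (dotv x x).

Lemma dotvC x y : dotv x y = dotv y x.
Proof. by apply: eq_bigr => i _; rewrite mulrC. Qed.
Lemma dotvDl x y z : dotv (x + y) z = dotv x z + dotv y z.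
Proof. by rewrite -big_split; apply: eq_bigr => i _; rewrite !mxE mulrDl. Qed.
Lemma dotvDr x y z : dotv z (x + y) = dotv z x + dotv z y.
Proof. by rewrite dotvC dotvDl !(dotvC z). Qed.
Lemma dotvZl a x y : dotv (a *: x) y = a * dotv x y.
Proof. by rewrite mulr_sumr; apply: eq_bigr => i _; rewrite !mxE mulrA. Qed.
Lemma dotvZr a x y : dotv x (a *: y) = a * dotv x y.
Proof. by rewrite dotvC dotvZl dotvC. Qed.
Lemma dotvNl x y : dotv (- x) y = - dotv x y.
Proof. by rewrite -scaleN1r dotvZl mulN1r. Qed.
Lemma dotvNr x y : dotv x (- y) = - dotv x y.
Proof. by rewrite dotvC dotvNl dotvC. Qed.
Lemma dotvBl x y z : dotv (x - y) z = dotv x z - dotv y z.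
Proof. by rewrite dotvDl dotvNl. Qed.
Lemma dotvBr x y z : dotv z (x - y) = dotv z x - dotv z y.
Proof. by rewrite dotvDr dotvNr. Qed.
Lemma dotv0l x : dotv 0 x = 0.
Proof. by rewrite -(scale0r x) dotvZl mul0r. Qed.
Lemma dotv0r x : dotv x 0 = 0.
Proof. by rewrite dotvC dotv0l. Qed.

Definition dotvE := (dotvDl, dotvDr, dotvZl, dotvZr, dotvNl, dotvNr).

Lemma dotv_ge0 x : 0 <= dotv x x.
Proof. by apply: sumr_ge0 => i _; rewrite -expr2 sqr_ge0. Qed.

Lemma dotv_eq0 x : (dotv x x == 0) = (x == 0).
Proof.
apply/eqP/eqP => [h|->]; last by rewrite dotv0l.
apply/rowP => i; rewrite mxE; apply/eqP; rewrite -sqrf_eq0 expr2; apply/eqP.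
by move: h => /psumr_eq0P; apply=> // j _; rewrite -expr2 sqr_ge0.
Qed.

Lemma enorm_ge0 x : 0 <= enorm x. Proof. exact: sqrtr_ge0. Qed.
Lemma enorm_sq x : enorm x ^+ 2 = dotv x x.
Proof. by rewrite sqr_sqrtr// dotv_ge0. Qed.
Lemma enorm_eq0 x : (enorm x == 0) = (x == 0).
Proof. by rewrite -dotv_eq0 -enorm_sq sqrf_eq0. Qed.
Lemma enorm0 : enorm 0 = 0.
Proof. by apply/eqP; rewrite enorm_eq0. Qed.
Lemma enorm_gt0 x : (0 < enorm x) = (x != 0).
Proof. by rewrite lt_neqAle enorm_ge0 andbT eq_sym enorm_eq0. Qed.
Lemma enormZ a x : enorm (a *: x) = `|a| * enorm x.
Proof. by rewrite /enorm dotvZl dotvZr mulrA -expr2 sqrtrM ?sqr_ge0// sqrtr_sqr. Qed.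
Lemma enormN x : enorm (- x) = enorm x.
Proof. by rewrite -scaleN1r enormZ normrN1 mul1r. Qed.

Lemma enorm_le (a : R) x : 0 <= a -> (enorm x <= a) = (dotv x x <= a ^+ 2).
Proof. by move=> a0; rewrite -enorm_sq ler_sqr ?nnegrE ?enorm_ge0. Qed.

Lemma cauchy_schwarz x y : dotv x y <= enorm x * enorm y.
Proof.
have [->|y0] := eqVneq y 0; first by rewrite dotv0r mulr_ge0 ?enorm_ge0.
have yy : 0 < dotv y y by rewrite lt_neqAle dotv_ge0 eq_sym dotv_eq0 y0.
have := dotv_ge0 (dotv y y *: x - dotv x y *: y).
rewrite !dotvE (dotvC y x).
set a := dotv x x; set b := dotv x y; set c := dotv y y in yy * => h.
have : 0 <= c * (a * c - b ^+ 2) by lra.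
rewrite pmulr_rge0// subr_ge0 => h2.
have [b0|b0] := leP b 0; first by rewrite (le_trans b0)// mulr_ge0 ?enorm_ge0.
by rewrite -ler_sqr ?nnegrE ?mulr_ge0 ?enorm_ge0 ?(ltW b0)// exprMn !enorm_sq.
Qed.

Lemma cauchy_schwarz_abs x y : `|dotv x y| <= enorm x * enorm y.
Proof.
rewrite ler_norml cauchy_schwarz andbT lerNl -dotvNl.
by rewrite (le_trans (cauchy_schwarz _ _))// enormN.
Qed.

Lemma enormD x y : enorm (x + y) <= enorm x + enorm y.
Proof.
rewrite enorm_le ?addr_ge0 ?enorm_ge0// !dotvE (dotvC y x) sqrrD !enorm_sq.
by have := cauchy_schwarz x y; lra.
Qed.

Lemma enorm_distC x y : enorm (x - y) = enorm (y - x).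
Proof. by rewrite -enormN opprB. Qed.

Lemma euclid_distE x y : euclid_dist x y = enorm (x - y).
Proof.
by rewrite /euclid_dist /enorm; congr Num.sqrt; apply: eq_bigr => i _; rewrite !mxE expr2.
Qed.

Lemma coord_le_norm x i : `|x 0 i| <= `|x|.
Proof.
rewrite [leRHS]mx_normrE; exact: (le_bigmax _ (fun ij : 'I_1 * 'I_n => `|x ij.1 ij.2|) (ord0, i)).
Qed.

Lemma norm_le_coord x (a : R) : 0 <= a -> (forall i, `|x 0 i| <= a) -> `|x| <= a.
Proof.
move=> a0 h; rewrite [leLHS]mx_normrE; apply/bigmax_leP; split => // -[i j] _ /=.
by rewrite ord1.
Qed.

Lemma coord_le_enorm x i : `|x 0 i| <= enorm x.
Proof.
rewrite -ler_sqr ?nnegrE ?enorm_ge0// enorm_sq /dotv (bigD1 i)//= real_normK ?num_real//.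
by rewrite expr2 lerDl sumr_ge0// => j _; rewrite -expr2 sqr_ge0.
Qed.

Lemma norm_le_enorm x : `|x| <= enorm x.
Proof. by apply: norm_le_coord; [exact: enorm_ge0|exact: coord_le_enorm]. Qed.

Lemma enorm_le_norm x : enorm x <= n%:R * `|x|.
Proof.
rewrite enorm_le ?mulr_ge0//; have [n0|npos] := posnP n.
  rewrite [dotv _ _]big1 ?sqr_ge0// => i _.
  by have := ltn_ord i; rewrite [X in (_ < X)%N]n0.
rewrite exprMn; apply: le_trans (_ : n%:R * `|x| ^+ 2 <= _).
  rewrite mulr_natl -[X in _ *+ X]card_ord -sumr_const; apply: ler_sum => i _.
  by rewrite -expr2 -real_normK ?num_real// ler_sqr ?nnegrE//; exact: coord_le_norm.
by rewrite ler_wpM2r ?sqr_ge0// expr2 ler_peMl// ler1n.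
Qed.

Lemma dotv_cont z : continuous (dotv^~ z : 'rV[R]_n -> R).
Proof.
apply: sum_cont => i; apply: mul_cont.
  exact: (@coord_continuous R 1 n).
exact: cst_continuous.
Qed.

Lemma dotv_sq_cont : continuous (fun x : 'rV[R]_n => dotv x x).
Proof. by apply: sum_cont => i; apply: mul_cont; exact: (@coord_continuous R 1 n). Qed.

Lemma dotv_subZ (u w : 'rV[R]_n) (t : R) :
  dotv (u - t *: w) (u - t *: w) = dotv u u - 2 * t * dotv u w + t ^+ 2 * dotv w w.
Proof. by rewrite dotvBl !dotvBr !dotvZl !dotvZr (dotvC w u); ring. Qed.

(** The squared distance attains its minimum on the part of [C] in a ball,
    which is compact. *)
Lemma closest_exists (C : set 'rV[R]_n) z : closed C -> C !=set0 ->
  exists p, C p /\ forall y, C y -> dotv (z - p) (z - p) <= dotv (z - y) (z - y).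
Proof.
move=> cC [c Cc].
pose B := [set y : 'rV[R]_n | dotv (z - y) (z - y) <= dotv (z - c) (z - c)].
have fc : continuous (fun y : 'rV[R]_n => dotv (z - y) (z - y)).
  move=> y; apply: (@continuous_comp _ _ _ (fun y => z - y) (fun x => dotv x x)).
    by apply: (@continuousB _ _ _ (fun=> z) id y); [exact: cst_continuous|exact: cvg_id].
  exact: dotv_sq_cont.
have cB : closed B.
  rewrite (_ : B = (fun y : 'rV[R]_n => dotv (z - y) (z - y)) @^-1` [set t | t <= dotv (z - c) (z - c)])//.
  by apply: preimage_closed => [y _|]; [exact: fc|exact: closed_le].
have kCB : compact (C `&` B).
  apply: bounded_closed_compact; last exact: closedI.
  exists (`|z| + enorm (z - c)); split; first exact: num_real.
  move=> M hM y [_ By]; apply: ltW; apply: le_lt_trans hM.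
  rewrite -[y](subKr z) (le_trans (ler_normB _ _))// lerD2l.
  by rewrite (le_trans (norm_le_enorm _))// enorm_le ?enorm_ge0// enorm_sq.
have ne : (C `&` B) !=set0 by exists c; split => //; exact: lexx.
have [p pCB pm] := compact_EVT_min ne kCB (continuous_subspaceT fc).
move: pCB; rewrite inE => -[Cp Bp]; exists p; split => // y Cy.
have [yB|yB] := leP (dotv (z - y) (z - y)) (dotv (z - c) (z - c)).
  by apply: pm; rewrite inE.
by apply: le_trans Bp (ltW yB).
Qed.

(** Moving from [p] a little towards [y] does not bring us closer to [z]; to
    first order the squared distance changes by -2 (z - p).(y - p). *)
Lemma closest_obtuse (C : set 'rV[R]_n) z p : cvx C -> C p ->
  (forall y, C y -> dotv (z - p) (z - p) <= dotv (z - y) (z - y)) ->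
  forall y, C y -> dotv (z - p) (y - p) <= 0.
Proof.
move=> cC Cp pm y Cy; rewrite leNgt; apply/negP => h.
set a := dotv (z - p) (y - p) in h; set b := dotv (y - p) (y - p).
have b0 : 0 <= b by exact: dotv_ge0.
pose t := a / (a + b + 1).
have t0 : 0 < t by rewrite divr_gt0//; lra.
have t1 : t <= 1 by rewrite ler_pdivrMr; lra.
have := pm _ (cC _ _ t Cy Cp (ltW t0) t1).
have -> : z - (t *: y + (1 - t) *: p) = (z - p) - t *: (y - p).
  by apply/rowP => i; rewrite !mxE; ring.
rewrite dotv_subZ -/a -/b => h2.
have : t * (2 * a) <= t * (t * b) by lra.
rewrite ler_pM2l// => h3.
have : t * b <= a by rewrite mulrAC ler_pdivrMr; nra.
lra.
Qed.

Lemma closest_uniq (C : set 'rV[R]_n) z p q : cvx C -> C p -> C q ->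
  (forall y, C y -> dotv (z - p) (z - p) <= dotv (z - y) (z - y)) ->
  dotv (z - q) (z - q) <= dotv (z - p) (z - p) -> q = p.
Proof.
move=> cC Cp Cq pm qm; apply/eqP; rewrite -subr_eq0 -dotv_eq0 eq_le dotv_ge0 andbT.
have := closest_obtuse cC Cp pm Cq.
move: qm; have -> : z - q = (z - p) - (q - p) by rewrite opprB addrA subrK.
rewrite -[q - p in X in X <= _]scale1r dotv_subZ; lra.
Qed.

End Euclid.

(** The hull is the continuous image of the standard simplex. *)
Lemma hull_on_compact (R : realType) (n : nat) (I : finType) (A : {set I}) (v : I -> 'rV[R]_n) :
  compact (hull_on A v).
Proof.
pose D := [set c : 'rV[R]_#|I| | (forall i, 0 <= c 0 i) /\
  (forall i, enum_val i \notin A -> c 0 i = 0) /\ \sum_i c 0 i = 1].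
pose f (c : 'rV[R]_#|I|) := \sum_i c 0 i *: v (enum_val i).
have bij : {on xpredT, bijective (@enum_rank I)}.
  by exists enum_val => i _; [exact: enum_rankK|exact: enum_valK].
have -> : hull_on A v = f @` D.
  apply/seteqP; split=> [_ [c [c0 cA c1 ->]]|_ [c [c0 [cA c1]] <-]].
    exists (\row_i c (enum_val i)).
      split; first by move=> i; rewrite mxE.
      split; first by move=> i; rewrite mxE; exact: cA.
      rewrite -[RHS]c1 (reindex _ bij)/=; apply: eq_bigr => i _.
      by rewrite mxE enum_rankK.
    rewrite /f (reindex _ bij)/=; apply: eq_bigr => i _.
    by rewrite mxE enum_rankK.
  exists (fun i => c 0 (enum_rank i)); split => //.
  - by move=> i iA; apply: cA; rewrite enum_rankK.
  - by rewrite -[RHS]c1 [RHS](reindex _ bij).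
  - by rewrite /f (reindex _ bij)/=; apply: eq_bigr => i _; rewrite enum_rankK.
apply: continuous_compact.
  apply: continuous_subspaceT; apply: sum_cont => i; apply: scale_cont.
  exact: (@coord_continuous R 1 _).
apply: bounded_closed_compact.
  exists 1; split; first exact: num_real.
  move=> M M1 c [c0 [_ c1]]; apply: le_trans (ltW M1). apply: norm_le_coord => // i.
  by rewrite ger0_norm// -[leRHS]c1 (bigD1 i)//= lerDl sumr_ge0.
rewrite (_ : D = (\bigcap_i [set c : 'rV[R]_#|I| | 0 <= c 0 i]) `&`
   ((\bigcap_(i in [set i | enum_val i \notin A]) [set c : 'rV[R]_#|I| | c 0 i = 0]) `&`
   [set c : 'rV[R]_#|I| | \sum_i c 0 i = 1])); last first.
  apply/seteqP; split=> [c [h1 [h2 h3]]|c [h1 [h2 h3]]].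
    by split=> [i _|]; [exact: h1|split => // i]; exact: h2.
  by split=> [i|]; [exact: h1|split => // i]; exact: h2.
apply: closedI; [|apply: closedI].
- apply: closed_bigI => i _.
  apply: (@preimage_closed _ _ (fun c : 'rV[R]_#|I| => c 0 i) [set t | 0 <= t]) => [c _|].
    exact: coord_continuous.
  exact: closed_ge.
- apply: closed_bigI => i _.
  apply: (@preimage_closed _ _ (fun c : 'rV[R]_#|I| => c 0 i) [set t | t = 0]) => [c _|].
    exact: coord_continuous.
  exact: closed_eq.
- apply: (@preimage_closed _ _ (fun c : 'rV[R]_#|I| => \sum_i c 0 i) [set t | t = 1]) => [c _|].
    by move: c; apply: sum_cont => i; exact: (@coord_continuous R 1 _).
  exact: closed_eq.
Qed.

(** * Weighted fractional Helly theorem *)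

Definition iverson (R : realType) (P : Prop) : R := (`[< P >])%:R.

Section ProductWeights.
Context {R : realType}.

Definition prob (I : finType) (w : I -> R) := (forall i, 0 <= w i) /\ \sum_i w i = 1.

(** The law of independent draws from [w]. *)
Definition pw (A I : finType) (w : I -> R) (T : {ffun A -> I}) : R := \prod_a w (T a).

Lemma pw_prob (A I : finType) (w : I -> R) : prob w -> prob (@pw A I w).
Proof.
move=> [w0 w1]; split; first by move=> T; apply: prodr_ge0.
by rewrite -(bigA_distr_bigA (fun _ => w)) big1.
Qed.

Lemma iverson_ge0 (P : Prop) : 0 <= iverson R (P).
Proof. exact: ler0n. Qed.

Lemma iverson_le (P Q : Prop) : (P -> Q) -> iverson R (P) <= iverson R (Q).
Proof.
by move=> PQ; rewrite /iverson ler_nat; case: asboolP => // /PQ q; case: asboolP.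
Qed.

Lemma pigeon_sum (J : finType) (F : J -> R) (a : R) : 0 < a ->
  a <= \sum_j F j -> exists j, a / #|J|%:R <= F j.
Proof.
move=> a0 aF; apply/not_existsP => h.
have J0 : (0 < #|J|)%N.
  rewrite lt0n; apply/eqP => /card0_eq J0; move: aF; rewrite big1 ?leNgt ?a0//.
  by move=> j; have := J0 j; rewrite inE.
have : \sum_j F j < \sum_(j : J) a / #|J|%:R.
  have [j0 _] := card_gt0P J0.
  rewrite (bigD1 j0)//= [ltRHS](bigD1 j0)//= ltr_leD//.
    by rewrite ltNge; apply/negP/h.
  by apply: ler_sum => j _; rewrite ltW// ltNge; apply/negP/h.
rewrite sumr_const -[_ *+ _]mulr_natr divfK ?pnatr_eq0 -?lt0n//.
by rewrite ltNge aF.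
Qed.

(** Some coordinates of an independent sample form an independent sample. *)
Lemma marginal_sub (A B X : finType) (mu : X -> R) (iota : B -> A)
    (h : {ffun B -> X} -> R) : prob mu -> injective iota ->
  \sum_(T : {ffun A -> X}) pw mu T * h [ffun b => T (iota b)] =
  \sum_U pw mu U * h U.
Proof.
move=> [mu0 mu1] inj.
rewrite (partition_big (fun T : {ffun A -> X} => [ffun b => T (iota b)]) predT)//=.
apply: eq_bigr => U _.
transitivity (\sum_(T : {ffun A -> X} | [ffun b => T (iota b)] == U) pw mu T * h U).
  by apply: eq_bigr => T /eqP ->.
rewrite -mulr_suml; congr (_ * _).
pose Q a := [pred x | [forall b, (iota b == a) ==> (x == U b)]].
rewrite (eq_bigl (fun T => T \in family Q)); last first.
  move=> T; apply/eqP/familyP => [e a|h' ].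
    by rewrite inE; apply/forallP => b; apply/implyP => /eqP <-; rewrite -e ffunE.
  apply/ffunP => b; rewrite ffunE.
  by have := h' (iota b); rewrite inE => /forallP/(_ b); rewrite eqxx => /eqP.
rewrite /pw -(bigA_distr_big_dep _ (fun _ => mu))/=.
rewrite (bigID (fun a => a \in iota @: [set: B]%SET))/= [X in _ * X]big1 ?mulr1.
  rewrite big_imset/=; last by move=> ? ? _ _; exact: inj.
  apply: eq_big => [b|b _]; first by rewrite inE.
  rewrite (big_pred1 (U b))// => x; apply/forallP/eqP => [/(_ b)|-> b'].
    by rewrite eqxx => /eqP.
  by apply/implyP => /eqP /inj ->.
move=> a aN; rewrite -[RHS]mu1; apply: eq_bigl => x.
apply/forallP => b; apply/implyP => /eqP ab.
by move: aN; rewrite -ab imset_f.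
Qed.

(** Choosing from each column of an independent array the entry of a
    prescribed row leaves an independent sample. It allows one random tuple,
    split by a Tverberg partition, to be replaced by several independent
    tuples. *)
Lemma marginal_rows (K N X : finType) (mu : X -> R) (g : N -> K)
    (h : {ffun N -> X} -> R) : prob mu ->
  \sum_(T : {ffun K -> {ffun N -> X}}) pw (pw mu) T * h [ffun l => T (g l) l] =
  \sum_U pw mu U * h U.
Proof.
move=> [mu0 mu1].
rewrite (partition_big (fun T : {ffun K -> {ffun N -> X}} => [ffun l => T (g l) l]) predT)//=.
apply: eq_bigr => U _.
transitivity (\sum_(T : {ffun K -> {ffun N -> X}} | [ffun l => T (g l) l] == U) pw (pw mu) T * h U).
  by apply: eq_bigr => T /eqP ->.
rewrite -mulr_suml; congr (_ * _).
pose Q r := [pred row : {ffun N -> X} | [forall l, (g l == r) ==> (row l == U l)]].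
rewrite (eq_bigl (fun T => T \in family Q)); last first.
  move=> T; apply/eqP/familyP => [e r|h' ].
    by rewrite inE; apply/forallP => l; apply/implyP => /eqP <-; rewrite -e ffunE.
  apply/ffunP => l; rewrite ffunE.
  by have := h' (g l); rewrite inE => /forallP/(_ l); rewrite eqxx => /eqP.
rewrite {1}/pw -(bigA_distr_big_dep _ (fun _ => pw mu))/=.
transitivity (\prod_r \prod_l (if g l == r then mu (U l) else 1)).
  apply: eq_bigr => r _.
  pose Q' l := [pred x | (g l == r) ==> (x == U l)].
  rewrite (eq_bigl (fun T => T \in family Q')); last first.
    by move=> T; apply/forallP/familyP => h' l; exact: h'.
  rewrite /pw -(bigA_distr_big_dep _ (fun _ => mu))/=.
  apply: eq_bigr => l _; case: eqP => _ /=; last by rewrite -[RHS]mu1; apply: eq_bigl.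
  by rewrite (big_pred1 (U l)).
rewrite exchange_big/=; apply: eq_bigr => l _.
by rewrite (bigD1 (g l))//= eqxx big1 ?mulr1// => r; rewrite eq_sym => /negbTE ->.
Qed.

(** A tuple is drawn by drawing its entry at [a] last. *)
Lemma sum_ffun_ins (I : finType) n (a : 'I_n.+1) (F : {ffun 'I_n.+1 -> I} -> R) :
  \sum_T F T = \sum_(S : {ffun 'I_n -> I}) \sum_i
     F [ffun b => if unlift a b is Some k then S k else i].
Proof.
rewrite pair_bigA/=.
pose f (p : {ffun 'I_n -> I} * I) : {ffun 'I_n.+1 -> I} :=
  [ffun b => if unlift a b is Some k then p.1 k else p.2].
rewrite (reindex f)//=.
exists (fun T => ([ffun k => T (lift a k)], T a)) => [[S i] _|T _].
  congr pair; last by rewrite ffunE unlift_none.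
  by apply/ffunP => k; rewrite !ffunE liftK.
by apply/ffunP => b; rewrite ffunE; case: unliftP => [k ->|->]/=; rewrite ?ffunE.
Qed.

End ProductWeights.

Section FractionalHelly.
Context {R : realType} {n : nat}.
Let V := 'rV[R]_n.

Lemma dotv_ball_cvx (c : R) : cvx [set y : V | dotv y y < c].
Proof.
move=> x y t /= hx hy t0 t1.
have t1' : 0 <= 1 - t by rewrite subr_ge0.
have : 0 <= t * (1 - t) * dotv (x - y) (x - y) by rewrite !mulr_ge0// dotv_ge0.
rewrite !(dotvDl, dotvDr, dotvZl, dotvZr, dotvNl, dotvNr) (dotvC y x).
have [->|tn0] := eqVneq t 0; first by rewrite !mul0r !subr0 !mul1r; lra.
have tp : 0 < t by rewrite lt_neqAle eq_sym tn0.
have : t * dotv x x < t * c by rewrite ltr_pM2l.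
have : (1 - t) * dotv y y <= (1 - t) * c by rewrite ler_wpM2l// ltW.
lra.
Qed.

(** [x S] is the point of least norm of the intersection of the n sets of
    [S]. If n + 1 sets meet, the point p0 of least norm of their
    intersection is already that of n of them. Otherwise any n of these sets
    meet the open ball of radius |p0|, and Helly's theorem for the n + 1
    sets and the ball gives a common point of norm less than |p0|. *)
Lemma min_norm_selection (I : finType) (G : I -> set V) :
  (forall i, cvx (G i)) -> (forall i, closed (G i)) ->
  exists x : {ffun 'I_n -> I} -> V, forall T : {ffun 'I_n.+1 -> I},
    (exists z, forall a, G (T a) z) ->
    exists a, G (T a) (x [ffun k => T (lift a k)]).
Proof.
move=> cG clG.
have mins (J : finType) (S : J -> I) : exists p, (exists z, forall k, G (S k) z) ->
    (forall k, G (S k) p) /\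
    forall y, (forall k, G (S k) y) -> dotv (0 - p) (0 - p) <= dotv (0 - y) (0 - y).
  have [[z hz]|h] := pselect (exists z, forall k, G (S k) z); last by exists 0.
  have [| |p [hp pm]] := @closest_exists R n (\bigcap_k G (S k)) 0.
  - by apply: closed_bigI => k _; exact: clG.
  - by exists z => k _; exact: hz.
  exists p => _; split => [k|y hy]; first exact: hp.
  by apply: pm => k _; exact: hy.
have /choice[x xP] := fun S : {ffun 'I_n -> I} => mins _ S.
exists x => T Tz.
have [p0 /(_ Tz)[p0T p0m]] := mins _ T.
(* index 0 is the open ball, index a + 1 the set of entry a *)
pose H (k : 'I_n.+2) := if unlift ord0 k is Some a then G (T a)
  else [set y | dotv y y < dotv p0 p0].
have noH : ~ exists z, forall k, H k z.
  move=> [z hz]; have := hz ord0; rewrite /H unlift_none /= ltNge => /negP; apply.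
  have := p0m z; rewrite !sub0r !dotvNl !dotvNr !opprK; apply => a.
  by have := hz (lift ord0 a); rewrite /H liftK.
have cH k : cvx (H k) by rewrite /H; case: unlift => [a|]//; exact: dotv_ball_cvx.
have [k hk] : exists k, ~ exists z, forall j, j != k -> H j z.
  by apply: contra_notP noH => /forallNP h; apply: helly => // k; exact/not_notP/h.
move: hk; case: (unliftP ord0 k) => [a ->|->] hk; last first.
  case: hk; move: Tz => [z hz]; exists z => j j0; rewrite /H.
  by case: unliftP j0 => [a ->|->]//; rewrite ?eqxx.
exists a; set S := [ffun _ => _].
have Sp0 b : G (S b) p0 by rewrite ffunE; exact: p0T.
have [xS xm] := xP S (ex_intro _ p0 Sp0).
suff -> : x S = p0 by [].
apply: (@closest_uniq _ _ (\bigcap_b G (S b)) 0).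
- by apply: cvx_bigcap => b _; exact: cG.
- by move=> b _; exact: Sp0.
- by move=> b _; exact: xS.
- move=> y hy; rewrite leNgt; apply/negP => lt; case: hk; exists y => j.
  rewrite /H; case: unliftP => [b ->|-> _]; last first.
    by move: lt; rewrite /= !sub0r !dotvNl !dotvNr !opprK.
  rewrite (inj_eq lift_inj) eq_sym => ba; have [c ->] := unlift_some ba.
  by have := hy c Logic.I; rewrite /S ffunE.
- by apply: xm.
Qed.

(** By [min_norm_selection] every intersecting (n+1)-tuple has an entry
    whose set contains the point [x] of the n other entries. Summing over
    the entry and averaging over the others finds one such point in sets of
    large weight. *)
Lemma frac_helly_closed (I : finType) (G : I -> set V) (w : I -> R) (alpha : R) :
  (forall i, cvx (G i)) -> (forall i, closed (G i)) -> prob w ->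
  alpha <= \sum_(T : {ffun 'I_n.+1 -> I}) pw w T * iverson R (exists z, forall a, G (T a) z) ->
  exists z, alpha / n.+1%:R <= \sum_i w i * iverson R (G i z).
Proof.
move=> cG clG pw_; have [w0 w1] := pw_; have [x xP] := min_norm_selection cG clG => aT.
pose Phi z := \sum_i w i * iverson R (G i z).
have h : alpha <= \sum_(S : {ffun 'I_n -> I}) pw w S * (n.+1%:R * Phi (x S)).
  apply: (le_trans aT).
  apply: (@le_trans _ _ (\sum_(T : {ffun 'I_n.+1 -> I}) \sum_a pw w T *
      iverson R (G (T a) (x [ffun k => T (lift a k)])))).
    apply: ler_sum => T _; have pT : 0 <= pw w T by exact: prodr_ge0.
    rewrite /iverson; case: asboolP => [/xP[a Ga]|_]; last first.
      by rewrite mulr0; apply: sumr_ge0 => a _; rewrite mulr_ge0// iverson_ge0.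
    rewrite (bigD1 a)//=; rewrite /iverson; case: asboolP => // _; rewrite lerDl.
    by apply: sumr_ge0 => b _; rewrite mulr_ge0// iverson_ge0.
  rewrite exchange_big/=.
  have -> : \sum_(S : {ffun 'I_n -> I}) pw w S * (n.+1%:R * Phi (x S)) =
      \sum_(a < n.+1) \sum_(S : {ffun 'I_n -> I}) pw w S * Phi (x S).
    rewrite exchange_big/=; apply: eq_bigr => S _.
    by rewrite sumr_const card_ord -[RHS]mulr_natl mulrCA.
  apply: ler_sum => a _; rewrite (sum_ffun_ins a); apply: ler_sum => S _.
  rewrite mulr_sumr; apply: ler_sum => i _.
  have -> : [ffun k => [ffun b => if unlift a b is Some k then S k else i] (lift a k)] = S.
    by apply/ffunP => k; rewrite !ffunE liftK.
  rewrite ffunE unlift_none /pw (bigD1_ord a)//= ffunE unlift_none.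
  rewrite (eq_bigr (fun k => w (S k))); last by move=> k _; rewrite ffunE liftK.
  by rewrite mulrCA mulrA.
apply: contrapT => /forallNP hz.
have [_ s1] := @pw_prob _ 'I_n _ _ pw_.
have neg S : 0 <= pw w S * (alpha - n.+1%:R * Phi (x S)).
  rewrite mulr_ge0 ?prodr_ge0// subr_ge0 -ler_pdivlMl//.
  by have /negP := hz (x S); rewrite -ltNge => /ltW; rewrite mulrC.
have : \sum_S pw w S * (alpha - n.+1%:R * Phi (x S)) <= 0.
  under eq_bigr do rewrite mulrBr.
  by rewrite sumrB -mulr_suml s1 mul1r subr_le0.
move=> le0; have /psumr_eq0P z0 : \sum_S pw w S * (alpha - n.+1%:R * Phi (x S)) = 0.
  by apply/eqP; rewrite eq_le le0 sumr_ge0.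
have : \sum_(S : {ffun 'I_n -> I}) pw w S = 0.
  apply: big1 => S _; have /eqP := z0 (fun S _ => neg S) S isT.
  rewrite mulf_eq0 => /orP[/eqP//|]; rewrite subr_eq0 => /eqP e.
  by case: (hz (x S)); rewrite e mulrC mulKf.
by rewrite s1 => /eqP; rewrite oner_eq0.
Qed.

(** Choose one witness for every intersecting subfamily and replace each set
    by the hull of the witnesses it contains: the same subfamilies
    intersect, and hulls of finite sets are closed. *)
Lemma frac_helly (I : finType) (G : I -> set V) (w : I -> R) (alpha : R) :
  (forall i, cvx (G i)) -> prob w ->
  alpha <= \sum_(T : {ffun 'I_n.+1 -> I}) pw w T * iverson R (exists z, forall a, G (T a) z) ->
  exists z, alpha / n.+1%:R <= \sum_i w i * iverson R (G i z).
Proof.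
move=> cG pw_ aT; have [w0 _] := pw_.
have /choice[W WP] (s : {set I}) : exists z, (exists z, forall i, i \in s -> G i z) ->
    forall i, i \in s -> G i z.
  have [[z hz]|h] := pselect (exists z, forall i, i \in s -> G i z); last by exists 0.
  by exists z.
pose A i := [set s : {set I} | (i \in s) && `[< exists z, forall i, i \in s -> G i z >]]%SET.
pose C i := hull_on (A i) W.
have CG i : C i `<=` G i.
  apply: hull_on_sub => // s; rewrite inE => /andP[is_ /asboolP hs].
  exact: WP.
have [| | | |z hz] := @frac_helly_closed _ C w alpha.
- by move=> i; exact: hull_on_cvx.
- by move=> i; apply: compact_closed; [exact: norm_hausdorff|exact: hull_on_compact].
- exact: pw_.
- apply: (le_trans aT); apply: ler_sum => T _; rewrite ler_wpM2l ?prodr_ge0//.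
  apply: iverson_le => -[z hz]; pose s := [set T a | a in 'I_n.+1]%SET.
  have hs : exists z, forall i, i \in s -> G i z.
    by exists z => i /imsetP[a _ ->]; exact: hz.
  exists (W s) => a; apply: hull_on_mem; rewrite inE imset_f//=.
  exact/asboolP.
exists z; apply: (le_trans hz); apply: ler_sum => i _; rewrite ler_wpM2l//.
by apply: iverson_le; exact: CG.
Qed.

End FractionalHelly.

(** * Selection lemma, weak nets, multiplicative weights *)

Section WeakNets.
Context {R : realType} {n : nat}.
Let V := 'rV[R]_n.

Lemma iversonT (P : Prop) : P -> iverson R P = 1.
Proof. by rewrite /iverson; case: asboolP. Qed.
Lemma iversonF (P : Prop) : ~ P -> iverson R P = 0.
Proof. by rewrite /iverson; case: asboolP. Qed.

(** First selection lemma for a probability measure. Some fixed way [g] of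
    splitting an N-tuple into n + 1 classes is a Tverberg partition with
    positive probability. Then n + 1 independent N-tuples have intersecting
    hulls with positive probability, because taking the class [r] from the
    r-th tuple is itself a random N-tuple; the fractional Helly theorem for
    the hulls of N-tuples concludes. *)
Lemma selection : exists (N : finType) (c : R), 0 < c /\
  forall (X : finType) (mu : X -> R) (v : X -> V), prob mu ->
    exists z, c <= \sum_(T : {ffun N -> X}) pw mu T *
                     iverson R (hull_on [set: N]%SET (v \o T) z).
Proof.
(* N points are enough for n + 1 classes *)
have [N tv] := @tverberg R n n.
pose M := #|{ffun N -> 'I_n.+1}|.
have M0 : (0 < M)%N by rewrite /M card_ffun expn_gt0 card_ord.
exists N, (M%:R^-1 / n.+1%:R); split; first by rewrite divr_gt0 ?invr_gt0 ?ltr0n.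
move=> X mu v mup; have [mu0 mu1] := mup.
pose works (g : {ffun N -> 'I_n.+1}) (U : {ffun N -> X}) :=
  exists z, forall r, hull_on [set l | g l == r]%SET (v \o U) z.
have [g hg] : exists g, M%:R^-1 <= \sum_U pw mu U * iverson R (works g U).
  have [|g] := @pigeon_sum R _ (fun g => \sum_U pw mu U * iverson R (works g U)) 1 ltr01.
    rewrite exchange_big/=; have [_ {1}<-] := @pw_prob R N X mu mup.
    apply: ler_sum => U _; have [g [z gz]] := tv (v \o U).
    rewrite (bigD1 g)//= iversonT ?mulr1 ?lerDl ?sumr_ge0//; last by exists z.
    by move=> g' _; rewrite mulr_ge0 ?prodr_ge0 ?iverson_ge0.
  by rewrite div1r => hg; exists g.
apply: (@frac_helly R n _ (fun T : {ffun N -> X} => hull_on [set: N]%SET (v \o T)) (pw mu)).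
- by move=> T; exact: hull_on_cvx.
- exact: pw_prob.
apply: (le_trans hg); rewrite -(@marginal_rows R 'I_n.+1 N X mu g _ mup).
apply: ler_sum => T _; rewrite ler_wpM2l//.
  by apply: prodr_ge0 => r _; apply: prodr_ge0.
apply: iverson_le => -[z hz]; exists z => r.
have [c [c0 cA c1 zE]] := hz r.
exists c; split => //; first by move=> l; rewrite inE.
rewrite zE; apply: eq_bigr => l _ /=; rewrite ffunE.
have [<-//|gr] := eqVneq (g l) r; rewrite cA ?scale0r//.
by rewrite inE.
Qed.

(** Greedy choice. As long as some [G j] of mass at least beta is missed,
    the selection lemma for the measure conditioned on [G j] gives a point
    of [G j] in the hulls of many tuples with entries in [G j]. The earlier
    points are in none of these hulls, so the mass [W] of the tuples whose
    hull meets the net grows by a fixed amount each time. *)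
Lemma weak_net (beta : R) : 0 < beta -> exists B : nat,
  forall (X J : finType) (mu : X -> R) (v : X -> V) (G : J -> set V),
    prob mu -> (forall j, cvx (G j)) ->
    exists net : seq V, [/\ (size net <= B)%N,
      forall z, z \in net -> exists j, G j z &
      forall j, beta <= \sum_x mu x * iverson R (G j (v x)) ->
        exists2 z, z \in net & G j z].
Proof.
move=> beta0; have [N [c [c0 sel]]] := selection.
pose e := c * beta ^+ #|N|.
have e0 : 0 < e by rewrite mulr_gt0// exprn_gt0.
exists (Num.bound e^-1) => X J mu v G mup cG; have [mu0 mu1] := mup.
pose good (net : seq V) := forall j, beta <= \sum_x mu x * iverson R (G j (v x)) ->
        exists2 z, z \in net & G j z.
pose W (net : seq V) := \sum_(T : {ffun N -> X}) pw mu T *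
   iverson R (exists2 z, z \in net & hull_on [set: N]%SET (v \o T) z).
have W1 net : W net <= 1.
  have [p0 <-] := @pw_prob R N X mu mup; apply: ler_sum => T _.
  by rewrite ler_piMr// /iverson; case: asboolP.
have step k : exists net : seq V, [/\ (size net <= k)%N,
    forall z, z \in net -> exists j, G j z & good net \/ k%:R * e <= W net].
  elim: k => [|k [net [sz ins [gd|Wk]]]].
  - exists [::]; split => //; right; rewrite mul0r; apply: sumr_ge0 => T _.
    by rewrite mulr_ge0 ?prodr_ge0 ?iverson_ge0.
  - by exists net; split; [exact: leqW| |left].
  have [gd|/existsNP[j /not_implyP[mj nj]]] := pselect (good net).
    by exists net; split; [exact: leqW| |left].
  set m := \sum_x _ in mj; have m0 : 0 < m by exact: lt_le_trans mj.
  pose mu' x := mu x * iverson R (G j (v x)) / m.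
  have mup' : prob mu'.
    split; first by move=> x; rewrite !mulr_ge0 ?iverson_ge0 ?invr_ge0 ?(ltW m0).
    by rewrite -mulr_suml mulfV// gt_eqF.
  have [z hz] := sel X mu' v mup'.
  have pwE (T : {ffun N -> X}) : m ^+ #|N| * pw mu' T = pw mu T * iverson R (forall l, G j (v (T l))).
    have -> : m ^+ #|N| = \prod_(l : N) m by rewrite prodr_const.
    rewrite /pw -big_split/=.
    rewrite (eq_bigr (fun l => mu (T l) * iverson R (G j (v (T l))))); last first.
      by move=> l _; rewrite /mu' mulrC divfK ?gt_eqF.
    rewrite big_split/=; congr (_ * _).
    have [h|h] := pselect (forall l, G j (v (T l))).
      by rewrite [RHS]iversonT// big1// => l _; rewrite iversonT.
    rewrite [RHS]iversonF//; have /existsNP[l nl] := h.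
    by rewrite (bigD1 l)//= iversonF// mul0r.
  have hullG (T : {ffun N -> X}) : (forall l, G j (v (T l))) -> hull_on [set: N]%SET (v \o T) `<=` G j.
    by move=> h; apply: hull_on_sub => // l _; exact: h.
  have Gz : G j z.
    have : 0 < \sum_(T : {ffun N -> X}) pw mu' T * iverson R (hull_on [set: N]%SET (v \o T) z).
      exact: lt_le_trans hz.
    apply: contraPP => nGz; apply/negP; rewrite -leNgt; apply: sumr_le0 => T _.
    have [hT|hT] := pselect (hull_on [set: N]%SET (v \o T) z); last by rewrite iversonF ?mulr0.
    rewrite iversonT// mulr1 -(@ler_pM2l _ (m ^+ #|N|)) ?exprn_gt0// mulr0 pwE iversonF ?mulr0//.
    by move=> /hullG/(_ z hT).
  exists (z :: net); split => //.
    by move=> y; rewrite inE => /orP[/eqP ->|/ins//]; exists j.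
  right; rewrite -natr1 mulrDl mul1r.
  apply: (@le_trans _ _ (W net + m ^+ #|N| * \sum_(T : {ffun N -> X}) pw mu' T *
      iverson R (hull_on [set: N]%SET (v \o T) z))).
    rewrite lerD// /e mulrC ler_pM ?exprn_ge0 ?(ltW c0) ?(ltW beta0)//.
    by apply: lerXn2r => //; rewrite nnegrE ltW.
  rewrite mulr_sumr -big_split/=; apply: ler_sum => T _.
  rewrite mulrA pwE -mulrA -mulrDr ler_wpM2l ?prodr_ge0//.
  have [h|h] := pselect (forall l, G j (v (T l))); last first.
    rewrite (iversonF h) mul0r addr0; apply: iverson_le => -[y ynet hy].
    by exists y => //; rewrite inE ynet orbT.
  rewrite (iversonT h) mul1r iversonF ?add0r.
    by apply: iverson_le => hy; exists z => //; rewrite inE eqxx.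
  by move=> [y ynet /(hullG _ h) Gy]; apply: nj; exists y.
have [net [sz ins [gd|Wb]]] := step (Num.bound e^-1); first by exists net.
exfalso; have := le_trans Wb (W1 net); rewrite leNgt => /negP; apply.
by rewrite -ltr_pdivrMr// div1r archi_boundP// invr_ge0 ltW.
Qed.

End WeakNets.

Section MultiplicativeWeights.
Context {R : realType}.

(** From Bernoulli's inequality for 1 + x and (1 - x)(1 + x) <= 1. *)
Lemma halving (x : R) (b : nat) : 0 <= x -> x <= 1 -> 1 <= b%:R * x -> (1 - x) ^+ b <= 2^-1.
Proof.
move=> x0 x1 bx.
have bern : forall k, 1 + k%:R * x <= (1 + x) ^+ k.
  elim=> [|k IH]; first by rewrite mul0r addr0 expr0.
  rewrite exprS; apply: (@le_trans _ _ ((1 + x) * (1 + k%:R * x))).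
    have : 0 <= k%:R * (x * x) by rewrite !mulr_ge0.
    rewrite -natr1; lra.
  by rewrite ler_wpM2l// addr_ge0.
have h2 : 2 <= (1 + x) ^+ b by apply: le_trans (bern b); lra.
have h1 : (1 - x) ^+ b * (1 + x) ^+ b <= 1.
  rewrite -exprMn exprn_ile1//; nra.
have p0 : 0 <= (1 - x) ^+ b by rewrite exprn_ge0// subr_ge0.
rewrite -[_^-1]mul1r ler_pdivlMr//; apply: le_trans h1; exact: ler_wpM2l.
Qed.

(** Halve the weight of every member hit by the chosen point and choose
    again. The total weight decays exponentially, at a rate depending on
    beta only, so after enough rounds every member must have been hit often:
    a member hit rarely would by itself weigh more than the bound on the
    total. *)
Lemma mult_weights (beta : R) : 0 < beta -> exists b : nat,
  forall (Y : Type) (I : finType) (hit : I -> Y -> Prop), (0 < #|I|)%N ->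
    (forall w : I -> R, prob w -> exists y, beta <= \sum_i w i * iverson R (hit i y)) ->
    exists s : seq Y, (0 < size s)%N /\
      forall i, (size s <= b * count (fun y => `[< hit i y >]) s)%N.
Proof.
move=> beta0; pose x := Num.min (beta / 2) 1.
have x0 : 0 < x by rewrite lt_min ltr01 andbT divr_gt0.
have x1 : x <= 1 by rewrite ge_min lexx orbT.
pose b := Num.bound x^-1.
have bx : 1 <= b%:R * x.
  by rewrite -ler_pdivrMr// div1r ltW// archi_boundP// invr_ge0 ltW.
have b0 : (0 < b)%N by rewrite lt0n; apply: contraTneq bx => ->; rewrite mul0r ler10.
exists (b * 2)%N => Y I hit I0 H.
pose h i (s : seq Y) := count (fun y => `[< hit i y >]) s.
(* the total weight after the rounds of s *)
pose Phi s := \sum_i (2^-1 : R) ^+ h i s.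
have Phi0 s : 0 < Phi s.
  have [i0 _] := card_gt0P I0.
  rewrite /Phi (bigD1 i0)//= ltr_wpDr ?exprn_gt0 ?invr_gt0//.
  by apply: sumr_ge0 => i _; rewrite exprn_ge0// invr_ge0.
have run k : exists s, size s = k /\ Phi s <= #|I|%:R * (1 - x) ^+ k.
  elim: k => [|k [s [sk hs]]].
    exists [::]; split => //; rewrite expr0 mulr1 /Phi (eq_bigr (fun=> 1)) ?sumr_const//.
  have [|y hy] := H (fun i => (2^-1) ^+ h i s / Phi s).
    split; first by move=> i; rewrite divr_ge0 ?exprn_ge0 ?invr_ge0// ltW.
    by rewrite -mulr_suml -/(Phi s) mulfV// gt_eqF.
  exists (y :: s); split; first by rewrite /= sk.
  rewrite exprS mulrCA; apply: (@le_trans _ _ ((1 - x) * Phi s)); last first.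
    by rewrite ler_wpM2l// subr_ge0.
  have -> : Phi (y :: s) = \sum_i (2^-1) ^+ h i s * (1 - iverson R (hit i y) / 2).
    apply: eq_bigr => i _; rewrite /h /= /iverson; case: asboolP => _ /=.
      by rewrite add1n exprS mulrC; congr (_ * _); field.
    by rewrite add0n mul0r subr0 mulr1.
  under eq_bigr do rewrite mulrBr mulr1 mulrA.
  rewrite sumrB mulrBl mul1r lerD2l lerN2 -mulr_suml.
  have : beta * Phi s <= \sum_i (2^-1) ^+ h i s * iverson R (hit i y).
    rewrite -ler_pdivlMr// mulr_suml; apply: (le_trans hy).
    by apply: ler_sum => i _; rewrite mulrAC.
  have xb : x <= beta / 2 by rewrite ge_min lexx.
  have := ler_wpM2r (ltW (Phi0 s)) xb; lra.
pose L := #|I|.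
(* 2 L rounds of halving beat the initial total L, since L < 2^L *)
have [s [sk hs]] := run (b * (2 * L))%N.
exists s; split; first by rewrite sk !muln_gt0 b0 I0.
move=> i; rewrite sk -mulnA leq_pmul2l// leq_pmul2l//.
rewrite leqNgt; apply/negP => lt.
have h1 : (2^-1 : R) ^+ h i s <= #|I|%:R * (2^-1) ^+ (2 * L).
  apply: le_trans (_ : Phi s <= _).
    rewrite /Phi (bigD1 i)//= lerDl; apply: sumr_ge0 => j _.
    by rewrite exprn_ge0// invr_ge0.
  apply: (le_trans hs); rewrite ler_wpM2l// exprM.
  apply: lerXn2r; rewrite ?nnegrE ?exprn_ge0 ?subr_ge0 ?invr_ge0//.
  by apply: halving => //; exact: ltW.
have h2 : (2^-1 : R) ^+ L < (2^-1) ^+ h i s.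
  by rewrite -subr_gt0 subr_gt0 ltr_iXn2l ?invr_gt0// invf_lt1// ltr1n.
have := lt_le_trans h2 h1; rewrite mulnC exprM expr2 mulrA -[ltLHS]mul1r.
rewrite ltr_pM2r ?exprn_gt0 ?invr_gt0// exprVn ltr_pdivlMr ?exprn_gt0// mul1r.
by rewrite -natrX ltr_nat ltnNge ltnW// /L ltn_expl.
Qed.

End MultiplicativeWeights.

(** * The coloured (p,q) theorem *)

Section PQ.
Context {R : realType} {n : nat}.
Let V := 'rV[R]_n.

Lemma inject_ord (X : finType) (A : {set X}) k : (k <= #|A|)%N ->
  exists f : 'I_k -> X, injective f /\ forall a, f a \in A.
Proof.
move=> kA; exists (fun a => enum_val (widen_ord kA a)); split => [a b /enum_val_inj|a].
  by move=> /(congr1 val) /= /val_inj.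
exact: enum_valP.
Qed.

(** A tuple of length p (k + 1) either repeats a value k + 1 times or takes
    p distinct values. *)
Lemma repeat_or_spread (I : finType) (p k : nat) (T : {ffun 'I_(p * k.+1) -> I}) :
  (exists (i : I) (f : 'I_k.+1 -> 'I_(p * k.+1)), injective f /\ forall a, T (f a) = i) \/
  (exists f : 'I_p -> 'I_(p * k.+1), injective (T \o f)).
Proof.
pose fib i := [set a | T a == i]%SET.
have [/existsP[i hi]|/existsPn small] := boolP [exists i, (k.+1 <= #|fib i|)%N].
  left; exists i; have [f [fi fA]] := inject_ord hi.
  by exists f; split => // a; have := fA a; rewrite inE => /eqP.
right; pose A := [set T a | a in 'I_(p * k.+1)]%SET.
have cA : (p <= #|A|)%N.
  rewrite -(@leq_pmul2r k.+1)//.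
  have -> : (p * k.+1 = \sum_(a : 'I_(p * k.+1)) 1)%N by rewrite sum1_card card_ord.
  rewrite (partition_big T (fun i => i \in A))/=; last by move=> a _; exact: imset_f.
  rewrite -sum_nat_const; apply: leq_sum => i _.
  have := small i; rewrite -ltnNge => /ltnW; apply: leq_trans.
  by rewrite sum1dep_card leq_eqVlt; apply/orP; left; apply/eqP; apply: eq_card => a; rewrite !inE.
have [f [fi fA]] := inject_ord cA.
have /choice[g gf] a : exists b, T b = f a by have /imsetP[b _ ->] := fA a; exists b.
by exists g => a b /=; rewrite !gf => /fi.
Qed.

(** In a random tuple of p (n + 1) members, n + 1 positions have members
    with a common point in one colour: either the same member n + 1 times,
    or p distinct members, q > n of which meet. Some fixed choice of
    positions and colour thus works with probability at least 1 / M, and the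
    fractional Helly theorem gives a point carrying the fraction [beta] of
    any weighting. Multiplicative weights turn this into a sequence [s]
    hitting all members in proportion 1 / b. Every member is then hit in
    proportion 1 / (b m) by the points of one colour, and a weak net for
    each colour suffices. *)
Theorem pq_coloured (m p q : nat) : (n < q)%N -> (q <= p)%N -> exists c : nat,
  forall (I : finType) (G : I -> 'I_m -> set V),
    (forall i j, cvx (G i j)) -> (forall i, exists j z, G i j z) ->
    (forall f : 'I_p -> I, injective f -> exists s : {set 'I_p}, #|s| = q /\
       exists j z, forall a, a \in s -> G (f a) j z) ->
    exists net : seq ('I_m * V), [/\ (size net <= c)%N,
      forall e, e \in net -> exists i, G i e.1 e.2 &
      forall i, exists2 e, e \in net & G i e.1 e.2].
Proof.
move=> nq qp.
pose K := n.+1; pose P := (p * n.+1)%N.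
pose M := #|{: {ffun 'I_K -> 'I_P} * 'I_m}|.
pose beta : R := 1 / M%:R / n.+1%:R.
have [m0|m0] := posnP m.
  exists 0%N => I G _ ne _; exists [::]; split => // i.
  by have [j] := ne i; have := ltn_ord j; rewrite [X in (_ < X)%N]m0.
have P0 : (0 < P)%N by rewrite muln_gt0; lia.
have M0 : (0 < M)%N by rewrite /M card_prod card_ffun !card_ord muln_gt0 expn_gt0 P0.
have beta0 : 0 < beta by rewrite !divr_gt0 ?ltr0n.
have [b mw] := mult_weights beta0.
pose gam : R := ((b * m).+1%:R)^-1.
have gam0 : 0 < gam by rewrite invr_gt0.
have [B wn] := @weak_net R n gam gam0.
exists (m * B)%N => I G cG ne hpq.
have [I0|I0] := posnP #|I|.
  by exists [::]; split => // i; have := card0_eq I0 i; rewrite inE.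
pose hit i (e : 'I_m * V) := G i e.1 e.2.
have [s [s0 hs]] : exists s : seq ('I_m * V), (0 < size s)%N /\
    forall i, (size s <= b * count (fun e => `[< hit i e >]) s)%N.
  apply: mw => // w wp; have [w0 w1] := wp.
  (* the positions e.1 of the tuple T have a common point of colour e.2 *)
  pose ev (e : {ffun 'I_K -> 'I_P} * 'I_m) (T : {ffun 'I_P -> I}) :=
    injective e.1 /\ exists z, forall a, G (T (e.1 a)) e.2 z.
  have [|e he] := @pigeon_sum R _ (fun e => \sum_T pw w T * iverson R (ev e T)) 1 ltr01.
    rewrite exchange_big/=; have [_ {1}<-] := @pw_prob R 'I_P I w wp.
    apply: ler_sum => T _.
    have [[f j] ef] : exists e, ev e T.
      have [[i [f [fi fT]]]|[f fi]] := repeat_or_spread T.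
        have [j [z hz]] := ne i; exists ([ffun a => f a], j); split => /=.
          by move=> a a'; rewrite !ffunE => /fi.
        by exists z => a; rewrite ffunE fT.
      have [t [tq [j [z hz]]]] := hpq _ fi.
      have [|g [gi gt]] := @inject_ord _ t K; first by rewrite tq.
      exists ([ffun a => f (g a)], j); split => /=.
        move=> a a'; rewrite !ffunE => ff; apply: gi; apply: fi => /=.
        by rewrite ff.
      by exists z => a; rewrite ffunE; exact: hz.
    rewrite (bigD1 (f, j))//= iversonT ?mulr1 ?lerDl ?sumr_ge0//.
    by move=> g' _; rewrite mulr_ge0 ?prodr_ge0 ?iverson_ge0.
  have einj : injective e.1.
    apply: contrapT => ne'; move: he; rewrite big1 ?leNgt ?divr_gt0 ?ltr0n//.
    by move=> T _; rewrite iversonF ?mulr0// => -[].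
  have [|z hz] := @frac_helly R n I (fun i => G i e.2) w (1 / M%:R) (fun i => cG i e.2) wp.
    apply: (le_trans he).
    rewrite -(@marginal_sub R 'I_P 'I_K I w e.1 _ wp einj).
    apply: ler_sum => T _; rewrite ler_wpM2l ?prodr_ge0//.
    by apply: iverson_le => -[_ [z hz]]; exists z => a; rewrite ffunE.
  by exists (e.2, z).
pose X := 'I_(size s).
pose pt (t : X) := tnth (in_tuple s) t.
pose N (j : 'I_m) : R := \sum_(t : X) ((pt t).1 == j)%:R.
have net_j (j : 'I_m) : exists net : seq V, [/\ (size net <= B)%N,
    forall z, z \in net -> exists i, G i j z &
    forall i, (size s <= b * m * count (fun e => `[< hit i e >] && (e.1 == j)) s)%N ->
       exists2 z, z \in net & G i j z].
  have cntE i : (count (fun e => `[< hit i e >] && (e.1 == j)) s)%:R =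
     \sum_(t : X) ((pt t).1 == j)%:R * iverson R (G i j (pt t).2).
    rewrite -sum1_count natr_sum (big_tnth _ _ s) big_mkcond/=; apply: eq_bigr => t _.
    rewrite -/(pt t) /iverson /hit.
    case: eqP => [<-|_]; rewrite ?andbF ?mul0r// andbT mul1r.
    by case: asboolP.
  have [Nj0|Nj0] := eqVneq (N j) 0.
    exists [::]; split => // i; rewrite leqNgt => /negP[].
    suff -> : count (fun e => `[< hit i e >] && (e.1 == j)) s = 0%N by rewrite muln0.
    apply/eqP; rewrite -(eqr_nat R) cntE eq_le; apply/andP; split.
      rewrite -[leRHS]Nj0; apply: ler_sum => t _; rewrite ler_piMr//.
      by rewrite /iverson; case: asboolP.
    by apply: sumr_ge0 => t _; rewrite mulr_ge0 ?iverson_ge0.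
  have Np : 0 < N j by rewrite lt_neqAle eq_sym Nj0 sumr_ge0.
  have mup : prob (fun t : X => ((pt t).1 == j)%:R / N j).
    split; first by move=> t; rewrite divr_ge0// ltW.
    by rewrite -mulr_suml mulfV.
  have [net [sz ins hit_]] := wn X I _ (fun t => (pt t).2) (fun i => G i j) mup (fun i => cG i j).
  exists net; split => // i hi; apply: hit_.
  under eq_bigr do rewrite mulrAC.
  rewrite -mulr_suml -cntE ler_pdivlMr// /gam mulrC ler_pdivrMr ?ltr0n//.
  apply: (@le_trans _ _ (size s)%:R).
    rewrite /N; apply: (@le_trans _ _ (\sum_(t : X) 1)).
      by apply: ler_sum => t _; case: eqP.
    by rewrite sumr_const card_ord.
  rewrite -natrM ler_nat mulnC; apply: (leq_trans hi).
  by rewrite leq_mul2r leqnSn orbT.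
have /choice[nets netsP] := net_j.
exists (flatten [seq [seq (j, z) | z <- nets j] | j <- enum 'I_m]); split.
- rewrite size_flatten /shape -map_comp sumnE big_map big_enum/=.
  rewrite -[m in leqRHS]card_ord -sum_nat_const; apply: leq_sum => j _ /=.
  by rewrite size_map; have [] := netsP j.
- move=> e /flattenP[_ /mapP[j _ ->] /mapP[z zj ->]] /=.
  by have [_ h _] := netsP j; exact: h.
- move=> i; have [j hj] : exists j,
      (size s <= b * m * count (fun e => `[< hit i e >] && (e.1 == j)) s)%N.
    apply: contrapT => /forallNP hN.
    have : (size s * m < size s * m)%N.
      apply: (@leq_ltn_trans (b * m * count (fun e => `[< hit i e >]) s)).
        by rewrite mulnAC leq_mul2r hs orbT.
      have -> : count (fun e => `[< hit i e >]) s =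
          (\sum_(j < m) count (fun e => `[< hit i e >] && (e.1 == j)) s)%N.
        rewrite -sum1_count.
        under [RHS]eq_bigr do rewrite -sum1_count.
        rewrite (exchange_big_dep (fun e => `[< hit i e >]))/=; last by move=> j e _ /andP[].
        apply: eq_bigr => e he; rewrite (big_pred1 e.1)// => j.
        by rewrite he eq_sym.
      rewrite big_distrr/= [ltnRHS]mulnC -[X in (_ < X * _)%N]card_ord -sum_nat_const.
      have lt_ j : (b * m * count (fun e => `[< hit i e >] && (e.1 == j)) s < size s)%N.
        by rewrite ltnNge; apply/negP/hN.
      rewrite (bigD1 (Ordinal m0))//= [ltnRHS](bigD1 (Ordinal m0))//=.
      rewrite -addSn; apply: leq_add; first exact: lt_.
      by apply: leq_sum => j _; exact: ltnW.
    by rewrite ltnn.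
  have [_ _ h] := netsP j; have [z zn Gz] := h i hj.
  exists (j, z) => //; apply/flattenP; exists [seq (j, z) | z <- nets j].
    by apply: map_f; rewrite mem_enum.
  exact: map_f.
Qed.

End PQ.

(** * Hausdorff measure as an outer measure *)

Section Hausdorff.
Context {R : realType}.
Local Open Scope ereal_scope.

Lemma ball_volume_ge0 n : (0 <= ball_volume R n)%R.
Proof.
elim/ltn_ind: n => -[|[|n]] IH //=.
by rewrite !mulr_ge0 ?invr_ge0 ?pi_ge0// IH.
Qed.

Lemma expe_le (x y : \bar R) n : 0 <= x -> x <= y -> x ^+ n <= y ^+ n.
Proof.
move=> x0 xy; elim: n => [|n IH]; first by rewrite !expe0.
by rewrite !expeS lee_pmul// expe_ge0.
Qed.

Lemma expeMl (a : R) (x : \bar R) n : (a%:E * x) ^+ n = (a ^+ n)%:E * x ^+ n.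
Proof.
elim: n => [|n IH]; first by rewrite !expe0 expr0 mule1.
by rewrite !expeS IH exprS EFinM muleACA.
Qed.

Section Fixed.
Context {d : nat}.
Implicit Types (U A B : set 'rV[R]_d).

Lemma diam_ub U x y : U x -> U y -> (enorm (x - y))%:E <= diam U.
Proof.
move=> Ux Uy; rewrite -euclid_distE; apply: ereal_sup_ubound.
by exists x => //; exists y.
Qed.

Lemma diam_le_ub U (c : \bar R) :
  (forall x y, U x -> U y -> (enorm (x - y))%:E <= c) -> diam U <= c.
Proof.
by move=> h; apply: ge_ereal_sup => _ [x Ux [y Uy <-]]; rewrite euclid_distE; exact: h.
Qed.

Lemma diam_ge0 U : U !=set0 -> 0 <= diam U.
Proof. by move=> [x Ux]; have := diam_ub Ux Ux; rewrite subrr enorm0. Qed.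

Lemma hw0 s : hausdorff_weight s (@set0 'rV[R]_d) = 0.
Proof. by rewrite /hausdorff_weight; case: asboolP. Qed.

Lemma hwE s U : U !=set0 ->
  hausdorff_weight s U = (ball_volume R s)%:E * (diam U * (2^-1)%:E) ^+ s.
Proof. by rewrite /hausdorff_weight; case: asboolP => // -> []. Qed.

Lemma hw_ge0 s U : 0 <= hausdorff_weight s U.
Proof.
rewrite /hausdorff_weight; case: asboolP => // /eqP/set0P U0.
rewrite mule_ge0 ?lee_fin ?ball_volume_ge0// expe_ge0// mule_ge0 ?diam_ge0//.
Qed.

Lemma hsum_ge0 s (U : nat -> set 'rV[R]_d) :
  0 <= \sum_(0 <= i <oo) hausdorff_weight s (U i).
Proof. by apply: nneseries_ge0 => i _ _; exact: hw_ge0. Qed.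

Lemma hc_ge0 s (delta : R) A : 0 <= hausdorff_content s delta A.
Proof. by apply: le_ereal_inf_tmp => _ [U _ <-]; exact: hsum_ge0. Qed.

Lemma hc_le s (delta : R) A B : A `<=` B ->
  hausdorff_content s delta A <= hausdorff_content s delta B.
Proof.
move=> AB; apply: ereal_inf_le_tmp => _ [U [BU dU] <-]; exists U => //.
by split => //; exact: subset_trans BU.
Qed.

Lemma hc_anti s (delta delta' : R) A : (delta <= delta')%R ->
  hausdorff_content s delta' A <= hausdorff_content s delta A.
Proof.
move=> dd; apply: ereal_inf_le_tmp => _ [U [BU dU] <-]; exists U => //.
by split => // i; rewrite (le_trans (dU i))// lee_fin.
Qed.

Lemma hc_cover s (delta : R) A (U : nat -> set 'rV[R]_d) :
  A `<=` \bigcup_i U i -> (forall i, diam (U i) <= delta%:E) ->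
  hausdorff_content s delta A <= \sum_(0 <= i <oo) hausdorff_weight s (U i).
Proof. by move=> AU dU; apply: ereal_inf_lbound; exists U. Qed.

Lemma hc_leH s (delta : R) A : (0 < delta)%R ->
  hausdorff_content s delta A <= hausdorff_measure s A.
Proof. by move=> d0; apply: ereal_sup_ubound; exists delta. Qed.

Lemma H_le_ub s A (c : \bar R) :
  (forall delta : R, (0 < delta)%R -> hausdorff_content s delta A <= c) ->
  hausdorff_measure s A <= c.
Proof. by move=> h; apply: ge_ereal_sup => _ [delta d0 <-]; exact: h. Qed.

Lemma H_ge0 s A : 0 <= hausdorff_measure s A.
Proof. by apply: (le_trans (hc_ge0 s 1 A)); exact: hc_leH. Qed.

Lemma H_le s A B : A `<=` B -> hausdorff_measure s A <= hausdorff_measure s B.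
Proof.
move=> AB; apply: H_le_ub => delta d0; apply: (le_trans (hc_le s delta AB)).
exact: hc_leH.
Qed.

(** The standard argument for outer measures: near-optimal covers of the
    sets A_n with errors e / 2^(n+1), rearranged as one sequence along a
    bijection between nat and nat * nat. *)
Lemma hc_sigma s (delta : R) (A : nat -> set 'rV[R]_d) :
  hausdorff_content s delta (\bigcup_n A n) <= \sum_(0 <= n <oo) hausdorff_content s delta (A n).
Proof.
have [[i ioo]|] := pselect (exists i, hausdorff_content s delta (A i) = +oo).
  rewrite (eseries_pinfty _ _ ioo) ?leey// => n _.
  by rewrite -ltNye (lt_le_trans _ (hc_ge0 _ _ _)).
rewrite -forallNE => Aoo.
apply/lee_addgt0Pr => e e0.
rewrite (le_trans _ (epsilon_trick _ _ (ltW e0)))//; last first.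
  by move=> n; exact: hc_ge0.
have /choice[G PG] n : exists U : nat -> set 'rV[R]_d,
    (A n `<=` \bigcup_i U i /\ forall i, diam (U i) <= delta%:E) /\
    \sum_(0 <= i <oo) hausdorff_weight s (U i) <=
      hausdorff_content s delta (A n) + (e / (2 ^ n.+1)%:R)%:E.
  have en1 : (0 < e / (2 ^ n.+1)%:R)%R by rewrite divr_gt0// ltr0n expn_gt0.
  have fn : hausdorff_content s delta (A n) \is a fin_num.
    by rewrite ge0_fin_numE ?hc_ge0// ltey; apply/eqP/Aoo.
  have [_ [U hU <-] lt] := lb_ereal_inf_adherent en1 fn.
  by exists U; split => //; exact: ltW.
pose w (p : nat * nat) := hausdorff_weight s (G p.1 p.2).
have w0 p : 0 <= w p by exact: hw_ge0.
apply: (@le_trans _ _ (\esum_(p in setT) w p)).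
  have /card_esym/ppcard_eqP[f] := card_nat2.
  apply: (@le_trans _ _ (\sum_(0 <= i <oo) w (f i))).
    apply: (@hc_cover s delta _ (fun i => G (f i).1 (f i).2)) => [t [n _ /(PG n).1.1[j _ Gt]]|i].
      by exists (f^-1%FUN (n, j)) => //=; rewrite invK ?inE.
    exact: (PG _).1.2.
  rewrite nneseries_esumT; last by move=> i; exact: w0.
  rewrite le_eqVlt; apply/orP; left; apply/eqP.
  rewrite [RHS](reindex_esum setT _ f)//.
rewrite (_ : esum _ _ = \sum_(0 <= i <oo) \sum_(0 <= j <oo) w (i, j)); last first.
  pose J : nat -> set (nat * nat) := fun i => [set (i, j) | j in setT].
  rewrite (_ : setT = \bigcup_k J k); last first.
    by rewrite predeqE => -[a b]; split => // _; exists a => //; exists b.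
  rewrite esum_bigcupT /=; last 2 first.
    - apply/trivIsetP => i j _ _ ij.
      rewrite predeqE => -[n m] /=; split => //= -[] [_] _ [<-{n} _].
      by move=> [m' _] [] /esym/eqP; rewrite (negbTE ij).
    - by [].
  rewrite -nneseries_esumT; last by move=> n; exact: esum_ge0.
  apply: eq_eseriesr => i _.
  rewrite nneseries_esumT; last by move=> j; exact: w0.
  rewrite /J [LHS](reindex_esum setT _ (pair i))//.
  by split => [j _|? ? _ _ []//|_ [j _ <-]]; [exists j|exists j].
apply: lee_nneseries => n *; first by apply: nneseries_ge0 => *; exact: w0.
exact: (PG n).2.
Qed.

Lemma H_sigma s (A : nat -> set 'rV[R]_d) :
  hausdorff_measure s (\bigcup_n A n) <= \sum_(0 <= n <oo) hausdorff_measure s (A n).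
Proof.
apply: H_le_ub => delta d0; apply: (le_trans (hc_sigma _ _ _)).
by apply: lee_nneseries => n *; [exact: hc_ge0|exact: hc_leH].
Qed.

End Fixed.
End Hausdorff.

(** * Separated sets and Lipschitz maps *)

Section HausdorffFinite.
Context {R : realType}.
Local Open Scope ereal_scope.

(** Finite covers are countable covers padded with the empty set. *)
Lemma finite_subadd (T : Type) (mu : set T -> \bar R) (I : finType) (A : set T) (B : I -> set T) :
  mu set0 = 0 -> (forall A, 0 <= mu A) -> (forall A B, A `<=` B -> mu A <= mu B) ->
  (forall F : nat -> set T, mu (\bigcup_n F n) <= \sum_(0 <= n <oo) mu (F n)) ->
  (forall x, A x -> exists i, B i x) -> mu A <= \sum_i mu (B i).
Proof.
move=> mu0 muge mule musig AB.
pose F n := if (n < #|I|)%N =P true is ReflectT h then B (enum_val (Ordinal h)) else set0.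
apply: (@le_trans _ _ (mu (\bigcup_n F n))).
  apply: mule => x /AB[i Bix]; exists (enum_rank i) => //.
  rewrite /F; case: eqP => [h|]; last by rewrite ltn_ord.
  by rewrite (_ : Ordinal h = enum_rank i) ?enum_rankK//; exact: val_inj.
apply: (le_trans (musig F)).
rewrite (nneseries_split 0 #|I|); last by move=> k _; exact: muge.
rewrite add0n eseries0 ?adde0; last first.
  move=> i iI _; rewrite /F; case: eqP => [h|//].
  by move: iI; rewrite leqNgt h.
rewrite big_mkord (reindex (@enum_rank I))/=; last first.
  by exists enum_val => i _; [exact: enum_rankK|exact: enum_valK].
apply: lee_sum => i _; rewrite /F; case: eqP => [h|]; last by rewrite ltn_ord.
by rewrite (_ : Ordinal h = enum_rank i) ?enum_rankK//; exact: val_inj.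
Qed.

Section Fixed.
Context {d : nat}.
Implicit Types (U A B : set 'rV[R]_d).

Lemma diam0 : diam (@set0 'rV[R]_d) = -oo.
Proof.
rewrite /diam (_ : [set _ | _ in _ & _ in _] = set0) ?ereal_sup0//.
by apply/seteqP; split => // ? [].
Qed.

Lemma hc0 s (delta : R) : hausdorff_content s delta (@set0 'rV[R]_d) = 0.
Proof.
apply/eqP; rewrite eq_le hc_ge0 andbT.
apply: (le_trans (hc_cover (U := fun=> set0) s _ _)) => //.
  by move=> i; rewrite diam0 leNye.
by rewrite eseries0// => i _ _; rewrite hw0.
Qed.

Lemma H0 s : hausdorff_measure s (@set0 'rV[R]_d) = 0.
Proof.
apply/eqP; rewrite eq_le H_ge0 andbT; apply: H_le_ub => delta _.
by rewrite hc0.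
Qed.

Lemma hc_le_sum s (delta : R) (I : finType) A (B : I -> set 'rV[R]_d) :
  (forall x, A x -> exists i, B i x) ->
  hausdorff_content s delta A <= \sum_i hausdorff_content s delta (B i).
Proof.
apply: finite_subadd; [exact: hc0|exact: hc_ge0|exact: hc_le|exact: hc_sigma].
Qed.

Lemma H_le_sum s (I : finType) A (B : I -> set 'rV[R]_d) :
  (forall x, A x -> exists i, B i x) ->
  hausdorff_measure s A <= \sum_i hausdorff_measure s (B i).
Proof.
apply: finite_subadd; [exact: H0|exact: H_ge0|exact: H_le|exact: H_sigma].
Qed.

Lemma H_U s A B :
  hausdorff_measure s (A `|` B) <= hausdorff_measure s A + hausdorff_measure s B.
Proof.
have := @H_le_sum s bool (A `|` B) (fun b => if b then A else B).
rewrite big_bool/=; apply => x [Ax|Bx]; [by exists true|by exists false].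
Qed.

Lemma hc_diam s (delta : R) U : diam U <= delta%:E ->
  hausdorff_content s delta U <= hausdorff_weight s U.
Proof.
move=> dU; have d0 : diam (@set0 'rV[R]_d) <= delta%:E by rewrite diam0 leNye.
apply: (le_trans (hc_cover (U := fun i => if i is 0%N then U else set0) s _ _)).
- by move=> x Ux; exists 0%N.
- by case.
rewrite (nneseries_split 0 1); last by move=> k _; exact: hw_ge0.
rewrite add0n big_nat1 eseries0 ?adde0// => -[|i]// _ _; exact: hw0.
Qed.

(** A set of diameter less than [eta] meets at most one of [A] and [B], so
    every fine cover of the union splits into a cover of [A] and a cover of
    [B]. *)
Lemma hc_separated s (delta eta : R) A B : (delta < eta)%R ->
  (forall a b, A a -> B b -> (eta <= enorm (a - b))%R) ->
  hausdorff_content s delta A + hausdorff_content s delta B <=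
  hausdorff_content s delta (A `|` B).
Proof.
move=> de sep; apply: le_ereal_inf_tmp => _ [U [ABU dU] <-].
(* the members of the cover that meet C *)
pose W (C : set 'rV[R]_d) i := if `[< (U i) `&` C !=set0 >] then U i else set0.
have dW C i : diam (W C i) <= delta%:E.
  by rewrite /W; case: asboolP => _ //; rewrite diam0 leNye.
have cW C : C `<=` A `|` B -> C `<=` \bigcup_i W C i.
  move=> CAB x Cx; have [i _ Uix] := ABU x (CAB x Cx); exists i => //.
  by rewrite /W; case: asboolP => // -[]; exists x.
have hA := hc_cover s (cW A (@subsetUl _ _ _)) (dW A).
have hB := hc_cover s (cW B (@subsetUr _ _ _)) (dW B).
apply: (le_trans (leeD hA hB)).
rewrite -nneseriesD; [|by move=> i _ _; exact: hw_ge0|by move=> i _ _; exact: hw_ge0].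
apply: lee_nneseries => [i _ _|i _]; first by rewrite adde_ge0 ?hw_ge0.
rewrite /W; case: asboolP => [[a [Ua Aa]]|_]; case: asboolP => [[b [Ub Bb]]|_];
  rewrite ?hw0 ?adde0 ?add0e ?hw_ge0//.
have := le_trans (diam_ub Ua Ub) (dU i); rewrite lee_fin => h.
by have := lt_le_trans de (sep _ _ Aa Bb); rewrite ltNge h.
Qed.

(** [hc_separated] at a scale that is fine enough for both measures. *)
Lemma H_separated s (eta : R) A B : (0 < eta)%R ->
  (forall a b, A a -> B b -> (eta <= enorm (a - b))%R) ->
  hausdorff_measure s A + hausdorff_measure s B <= hausdorff_measure s (A `|` B).
Proof.
move=> eta0 sep.
have [->|fin] := eqVneq (hausdorff_measure s (A `|` B)) +oo; first by rewrite leey.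
have fA : hausdorff_measure s A \is a fin_num.
  rewrite ge0_fin_numE ?H_ge0//; apply: le_lt_trans (H_le s (@subsetUl _ A B)) _.
  by rewrite ltey.
have fB : hausdorff_measure s B \is a fin_num.
  rewrite ge0_fin_numE ?H_ge0//; apply: le_lt_trans (H_le s (@subsetUr _ A B)) _.
  by rewrite ltey.
apply/lee_addgt0Pr => e e0.
have e2 : (0 < e / 2)%R by rewrite divr_gt0.
have [_ [d1 d10 <-] h1] := ub_ereal_sup_adherent e2 fA.
have [_ [d2 d20 <-] h2] := ub_ereal_sup_adherent e2 fB.
pose dl := Num.min (Num.min d1 d2) (eta / 2)%R.
have dl0 : (0 < dl)%R by rewrite !lt_min d10 d20 divr_gt0.
have dl1 : (dl <= d1)%R by rewrite !ge_min lexx.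
have dl2 : (dl <= d2)%R by rewrite !ge_min lexx orbT.
have dle : (dl < eta)%R by rewrite gt_min ltr_pdivrMr// ltr_pMr// ltr1n orbT.
have k1 := lt_le_trans h1 (hc_anti s A dl1).
have k2 := lt_le_trans h2 (hc_anti s B dl2).
rewrite lteBlDr// in k1; rewrite lteBlDr// in k2.
apply: (le_trans (leeD (ltW k1) (ltW k2))).
rewrite addeACA -EFinD -splitr leeD2r//.
apply: (le_trans (hc_separated s dle sep)); exact: hc_leH.
Qed.

End Fixed.

(** A Lipschitz bound between two parametrizations [f1], [f2] of images of
    one set: this covers Lipschitz maps, scalings, isometries and
    comparisons of linear maps without inverses. *)
Lemma H_lipschitz s (X : Type) (S : set X) d1 d2 (f1 : X -> 'rV[R]_d1)
    (f2 : X -> 'rV[R]_d2) (L : R) : (0 < L)%R ->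
  (forall x y, S x -> S y -> (enorm (f1 x - f1 y) <= L * enorm (f2 x - f2 y))%R) ->
  hausdorff_measure s (f1 @` S) <= (L ^+ s)%:E * hausdorff_measure s (f2 @` S).
Proof.
move=> L0 lip; apply: H_le_ub => delta d0.
have Ls0 : (0 < L ^+ s)%R by rewrite exprn_gt0.
apply: (@le_trans _ _ ((L ^+ s)%:E * hausdorff_content s (delta / L) (f2 @` S))); last first.
  by rewrite lee_wpmul2l ?lee_fin ?(ltW Ls0)//; apply: hc_leH; rewrite divr_gt0.
rewrite -lee_pdivrMl//; apply: le_ereal_inf_tmp => _ [U [SU dU] <-].
rewrite lee_pdivrMl// -nneseriesZl; last by move=> i _; exact: hw_ge0.
pose W i := f1 @` (S `&` f2 @^-1` U i).
have dW i : diam (W i) <= L%:E * diam (U i).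
  apply: diam_le_ub => _ _ [x [Sx Ux] <-] [y [Sy Uy] <-].
  apply: (@le_trans _ _ (L%:E * (enorm (f2 x - f2 y))%:E)).
    by rewrite -EFinM lee_fin; exact: lip.
  by rewrite lee_wpmul2l ?lee_fin ?(ltW L0)//; exact: diam_ub.
apply: (le_trans (hc_cover (U := W) s _ _)).
- by move=> _ [x Sx <-]; have [|i _ Ui] := SU (f2 x); [exists x|exists i => //; exists x].
- move=> i; apply: (le_trans (dW i)).
  apply: (@le_trans _ _ (L%:E * (delta / L)%:E)).
    by rewrite lee_wpmul2l ?lee_fin ?(ltW L0).
  by rewrite -EFinM lee_fin mulrCA mulfV ?mulr1// gt_eqF.
apply: lee_nneseries => [i _ _|i _]; first exact: hw_ge0.
have [W0|/eqP/set0P W0] := pselect (W i = set0).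
  by rewrite W0 hw0 mule_ge0 ?hw_ge0// lee_fin ltW.
have U0 : U i !=set0 by have [_ [x [_ Ux] _]] := W0; exists (f2 x).
rewrite !hwE// muleCA lee_wpmul2l ?lee_fin ?ball_volume_ge0//.
rewrite -expeMl muleA; apply: expe_le.
  by rewrite mule_ge0 ?diam_ge0// lee_fin invr_ge0.
by rewrite lee_wpmul2r// lee_fin invr_ge0.
Qed.

Lemma H_isometric s (X : Type) (S : set X) d1 d2 (f1 : X -> 'rV[R]_d1)
    (f2 : X -> 'rV[R]_d2) :
  (forall x y, S x -> S y -> enorm (f1 x - f1 y) = enorm (f2 x - f2 y)) ->
  hausdorff_measure s (f1 @` S) = hausdorff_measure s (f2 @` S).
Proof.
move=> iso; apply/eqP; rewrite eq_le; apply/andP; split.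
  have := @H_lipschitz s X S d1 d2 f1 f2 1%R ltr01; rewrite expr1n mul1e; apply.
  by move=> x y Sx Sy; rewrite mul1r iso.
have := @H_lipschitz s X S d2 d1 f2 f1 1%R ltr01; rewrite expr1n mul1e; apply.
by move=> x y Sx Sy; rewrite mul1r iso.
Qed.

Lemma H_scale s d (A : set 'rV[R]_d) (a : R) (t : 'rV[R]_d) : (0 < a)%R ->
  hausdorff_measure s [set a *: x + t | x in A]%R = (a ^+ s)%:E * hausdorff_measure s A.
Proof.
move=> a0.
have E (x y : 'rV[R]_d) : (enorm (a *: x + t - (a *: y + t)) = a * enorm (x - y))%R.
  by rewrite opprD addrACA subrr addr0 -scalerBr enormZ gtr0_norm.
rewrite -[in RHS](image_id A); apply/eqP; rewrite eq_le; apply/andP; split.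
  by apply: H_lipschitz => // x y _ _; rewrite E.
rewrite -lee_pdivlMl ?exprn_gt0// -exprVn.
apply: H_lipschitz; rewrite ?invr_gt0// => x y _ _.
by rewrite E mulKf// gt_eqF.
Qed.

Lemma H_translate s d (A : set 'rV[R]_d) (t : 'rV[R]_d) :
  hausdorff_measure s [set x + t | x in A]%R = hausdorff_measure s A.
Proof.
have := H_scale s A t ltr01; rewrite expr1n mul1e => <-; congr hausdorff_measure.
by apply: eq_imagel => x _; rewrite scale1r.
Qed.

End HausdorffFinite.

(** * Hausdorff measure of linear images *)

Section LinearImages.
Context {R : realType}.

(** Matrices act on the right, as vectors are rows. *)
Definition imx m d (T : 'M[R]_(m, d)) (B : set 'rV[R]_m) : set 'rV[R]_d :=
  [set x *m T | x in B].

Definition bnd d (B : set 'rV[R]_d) := exists M : R, forall x, B x -> `|x| <= M.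

(** The measure as a real number, for sets where it is finite. *)
Definition hv s d (A : set 'rV[R]_d) : R := fine (hausdorff_measure s A).

Lemma hv_ge0 s d (A : set 'rV[R]_d) : 0 <= hv s A.
Proof. by rewrite fine_ge0// H_ge0. Qed.

Lemma hvE s d (A : set 'rV[R]_d) : (hausdorff_measure s A < +oo)%E ->
  hausdorff_measure s A = (hv s A)%:E.
Proof. by move=> fA; rewrite fineK// ge0_fin_numE ?H_ge0. Qed.

Lemma imx_sub m d (T : 'M[R]_(m, d)) A B : A `<=` B -> imx T A `<=` imx T B.
Proof. by move=> AB _ [x Ax <-]; exists x => //; exact: AB. Qed.

Lemma imx_comp m d e (T : 'M[R]_(m, d)) (S : 'M[R]_(d, e)) A :
  imx S (imx T A) = imx (T *m S) A.
Proof.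
apply/seteqP; split=> [_ [_ [x Ax <-] <-]|_ [x Ax <-]].
  by exists x => //; rewrite mulmxA.
by exists (x *m T); [exists x|rewrite mulmxA].
Qed.

Lemma imx1 m (A : set 'rV[R]_m) : imx 1%:M A = A.
Proof.
by apply/seteqP; split=> [_ [x Ax <-]|x Ax]; [rewrite mulmx1|exists x; rewrite ?mulmx1].
Qed.

Lemma imx_affine m d (T : 'M[R]_(m, d)) (a : R) (t : 'rV[R]_m) A :
  imx T [set a *: x + t | x in A] = [set a *: y + t *m T | y in imx T A].
Proof.
apply/seteqP; split=> [_ [_ [x Ax <-] <-]|_ [_ [x Ax <-] <-]].
  by exists (x *m T); [exists x|rewrite mulmxDl -scalemxAl].
by exists (a *: x + t); [exists x|rewrite mulmxDl -scalemxAl].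
Qed.

Lemma imx_cvx m d (T : 'M[R]_(m, d)) A : cvx A -> cvx (imx T A).
Proof.
move=> cA _ _ t [x Ax <-] [y Ay <-] t0 t1; exists (t *: x + (1 - t) *: y); first exact: cA.
by rewrite mulmxDl !scalemxAl.
Qed.

Lemma affine_cvx (V : lmodType R) (a : R) (t : V) (A : set V) : cvx A ->
  cvx [set a *: x + t | x in A].
Proof.
move=> cA _ _ u [x Ax <-] [y Ay <-] u0 u1; exists (u *: x + (1 - u) *: y); first exact: cA.
rewrite !scalerDr !scalerA [RHS]addrACA -scalerDl.
by rewrite [u + _]addrC subrK scale1r [a * u]mulrC [a * (1 - u)]mulrC.
Qed.

Lemma enorm_sum (I : Type) (r : seq I) d (F : I -> 'rV[R]_d) :
  enorm (\sum_(i <- r) F i) <= \sum_(i <- r) enorm (F i).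
Proof.
elim: r => [|i r IH]; first by rewrite !big_nil enorm0.
by rewrite !big_cons (le_trans (enormD _ _))// lerD2l.
Qed.

Lemma mulmx_lip m d (T : 'M[R]_(m, d)) : exists2 L : R, 0 < L &
  forall x, enorm (x *m T) <= L * enorm x.
Proof.
exists (1 + \sum_i enorm (row i T)); first by rewrite ltr_wpDr// sumr_ge0// => i _; exact: enorm_ge0.
move=> x; rewrite mulmx_sum_row (le_trans (enorm_sum _ _))//.
rewrite mulrDl mul1r mulr_suml; apply: ler_wpDl; first exact: enorm_ge0.
apply: ler_sum => i _; rewrite enormZ mulrC ler_wpM2l ?enorm_ge0//.
exact: coord_le_enorm.
Qed.

Lemma H_le_mx s m d1 d2 (T1 : 'M[R]_(m, d1)) (T2 : 'M[R]_(m, d2)) (L : R) B : 0 < L ->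
  (forall x, enorm (x *m T1) <= L * enorm (x *m T2)) ->
  (hausdorff_measure s (imx T1 B) <= (L ^+ s)%:E * hausdorff_measure s (imx T2 B))%E.
Proof.
by move=> L0 h; apply: H_lipschitz => // x y _ _; rewrite -!mulmxBl.
Qed.

Lemma H_same_norm s m d1 d2 (T1 : 'M[R]_(m, d1)) (T2 : 'M[R]_(m, d2)) B :
  (forall x, enorm (x *m T1) = enorm (x *m T2)) ->
  hausdorff_measure s (imx T1 B) = hausdorff_measure s (imx T2 B).
Proof. by move=> h; apply: H_isometric => x y _ _; rewrite -!mulmxBl. Qed.

Definition cube s : set 'rV[R]_s := [set x | forall i, 0 <= x 0 i <= 1].

(** The cells of the subdivision of the unit cube into n^s cubes of side 1 /
    n. *)
Definition cell s n (k : {ffun 'I_s -> 'I_n}) : set 'rV[R]_s :=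
  [set (n%:R)^-1 *: y + (n%:R)^-1 *: (\row_i (k i)%:R) | y in @cube s].

Lemma cube_grid s n (x : 'rV[R]_s) : (0 < n)%N -> cube x ->
  exists k : {ffun 'I_s -> 'I_n}, cell k x.
Proof.
case: n => // n _ Qx.
have kP i : exists k : 'I_n.+1, (k%:R <= n.+1%:R * x 0 i <= k.+1%:R).
  have /andP[x0 x1] := Qx i.
  have [lt|ge] := ltP (x 0 i) 1; last first.
    have -> : x 0 i = 1 by apply/le_anti; rewrite x1 ge.
    by exists ord_max; rewrite mulr1 lexx andbT ler_nat.
  have nx0 : 0 <= n.+1%:R * x 0 i by rewrite mulr_ge0.
  have /andP[h1 h2] := truncn_itv nx0.
  have tn : (Num.truncn (n.+1%:R * x 0 i)%R < n.+1)%N.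
    by rewrite -(@ltr_nat R) (le_lt_trans h1)// gtr_pMr ?ltr0n.
  by exists (Ordinal tn); rewrite /= h1 ltW.
have /choice[k hk] := kP.
have n0 : n.+1%:R != 0 :> R by rewrite pnatr_eq0.
exists [ffun i => k i]; exists (n.+1%:R *: x - \row_i (k i)%:R).
  by move=> i; rewrite !mxE subr_ge0 lerBlDr (addrC 1) natr1.
by apply/rowP => i; rewrite !mxE ffunE; field; rewrite nat1r.
Qed.

Lemma cell_close s n (k : {ffun 'I_s -> 'I_n}) x y : cell k x -> cell k y ->
  `|x - y| <= (n%:R)^-1.
Proof.
move=> [u Qu <-] [v Qv <-]; rewrite opprD addrACA subrr addr0 -scalerBr.
rewrite normrZ ger0_norm ?invr_ge0// ler_piMr ?invr_ge0//.
apply: norm_le_coord => // i; rewrite !mxE.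
by have /andP[? ?] := Qu i; have /andP[? ?] := Qv i; rewrite ler_norml; apply/andP; split; lra.
Qed.

Lemma cube_cvx s : cvx (@cube s).
Proof.
move=> x y t Qx Qy t0 t1 i; rewrite !mxE.
by have /andP[? ?] := Qx i; have /andP[? ?] := Qy i; apply/andP; split; nra.
Qed.

(** The subdivision into n^s cells of diameter at most s / n bounds the
    content by a quantity that does not depend on n. *)
Lemma H_cube_fin s : (hausdorff_measure s (@cube s) < +oo)%E.
Proof.
apply: (@le_lt_trans _ _ (ball_volume R s * (s%:R / 2) ^+ s)%:E); last exact: ltry.
apply: H_le_ub => delta d0.
pose n := (Num.bound (s%:R / delta)).+1.
have n0 : 0 < n%:R :> R by rewrite ltr0n.
have sn : s%:R / n%:R <= delta.
  rewrite ler_pdivrMr// mulrC -ler_pdivrMr// ltW//.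
  apply: lt_le_trans (archi_boundP _) _; first by rewrite divr_ge0// ltW.
  by rewrite ler_nat.
have dc (k : {ffun 'I_s -> 'I_n}) : (diam (cell k) <= (s%:R / n%:R)%:E)%E.
  apply: diam_le_ub => x y cx cy; rewrite lee_fin (le_trans (enorm_le_norm _))//.
  by rewrite ler_wpM2l//; exact: cell_close cx cy.
have hk (k : {ffun 'I_s -> 'I_n}) : (hausdorff_content s delta (cell k) <=
    (ball_volume R s * (s%:R / n%:R / 2) ^+ s)%:E)%E.
  have ne : cell k !=set0.
    exists ((n%:R)^-1 *: (\row_i (k i)%:R)); exists 0; last by rewrite scaler0 add0r.
    by move=> i; rewrite mxE lexx ler01.
  apply: (le_trans (hc_diam _ (le_trans (dc k) _))); first by rewrite lee_fin.
  rewrite hwE// EFinM lee_wpmul2l ?lee_fin ?ball_volume_ge0// EFin_expe.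
  apply: expe_le; first by rewrite mule_ge0 ?diam_ge0// lee_fin invr_ge0.
  by rewrite EFinM lee_wpmul2r// lee_fin invr_ge0.
apply: (le_trans (hc_le_sum s delta (B := fun k : {ffun 'I_s -> 'I_n} => cell k) _)).
  by move=> x; exact: cube_grid.
apply: (le_trans (lee_sum _ (fun k _ => hk k))).
rewrite sumEFin lee_fin sumr_const card_ffun !card_ord -[_ *+ _]mulr_natl natrX.
rewrite mulrCA -exprMn le_eqVlt; apply/orP; left; apply/eqP.
by congr (_ * _ ^+ _); field; rewrite gt_eqF.
Qed.

Lemma bnd_imx m d (T : 'M[R]_(m, d)) B : bnd B -> bnd (imx T B).
Proof.
move=> [M hM]; have [L L0 hL] := mulmx_lip T.
exists (L * (m%:R * M)) => _ [x Bx <-].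
rewrite (le_trans (norm_le_enorm _))// (le_trans (hL _))// ler_wpM2l ?(ltW L0)//.
by rewrite (le_trans (enorm_le_norm _))// ler_wpM2l// hM.
Qed.

Lemma bnd_affine d (a : R) (t : 'rV[R]_d) B : bnd B -> bnd [set a *: x + t | x in B].
Proof.
move=> [M hM]; exists (`|a| * M + `|t|) => _ [x Bx <-].
by rewrite (le_trans (ler_normD _ _))// lerD2r normrZ ler_wpM2l// hM.
Qed.

Lemma bnd_in_cube s (B : set 'rV[R]_s) : bnd B -> exists (M : R) (t : 'rV[R]_s), 0 < M /\
  forall x, B x -> cube (M *: x + t).
Proof.
move=> [M0 hM0]; pose M := `|M0| + 1.
have M_gt0 : 0 < M by rewrite ltr_wpDl.
have hM x : B x -> `|x| <= M.
  by move=> /hM0 h; rewrite (le_trans h)// (le_trans (ler_norm _))// lerDl.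
exists ((2 * M)^-1), (const_mx 2^-1); split; first by rewrite invr_gt0 mulr_gt0.
move=> x /hM xM i; rewrite !mxE.
have : `|x 0 i| <= M by apply: le_trans xM; exact: coord_le_norm.
rewrite ler_norml => /andP[h1 h2].
have -> : (2 * M)^-1 * x 0 i + 2^-1 = (x 0 i + M) / (2 * M).
  by field; rewrite gt_eqF.
rewrite divr_ge0 ?ler_pdivrMr ?mulr_gt0//=; [lra|lra|].
by rewrite mulr_ge0// ltW.
Qed.

(** Up to a constant the measure of the cube bounds that of any bounded set,
    which is a scaled and translated part of the cube. *)
Lemma H_bnd_cube s d (T : 'M[R]_(s, d)) B : bnd B -> exists c : R,
  (hausdorff_measure s (imx T B) <= c%:E * hausdorff_measure s (@cube s))%E.
Proof.
move=> /bnd_in_cube[M [t [M0 hM]]]; have [L L0 hL] := mulmx_lip T.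
exists (L ^+ s * (M ^+ s)^-1); rewrite EFinM -muleA.
apply: (@le_trans _ _ ((L ^+ s)%:E * hausdorff_measure s (imx 1%:M B))%E).
  by apply: H_le_mx => // x; rewrite mulmx1.
rewrite imx1 lee_wpmul2l ?lee_fin ?exprn_ge0 ?(ltW L0)//.
rewrite lee_pdivlMl ?exprn_gt0// -(H_scale s B t M0).
by apply: H_le => _ [x Bx <-]; exact: hM.
Qed.

Lemma H_bnd_finite s d (T : 'M[R]_(s, d)) B : bnd B -> (hausdorff_measure s (imx T B) < +oo)%E.
Proof.
move=> /(H_bnd_cube T)[c /le_lt_trans]; apply.
by rewrite (hvE (H_cube_fin s)) -EFinM ltry.
Qed.

Lemma H_bnd_null s d (T : 'M[R]_(s, d)) B : hv s (@cube s) = 0 -> bnd B ->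
  hausdorff_measure s (imx T B) = 0%E.
Proof.
move=> k0 /(H_bnd_cube T)[c]; rewrite (hvE (H_cube_fin s)) k0 mule0 => h.
by apply/le_anti; rewrite h H_ge0.
Qed.

Lemma H_cell s d (T : 'M[R]_(s, d)) n (k : {ffun 'I_s -> 'I_n}) : (0 < n)%N ->
  hausdorff_measure s (imx T (cell k)) =
  ((n%:R^-1) ^+ s * hv s (imx T (@cube s)))%:E.
Proof.
move=> n0; rewrite /cell imx_affine H_scale ?invr_gt0 ?ltr0n//.
rewrite hvE ?EFinM//; apply: H_bnd_finite.
exists 1 => x Qx; apply: norm_le_coord => // i.
by have /andP[x0 x1] := Qx i; rewrite ger0_norm.
Qed.

Lemma bnd_cube s : bnd (@cube s).
Proof.
exists 1 => x Qx; apply: norm_le_coord => // i.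
by have /andP[x0 x1] := Qx i; rewrite ger0_norm.
Qed.

(** A lower bound that avoids measurability: the [n ^ s] cells have equal
    measure and cover the cube, so finite subadditivity, applied to the cube
    and the cells outside [D], forces the cells of [D] to contribute their
    full measure. *)
Lemma grid_lower s d (T : 'M[R]_(s, d)) n (D : {set {ffun 'I_s -> 'I_n}}) B : (0 < n)%N ->
  (forall k x, k \in D -> cell k x -> B x) -> bnd B ->
  #|D|%:R * ((n%:R^-1) ^+ s * hv s (imx T (@cube s))) <= hv s (imx T B).
Proof.
move=> n0 DB bB; set kap := hv s (imx T (@cube s)).
have N0 : n%:R != 0 :> R by rewrite pnatr_eq0 -lt0n.
pose F k := if k \in D then set0 else imx T (cell k).
have : (kap%:E <= hausdorff_measure s (imx T B) + \sum_k hausdorff_measure s (F k))%E.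
  rewrite -hvE; last exact/H_bnd_finite/bnd_cube.
  apply: (@le_trans _ _ (hausdorff_measure s (imx T B `|` \bigcup_k F k))).
    apply: H_le => _ [x Qx <-]; have [k kx] := cube_grid n0 Qx.
    have [kD|kD] := boolP (k \in D); first by left; exists x => //; exact: DB kx.
    by right; exists k => //; rewrite /F (negbTE kD); exists x.
  apply: (le_trans (H_U _ _ _)); rewrite leeD2l//.
  by apply: H_le_sum => x [k _ Fk]; exists k.
rewrite hvE; last exact: H_bnd_finite.
rewrite (eq_bigr (fun k => ((k \notin D)%:R * ((n%:R^-1) ^+ s * kap))%:E)); last first.
  by move=> k _; rewrite /F; case: (k \in D); rewrite /= ?H0 ?mul0r// mul1r H_cell.
rewrite sumEFin -EFinD lee_fin -mulr_suml -natr_sum => h.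
have e1 : (\sum_k (k \notin D) = n ^ s - #|D|)%N.
  have := cardsC D; rewrite card_ffun !card_ord => <-; rewrite addKn -sum1_card [RHS]big_mkcond/=.
  by apply: eq_bigr => k _; rewrite inE; case: (k \in D).
have le1 : (#|D| <= n ^ s)%N.
  by rewrite (leq_trans (max_card _))// card_ffun !card_ord.
move: h; rewrite e1 natrB// natrX mulrBl.
have -> : n%:R ^+ s * (n%:R^-1 ^+ s * kap) = kap.
  by rewrite mulrA -exprMn mulfV// expr1n mul1r.
lra.
Qed.

(** [B'] is covered by the cells it meets, which lie in [B]; the number of
    these cells is the same for the two maps. *)
Lemma grid_compare s d1 d2 (T1 : 'M[R]_(s, d1)) (T2 : 'M[R]_(s, d2)) n B' B : (0 < n)%N ->
  B' `<=` @cube s -> bnd B ->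
  (forall x y, B' x -> `|x - y| <= (n%:R)^-1 -> B y) ->
  hv s (imx T1 B') * hv s (imx T2 (@cube s)) <=
  hv s (imx T1 (@cube s)) * hv s (imx T2 B).
Proof.
move=> n0 B'Q bB near_.
pose D := [set k : {ffun 'I_s -> 'I_n} | `[< exists2 x, B' x & cell k x >]]%SET.
have lo := @grid_lower s d2 T2 n D B n0 _ bB.
have {lo} : #|D|%:R * ((n%:R^-1) ^+ s * hv s (imx T2 (@cube s))) <= hv s (imx T2 B).
  apply: lo => k y; rewrite inE => /asboolP[x B'x kx] ky.
  by apply: (near_ x y B'x); exact: cell_close kx ky.
have : hv s (imx T1 B') <= #|D|%:R * ((n%:R^-1) ^+ s * hv s (imx T1 (@cube s))).
  have bB' : bnd B' by have [M hM] := bnd_cube s; exists M => x /B'Q/hM.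
  rewrite -lee_fin -hvE; last exact: H_bnd_finite.
  apply: (@le_trans _ _ (\sum_k hausdorff_measure s (if k \in D then imx T1 (cell k) else set0))).
    apply: H_le_sum => _ [x B'x <-]; have [k kx] := cube_grid n0 (B'Q x B'x).
    exists k; rewrite (_ : k \in D); first by exists x.
    by rewrite inE; apply/asboolP; exists x.
  rewrite (eq_bigr (fun k => ((k \in D)%:R * ((n%:R^-1) ^+ s * hv s (imx T1 (@cube s))))%:E)); last first.
    by move=> k _; case: (k \in D); rewrite /= ?H0 ?mul0r// mul1r H_cell.
  rewrite sumEFin lee_fin -mulr_suml -natr_sum ler_wpM2r//.
    by rewrite mulr_ge0 ?hv_ge0// exprn_ge0// invr_ge0.
  by rewrite ler_nat -sum1_card [leqRHS]big_mkcond; apply: leq_sum => k _; case: (k \in D).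
have k1 := hv_ge0 s (imx T1 (@cube s)); have k2 := hv_ge0 s (imx T2 (@cube s)).
move: (hv s (imx T1 (@cube s))) (hv s (imx T2 (@cube s))) k1 k2 => a b a0 b0.
move=> /(ler_wpM2r b0) h1 /(ler_wpM2l a0) h2.
apply: (le_trans h1); apply: le_trans h2; rewrite le_eqVlt; apply/orP; left; apply/eqP; ring.
Qed.

(** Continuity of l^s at l = 1, through Bernoulli's inequality. *)
Lemma le_of_shrink s (a b : R) : 0 <= a ->
  (forall l : R, 0 < l -> l < 1 -> l ^+ s * a <= b) -> a <= b.
Proof.
move=> a0 h.
have bern (l : R) : 0 <= l -> l <= 1 -> 1 - s%:R * (1 - l) <= l ^+ s.
  move=> l0 l1; elim: s {h} => [|k IH]; first by rewrite mul0r subr0 expr0.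
  rewrite exprS -natr1; have := ler_wpM2l l0 IH.
  have : 0 <= k%:R * ((1 - l) * (1 - l)) by rewrite !mulr_ge0 ?subr_ge0.
  lra.
apply/ler_addgt0Pr => e e0.
pose eta := Num.min (2^-1) (e / (s%:R * a + 1)).
have den : 0 < s%:R * a + 1 by rewrite ltr_wpDl ?mulr_ge0.
have eta0 : 0 < eta by rewrite lt_min invr_gt0 ltr0n divr_gt0.
have eta2 : eta <= 2^-1 by rewrite ge_min lexx.
have etae : eta * (s%:R * a + 1) <= e by rewrite -ler_pdivlMr// ge_min lexx orbT.
have := h (1 - eta); have := bern (1 - eta).
rewrite opprB addrCA subrr addr0 => b1 h1.
have {b1} b1 := ler_wpM2r a0 (b1 _ _).
have := b1 _ _; have := h1 _ _; lra.
Qed.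

End LinearImages.

(** * Linear maps scale the measure of all convex bodies alike *)

Section FlatLaw.
Context {R : realType}.

Definition has_ball d (B : set 'rV[R]_d) := exists (c : 'rV[R]_d) (r : R),
  0 < r /\ forall y, `|y - c| <= r -> B y.

Lemma hv_scale s d (A : set 'rV[R]_d) (a : R) (t : 'rV[R]_d) : 0 < a ->
  hv s [set a *: x + t | x in A] = a ^+ s * hv s A.
Proof.
move=> a0; have as0 : 0 < a ^+ s by rewrite exprn_gt0.
rewrite /hv H_scale//; case: (hausdorff_measure s A) (H_ge0 s A) => [r|//|//] _ //=.
by rewrite gt0_muley ?lte_fin//= mulr0.
Qed.

Lemma hv_affine s m d (T : 'M[R]_(m, d)) (B : set 'rV[R]_m) (a : R) t : 0 < a ->
  hv s (imx T [set a *: x + t | x in B]) = a ^+ s * hv s (imx T B).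
Proof. by move=> a0; rewrite imx_affine hv_scale. Qed.

(** Shrink the body towards the centre of an inscribed ball: the shrunken
    body keeps a positive distance from the complement, so a fine grid
    compares it with the body itself by [grid_compare]. Then let the factor
    tend to 1. *)
Lemma flat_law_le s d1 d2 (T1 : 'M[R]_(s, d1)) (T2 : 'M[R]_(s, d2)) B :
  cvx B -> bnd B -> has_ball B ->
  hv s (imx T1 B) * hv s (imx T2 (@cube R s)) <=
  hv s (imx T1 (@cube R s)) * hv s (imx T2 B).
Proof.
move=> cB bB [c [r [r0 hr]]].
have [M [t [M0 BQ]]] := bnd_in_cube bB.
pose B0 := [set M *: x + t | x in B].
suff : hv s (imx T1 B0) * hv s (imx T2 (@cube R s)) <=
       hv s (imx T1 (@cube R s)) * hv s (imx T2 B0).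
  rewrite !hv_affine// -mulrA [leRHS]mulrCA ler_pM2l//.
  exact: exprn_gt0.
apply: (@le_of_shrink _ s); first by rewrite mulr_ge0 ?hv_ge0.
move=> l l0 l1; rewrite mulrA.
pose c0 := M *: c + t.
rewrite -(hv_affine _ _ _ ((1 - l) *: c0) l0).
have l1' : 0 < 1 - l by rewrite subr_gt0.
pose n := (Num.bound ((1 - l) * (M * r))^-1).+1.
have cB0 : cvx B0 by exact: affine_cvx.
have hB0 y : `|y - c0| <= M * r -> B0 y.
  move=> h; exists (M^-1 *: (y - t)); last by rewrite scalerA mulfV ?gt_eqF// scale1r subrK.
  apply: hr; have -> : M^-1 *: (y - t) - c = M^-1 *: (y - c0).
    by apply/rowP => i; rewrite !mxE; field; rewrite gt_eqF.
  by rewrite normrZ gtr0_norm ?invr_gt0// ler_pdivrMl.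
apply: (@grid_compare _ s d1 d2 T1 T2 n) => //.
- move=> _ [y B0y <-].
  have : B0 (l *: y + (1 - l) *: c0).
    apply: cB0 => //; rewrite ?(ltW l0) ?(ltW l1)//.
    by apply: hB0; rewrite subrr normr0 mulr_ge0 ?ltW.
  by move=> [x Bx <-]; exact: BQ.
- exact: bnd_affine.
- move=> x z [y B0y <-] xz.
  have -> : z = l *: y + (1 - l) *: (c0 + (1 - l)^-1 *: (z - (l *: y + (1 - l) *: c0))).
    rewrite scalerDr scalerA mulfV ?gt_eqF// scale1r addrA addrC subrK//.
  apply: cB0 => //; rewrite ?(ltW l0) ?(ltW l1)//.
  apply: hB0; rewrite addrC addKr normrZ ger0_norm ?invr_ge0 ?(ltW l1')//.
  rewrite ler_pdivrMl// distrC (le_trans xz)//.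
  have p0 : 0 < (1 - l) * (M * r) by rewrite !mulr_gt0.
  rewrite -[leRHS]invrK lef_pV2 ?posrE ?invr_gt0 ?ltr0n//.
  apply: ltW; apply: lt_le_trans (archi_boundP _) _; first by rewrite invr_ge0 ltW.
  by rewrite ler_nat.
Qed.

(** The factor by which a linear map multiplies the s-dimensional measure is
    the same for all convex bodies of R^s. *)
Lemma flat_law s d1 d2 (T1 : 'M[R]_(s, d1)) (T2 : 'M[R]_(s, d2)) B :
  cvx B -> bnd B -> has_ball B ->
  hv s (imx T1 B) * hv s (imx T2 (@cube R s)) =
  hv s (imx T1 (@cube R s)) * hv s (imx T2 B).
Proof.
move=> cB bB hB; apply/le_anti/andP; split; first exact: flat_law_le.
by rewrite mulrC [leRHS]mulrC; exact: flat_law_le.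
Qed.

(** Translates of [B] orthogonally to its hyperplane are separated from each
    other; arbitrarily many fit in one bounded set, whose measure is finite. *)
Lemma H_flat_null s d (T : 'M[R]_(s, d)) (B : set 'rV[R]_s) (u : 'rV[R]_s) (c : R) :
  bnd B -> u != 0 -> (forall x, B x -> dotv x u = c) ->
  hausdorff_measure s (imx T B) = 0%E.
Proof.
move=> bB u0 Bu; have [L L0 hL] := mulmx_lip T.
suff h0 : hausdorff_measure s B = 0%E.
  apply/eqP; rewrite eq_le H_ge0 andbT.
  have : (hausdorff_measure s (imx T B) <= (L ^+ s)%:E * hausdorff_measure s (imx 1%:M B))%E.
    by apply: H_le_mx => // x; rewrite mulmx1.
  by rewrite imx1 h0 mule0.
have [M hM] := bB.
pose v := (dotv u u)^-1 *: u.
have uu : 0 < dotv u u by rewrite lt_neqAle eq_sym dotv_eq0 u0 dotv_ge0.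
have vu : dotv v u = 1 by rewrite dotvZl mulVf// gt_eqF.
have nu : 0 < enorm u by rewrite enorm_gt0.
pose Big := [set x : 'rV[R]_s | `|x| <= M + `|v|].
have bBig : bnd Big by exists (M + `|v|).
have fBig := H_bnd_finite 1%:M bBig; rewrite imx1 in fBig.
have fB : (hausdorff_measure s B < +oo)%E by have := H_bnd_finite 1%:M bB; rewrite imx1.
(* an upper bound for the union of k translates at heights j / (n + 1) *)
pose Cp (n k : nat) : set 'rV[R]_s :=
  [set x | Big x /\ exists2 j : nat, (j < k)%N & dotv x u = c + j%:R / n.+1%:R].
have copies n k : (k <= n.+1)%N -> ((k%:R * hv s B)%:E <= hausdorff_measure s (Cp n k))%E.
  elim: k => [|k IH] kn; first by rewrite mul0r H_ge0.
  set S := Cp n k in IH.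
  have shift x : B x -> Big (x + (k%:R / n.+1%:R) *: v).
    move=> Bx; rewrite /Big/= (le_trans (ler_normD _ _))// lerD ?hM//.
    rewrite normrZ ger0_norm// ler_piMl// ler_pdivrMr// mul1r ler_nat.
    exact: ltnW.
  have := @H_separated _ _ s ((n.+1%:R * enorm u)^-1) S [set x + (k%:R / n.+1%:R) *: v | x in B].
  rewrite H_translate (hvE fB) => /(_ _ _)/le_trans h.
  rewrite -natr1 mulrDl mul1r EFinD; apply: le_trans (leeD2r _ (IH (ltnW kn))) _.
  apply: h.
  - by rewrite invr_gt0 mulr_gt0.
  - move=> a _ [_ [j jk aj]] [x Bx <-].
    rewrite invfM ler_pdivrMr//.
    have : n.+1%:R^-1 <= `|dotv (a - (x + (k%:R / n.+1%:R) *: v)) u|.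
      rewrite dotvBl dotvDl dotvZl vu mulr1 (Bu x Bx) aj distrC.
      rewrite opprD addrACA subrr add0r -mulrBl normrM [X in _ <= _ * X]ger0_norm ?invr_ge0//.
      rewrite -[leLHS]mul1r ler_wpM2r ?invr_ge0// ger0_norm ?subr_ge0 ?ler_nat ?(ltnW jk)//.
      by rewrite -natrB ?(ltnW jk)// ler1n subn_gt0.
    move=> /le_trans; apply.
    exact: cauchy_schwarz_abs.
  - apply: H_le => x [[Bx [j jk xj]]|[y By <-]].
      by split => //; exists j => //; rewrite ltnS ltnW.
    split; first exact: shift.
    by exists k => //; rewrite dotvDl dotvZl vu mulr1 (Bu y By).
have hn n : n.+1%:R * hv s B <= hv s Big.
  rewrite -lee_fin -hvE//; apply: (le_trans (copies n n.+1 (leqnn _))).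
  by apply: H_le => x [].
rewrite hvE//; congr EFin; apply/eqP; rewrite eq_le hv_ge0 andbT leNgt; apply/negP => h.
have := hn (Num.bound (hv s Big / hv s B)).
rewrite -ler_pdivlMr// leNgt => /negP; apply.
apply: lt_le_trans (archi_boundP _) _; first by rewrite divr_ge0 ?hv_ge0.
by rewrite ler_nat.
Qed.

(** The reflection in the hyperplane orthogonal to [w]. *)
Lemma householder s (w : 'rV[R]_s) : dotv w w != 0 ->
  exists rho : 'M[R]_s, [/\ rho *m rho = 1%:M, rho^T = rho &
    forall x, x *m rho = x - (2 * dotv x w / dotv w w) *: w].
Proof.
move=> ww.
have mulw x : x *m (w^T *m w) = dotv x w *: w.
  rewrite mulmxA (_ : x *m w^T = (dotv x w)%:M) ?mul_scalar_mx//.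
  apply/matrixP => i j; rewrite !ord1 !mxE eqxx mulr1n; apply: eq_bigr => k _.
  by rewrite mxE.
pose rho : 'M[R]_s := 1%:M - (2 / dotv w w) *: (w^T *m w).
have rhoE x : x *m rho = x - (2 * dotv x w / dotv w w) *: w.
  rewrite mulmxBr mulmx1 -scalemxAr mulw scalerA; congr (_ - _ *: _).
  by rewrite mulrAC.
exists rho; split => //.
- apply/row_matrixP => i; rewrite !rowE mulmxA mulmx1 !rhoE.
  set x := delta_mx _ _; rewrite dotvBl dotvZl.
  rewrite -addrA -opprD -scalerDl.
  have -> : 2 * dotv x w / dotv w w +
     2 * (dotv x w - 2 * dotv x w / dotv w w * dotv w w) / dotv w w = 0 by field.
  by rewrite scale0r subr0.
- by rewrite /rho linearB/= linearZ/= trmx_mul trmxK trmx1.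
Qed.

Lemma reflection s (u v : 'rV[R]_s) : dotv u u = dotv v v ->
  exists rho : 'M[R]_s, [/\ rho *m rho = 1%:M, rho^T = rho & u *m rho = v].
Proof.
move=> uv; have [->|ne] := eqVneq u v.
  by exists 1%:M; rewrite mulmx1 trmx1 mulmx1.
have ww : dotv (u - v) (u - v) != 0 by rewrite dotv_eq0 subr_eq0.
have [rho [h1 h2 rhoE]] := householder ww.
exists rho; split => //; rewrite rhoE.
have e : dotv (u - v) (u - v) = 2 * dotv u (u - v).
  by rewrite !(dotvBl, dotvBr) (dotvC v u) -uv; ring.
by rewrite e in ww *; rewrite mulfV// scale1r subKr.
Qed.

Lemma dotv_mx s d (T : 'M[R]_(s, d)) x y : dotv (x *m T) y = dotv x (y *m T^T).
Proof.
have e n (a b : 'rV[R]_n) : dotv a b = (a *m b^T) 0 0.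
  by rewrite mxE; apply: eq_bigr => k _; rewrite mxE.
by rewrite !e trmx_mul trmxK mulmxA.
Qed.

Lemma orth_enorm s (rho : 'M[R]_s) x : rho *m rho^T = 1%:M -> enorm (x *m rho) = enorm x.
Proof. by move=> h; rewrite /enorm dotv_mx -mulmxA h mulmx1. Qed.

End FlatLaw.

(** * Area factors of diagonal and graph maps *)

Section AreaFactors.
Context {R : realType}.

Lemma has_ball_cube s : has_ball (@cube R s).
Proof.
exists (const_mx 2^-1), 2^-1; split; first by rewrite invr_gt0.
move=> y h i; have := le_trans (coord_le_norm (y - const_mx 2^-1) i) h.
by rewrite !mxE ler_norml => /andP[? ?]; apply/andP; split; lra.
Qed.

Lemma norm_mulmx m d (T : 'M[R]_(m, d)) : exists2 L : R, 0 < L &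
  forall x : 'rV[R]_m, `|x *m T| <= L * `|x|.
Proof.
have [L L0 hL] := mulmx_lip T.
exists (L * (m%:R + 1)); first by rewrite mulr_gt0// ltr_wpDl.
move=> x; rewrite (le_trans (norm_le_enorm _))// (le_trans (hL _))// -mulrA ler_wpM2l ?(ltW L0)//.
by rewrite (le_trans (enorm_le_norm _))// ler_wpM2r// lerDl.
Qed.

Lemma has_ball_imx s d (L : 'M[R]_(s, d)) (L' : 'M[R]_(d, s)) B :
  L' *m L = 1%:M -> has_ball B -> has_ball (imx L B).
Proof.
move=> L'L [c [r [r0 hr]]]; have [l l0 hl] := norm_mulmx L'.
exists (c *m L), (r / l); split; first by rewrite divr_gt0.
move=> y hy; exists (c + (y - c *m L) *m L').
  apply: hr; rewrite addrC addKr (le_trans (hl _))// -ler_pdivlMl// mulrC//.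
by rewrite mulmxDl -mulmxA L'L mulmx1 addrC subrK.
Qed.

Section Fixed.
Context {s : nat}.
Hypothesis kap0 : 0 < hv s (@cube R s).
Let kap := hv s (@cube R s).

Definition area_factor d (T : 'M[R]_(s, d)) : R := hv s (imx T (@cube R s)).

Lemma area_law d (T : 'M[R]_(s, d)) B : cvx B -> bnd B -> has_ball B ->
  hv s (imx T B) * kap = area_factor T * hv s B.
Proof.
move=> cB bB hB; have := flat_law T 1%:M cB bB hB.
by rewrite !imx1.
Qed.

Lemma area_comp d (L : 'M[R]_s) (T : 'M[R]_(s, d)) L' : L' *m L = 1%:M ->
  area_factor (L *m T) * kap = area_factor T * area_factor L.
Proof.
move=> L'L; rewrite /area_factor -imx_comp; apply: area_law.
- exact/imx_cvx/cube_cvx.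
- exact/bnd_imx/bnd_cube.
- exact/(has_ball_imx L'L)/has_ball_cube.
Qed.

Definition dg n (a : 'I_n -> R) : 'M[R]_n := diag_mx (\row_i a i).

Lemma mul_dg n (a : 'I_n -> R) (x : 'rV[R]_n) i : (x *m dg a) 0 i = x 0 i * a i.
Proof. by rewrite /dg mul_mx_diag !mxE. Qed.

Lemma dgM n (a b : 'I_n -> R) : dg a *m dg b = dg (fun i => a i * b i).
Proof. by rewrite /dg mulmx_diag; congr diag_mx; apply/rowP => i; rewrite !mxE. Qed.

Lemma dg1 n : dg (fun _ : 'I_n => 1) = 1%:M.
Proof.
by rewrite /dg; apply/matrixP => i j; rewrite !mxE.
Qed.

Lemma eq_dg n (a b : 'I_n -> R) : a =1 b -> dg a = dg b.
Proof. by move=> ab; congr diag_mx; apply/rowP => i; rewrite !mxE ab. Qed.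

Lemma dgV n (a : 'I_n -> R) : (forall i, a i != 0) -> dg (fun i => (a i)^-1) *m dg a = 1%:M.
Proof. by move=> a0; rewrite dgM -dg1; apply: eq_dg => i; rewrite mulVf. Qed.

Definition stretch (i : 'I_s) (t : R) := dg (fun j => if j == i then t else 1).

(** Exchanging two coordinates preserves the cube and all distances. *)
Lemma stretch_swap i j t : area_factor (stretch i t) = area_factor (stretch j t).
Proof.
pose sg := tperm i j.
pose f1 (x : 'rV[R]_s) := x *m stretch i t.
pose f2 (x : 'rV[R]_s) := col_perm sg x *m stretch j t.
have -> : area_factor (stretch j t) = hv s (f2 @` @cube R s).
  rewrite /area_factor; congr hv; apply/seteqP; split=> [_ [x Qx <-]|_ [x Qx <-]].
    exists (col_perm sg x); first by move=> k; rewrite !mxE.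
    rewrite /f2 (_ : col_perm sg (col_perm sg x) = x)//.
    by apply/rowP => k; rewrite !mxE tpermK.
  by exists (col_perm sg x) => // k; rewrite !mxE.
rewrite /area_factor /hv; congr fine.
apply: (@H_isometric _ s _ _ s s f1 f2) => x y _ _.
rewrite /f1 /f2 -!mulmxBl; have -> : col_perm sg x - col_perm sg y = col_perm sg (x - y).
  by apply/rowP => k; rewrite !mxE.
rewrite /enorm /dotv; congr Num.sqrt.
rewrite (reindex_inj (@perm_inj _ sg))/=; apply: eq_bigr => k _.
rewrite !mul_dg !mxE.
have -> : (sg k == i) = (k == j).
  by rewrite -(inj_eq (@perm_inj _ sg)) tpermK tpermL.
by [].
Qed.

Lemma stretch_inv i t : t != 0 -> stretch i t^-1 *m stretch i t = 1%:M.
Proof.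
move=> t0; rewrite dgM -dg1; apply: eq_dg => j.
by case: eqP => _; rewrite ?mulVf ?mulr1.
Qed.

Lemma area_dg_seq (a : 'I_s -> R) (r : seq 'I_s) : (forall i, 0 < a i) -> uniq r ->
  area_factor (dg (fun j => if j \in r then a j else 1)) =
  kap * \prod_(i <- r) (area_factor (stretch i (a i)) / kap).
Proof.
move=> a0; have kn0 : kap != 0 by rewrite gt_eqF.
elim: r => [|i r IH].
  by move=> _; rewrite big_nil mulr1 /area_factor dg1 imx1.
move=> /= /andP[ir ur]; rewrite big_cons.
have -> : dg (fun j => if j \in i :: r then a j else 1) =
    stretch i (a i) *m dg (fun j => if j \in r then a j else 1).
  rewrite dgM; apply: eq_dg => j; rewrite inE; case: eqP => [->|] /=.
    by rewrite (negbTE ir) mulr1.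
  by rewrite mul1r.
have ai0 : a i != 0 by rewrite gt_eqF.
apply: (mulIf kn0); rewrite (area_comp _ (stretch_inv i ai0)) IH//.
by field.
Qed.

(** A diagonal map is a composition of one-coordinate stretches, and area
    factors are multiplicative. *)
Lemma area_dg_prod (a : 'I_s -> R) : (forall i, 0 < a i) ->
  area_factor (dg a) = kap * \prod_i (area_factor (stretch i (a i)) / kap).
Proof.
move=> a0; rewrite -big_enum -area_dg_seq ?enum_uniq//.
by congr area_factor; apply: eq_dg => i; rewrite mem_enum.
Qed.

(** All one-coordinate stretches by [t] have the same factor, and their
    product is the homothety of ratio [t], which has factor t^s. *)
Lemma area_stretch i t : 0 < t -> area_factor (stretch i t) = t * kap.
Proof.
move=> t0; have kn0 : kap != 0 by rewrite gt_eqF.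
have := @area_dg_prod (fun=> t) (fun=> t0).
have -> : area_factor (dg (fun=> t)) = t ^+ s * kap.
  rewrite -(hv_scale s (@cube R s) 0 t0); congr hv; apply: eq_imagel => x _.
  by apply/rowP => k; rewrite mul_dg !mxE addr0 mulrC.
rewrite (eq_bigr (fun=> area_factor (stretch i t) / kap)); last first.
  by move=> j _; rewrite (stretch_swap j i).
rewrite prodr_const card_ord mulrC => /(mulfI kn0) e.
have s0 : (0 < s)%N := leq_ltn_trans (leq0n _) (ltn_ord i).
apply: (mulIf (invr_neq0 kn0)); rewrite mulfK//; apply/esym.
apply: (pexpIrn s0); rewrite ?nnegrE ?(ltW t0)//.
by rewrite divr_ge0 ?hv_ge0.
Qed.

Lemma area_dg (a : 'I_s -> R) : (forall i, 0 < a i) ->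
  area_factor (dg a) = kap * \prod_i a i.
Proof.
move=> a0; rewrite area_dg_prod//; congr (_ * _); apply: eq_bigr => i _.
by rewrite area_stretch// mulfK// gt_eqF.
Qed.

Lemma area_same_norm d1 d2 (T1 : 'M[R]_(s, d1)) (T2 : 'M[R]_(s, d2)) :
  (forall x, dotv (x *m T1) (x *m T1) = dotv (x *m T2) (x *m T2)) ->
  area_factor T1 = area_factor T2.
Proof.
by move=> h; rewrite /area_factor /hv (@H_same_norm _ s s d1 d2 T1 T2)// /enorm => x; rewrite h.
Qed.

(** A reflection takes [g] to a multiple of a basis vector; the graph map
    then has the same norms as the stretch of one coordinate by sqrt (1 +
    |g|^2). *)
Lemma area_graph d (T : 'M[R]_(s, d)) (g : 'rV[R]_s) :
  (forall y, dotv (y *m T) (y *m T) = dotv y y + dotv y g ^+ 2) ->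
  area_factor T = kap * Num.sqrt (1 + dotv g g).
Proof.
move=> hT; have kn0 : kap != 0 by rewrite gt_eqF.
have [g0|g0] := eqVneq g 0.
  rewrite g0 dotv0l addr0 sqrtr1 mulr1 (@area_same_norm _ _ _ 1%:M) /area_factor ?imx1//.
  by move=> x; rewrite hT g0 dotv0r expr0n addr0 mulmx1.
have [i _] : exists i, g 0 i != 0.
  by apply/existsP; apply: contraNT g0 => /existsPn h; apply/eqP/rowP => j; rewrite mxE; apply/eqP/negPn.
pose e : 'rV[R]_s := enorm g *: delta_mx 0 i.
have de y : dotv y e = enorm g * y 0 i.
  rewrite dotvZr; congr (_ * _); rewrite /dotv (bigD1 i)//= big1 ?addr0 ?mxE ?eqxx ?mulr1//.
  by move=> j /negbTE ji; rewrite !mxE ji andbF mulr0.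
have ee : dotv g g = dotv e e.
  by rewrite de !mxE !eqxx mulr1 -expr2 enorm_sq.
have [rho [rr rT gr]] := reflection ee.
have rhok : area_factor rho = kap.
  rewrite (@area_same_norm _ _ rho 1%:M) /area_factor ?imx1// => x.
  by rewrite dotv_mx rT -mulmxA rr !mulmx1.
have := area_comp T rr; rewrite rhok => /(mulIf kn0) <-.
have t0 : 0 < Num.sqrt (1 + dotv g g) by rewrite sqrtr_gt0 ltr_wpDr ?dotv_ge0.
rewrite mulrC -(area_stretch i t0); apply: area_same_norm => x.
rewrite mulmxA hT dotv_mx rT -mulmxA rr mulmx1 dotv_mx rT gr de.
rewrite /dotv (bigD1 i)//= [RHS](bigD1 i)//= !mul_dg eqxx.
rewrite (eq_bigr (fun k => (x *m stretch i (Num.sqrt (1 + dotv g g))) 0 k *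
   (x *m stretch i (Num.sqrt (1 + dotv g g))) 0 k)); last first.
  by move=> k /negbTE ki; rewrite !mul_dg ki mulr1.
rewrite -!/(dotv g g) exprMn enorm_sq [RHS]addrC [LHS]addrAC [LHS]addrC; congr (_ + _).
rewrite mulrACA -(expr2 (Num.sqrt _)) sqr_sqrtr; last by rewrite addr_ge0 ?dotv_ge0.
ring.
Qed.

End Fixed.
End AreaFactors.

(** * Area of a facet under a diagonal map *)

(** The diagonal entries of the adjugate of diag(a): the factor by which
    diag(a) multiplies areas in the coordinate hyperplane orthogonal to [i]. *)
Definition cof (R : realType) n (a : 'I_n -> R) (i : 'I_n) : R := \prod_(j | j != i) a j.

Section FacetArea.
Context {R : realType} {s : nat}.
Hypothesis kap0 : 0 < hv s (@cube R s).
Let kap := hv s (@cube R s).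

(** Projection along the i-th axis. *)
Definition drop_mx (i : 'I_s.+1) : 'M[R]_(s.+1, s) := \matrix_(j, k) (j == lift i k)%:R.
(** Parametrization of the hyperplane x_i = y.g by the other coordinates. *)
Definition graph_mx (i : 'I_s.+1) (g : 'rV[R]_s) : 'M[R]_(s, s.+1) :=
  \matrix_(k, j) (if unlift i j is Some k' then (k == k')%:R else g 0 k).

Lemma mul_drop i (x : 'rV[R]_s.+1) k : (x *m drop_mx i) 0 k = x 0 (lift i k).
Proof.
rewrite !mxE (bigD1 (lift i k))//= !mxE eqxx mulr1 big1 ?addr0// => j /negbTE h.
by rewrite mxE h mulr0.
Qed.

Lemma mul_graph_lift i g (y : 'rV[R]_s) k : (y *m graph_mx i g) 0 (lift i k) = y 0 k.
Proof.
rewrite !mxE (bigD1 k)//= mxE liftK eqxx mulr1 big1 ?addr0// => j /negbTE h.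
by rewrite mxE liftK h mulr0.
Qed.

Lemma mul_graph_i i g (y : 'rV[R]_s) : (y *m graph_mx i g) 0 i = dotv y g.
Proof. by rewrite !mxE; apply: eq_bigr => k _; rewrite mxE unlift_none. Qed.

Lemma dotv_lift i (x y : 'rV[R]_s.+1) :
  dotv x y = x 0 i * y 0 i + dotv (x *m drop_mx i) (y *m drop_mx i).
Proof.
rewrite /dotv (bigD1_ord i)//=; congr (_ + _); apply: eq_bigr => k _.
by rewrite !mul_drop.
Qed.

Lemma graph_drop i g : graph_mx i g *m drop_mx i = 1%:M.
Proof.
apply/row_matrixP => k; rewrite !rowE mulmxA mulmx1; apply/rowP => l.
by rewrite mul_drop mul_graph_lift.
Qed.

Lemma graph_norm i g (y : 'rV[R]_s) :
  dotv (y *m graph_mx i g) (y *m graph_mx i g) = dotv y y + dotv y g ^+ 2.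
Proof. by rewrite (dotv_lift i) mul_graph_i -mulmxA graph_drop mulmx1 addrC expr2. Qed.

(** The hyperplane orthogonal to [n] is the graph of this slope over the
    i-th coordinate hyperplane. *)
Definition slope i (n : 'rV[R]_s.+1) : 'rV[R]_s := \row_k (- n 0 (lift i k) / n 0 i).

Lemma plane_graph i (n x : 'rV[R]_s.+1) (c : R) : n 0 i != 0 -> dotv x n = c ->
  x = (x *m drop_mx i) *m graph_mx i (slope i n) + (c / n 0 i) *: delta_mx 0 i.
Proof.
move=> ni xn; apply/rowP => j; case: (unliftP i j) => [k|] ->.
  by rewrite mxE mul_graph_lift mul_drop !mxE eqxx eq_sym (negbTE (neq_lift i k)) mulr0 addr0.
rewrite mxE mul_graph_i !mxE !eqxx mulr1; apply: (mulIf ni).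
rewrite mulrDl divfK// -xn (dotv_lift i).
have -> : dotv (x *m drop_mx i) (slope i n) = - dotv (x *m drop_mx i) (n *m drop_mx i) / n 0 i.
  rewrite /dotv -sumrN mulr_suml; apply: eq_bigr => k _.
  by rewrite !mul_drop mxE !mulNr mulrN mulrA.
by rewrite divfK// addrC addrK.
Qed.

(** Stretching a graph gives a graph over the stretched base, with a new
    slope. *)
Lemma graph_dg i g (a : 'I_s.+1 -> R) : (forall j, a j != 0) ->
  graph_mx i g *m dg a =
  dg (fun k => a (lift i k)) *m graph_mx i (\row_k (g 0 k * a i / a (lift i k))).
Proof.
move=> a0; apply/row_matrixP => k; rewrite !rowE !mulmxA; set y := delta_mx _ _.
apply/rowP => j; rewrite mul_dg; case: (unliftP i j) => [l|] ->.
  by rewrite !mul_graph_lift mul_dg.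
rewrite !mul_graph_i /dotv mulr_suml; apply: eq_bigr => l _.
by rewrite mul_dg !mxE; field.
Qed.

Lemma cof_lift i (a : 'I_s.+1 -> R) : cof a i = \prod_k a (lift i k).
Proof.
rewrite /cof big_mkcond (bigD1_ord i)//= eqxx mul1r; apply: eq_bigr => k _.
by rewrite eq_sym neq_lift.
Qed.

Lemma cof_prod n (a : 'I_n -> R) i : a i * cof a i = \prod_j a j.
Proof. by rewrite [RHS](bigD1 i). Qed.

(** A subset of a hyperplane not parallel to the i-th axis is, up to
    translation, a graph over its projection along that axis. *)
Lemma hv_plane i (n : 'rV[R]_s.+1) (c : R) (a : 'I_s.+1 -> R) (phi : set 'rV[R]_s.+1) :
  n 0 i != 0 -> (forall x, phi x -> dotv x n = c) ->
  hausdorff_measure s (imx (dg a) phi) =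
  hausdorff_measure s (imx (graph_mx i (slope i n) *m dg a) (imx (drop_mx i) phi)).
Proof.
move=> ni hphi; rewrite imx_comp; pose t : 'rV[R]_s.+1 := (c / n 0 i) *: delta_mx 0 i.
rewrite -(H_translate s (imx (drop_mx i *m _) phi) (t *m dg a)); congr hausdorff_measure.
have e x : phi x -> x *m dg a = x *m (drop_mx i *m (graph_mx i (slope i n) *m dg a)) + t *m dg a.
  by move=> px; rewrite {1}(plane_graph ni (hphi x px)) -/t mulmxDl !mulmxA.
apply/seteqP; split=> [_ [x px <-]|_ [_ [x px <-] <-]].
  by rewrite (e x px); exists (x *m (drop_mx i *m (graph_mx i (slope i n) *m dg a))) => //; exists x.
by exists x => //; rewrite (e x px).
Qed.

(** Project along an axis [i] with [n 0 i != 0]. The image is a graph over a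
    stretched body, whose area is known from [area_dg] and [area_graph]; the
    factors combine to the norm of the vector of the cofactors times the
    normal. *)
Lemma facet_area (n : 'rV[R]_s.+1) (phi : set 'rV[R]_s.+1) : n != 0 ->
  cvx phi -> bnd phi -> (forall x, phi x -> dotv x n = 1) ->
  (exists (z : 'rV[R]_s.+1) (r : R), [/\ 0 < r, dotv z n = 1 &
     forall y, dotv y n = 1 -> `|y - z| <= r -> phi y]) ->
  exists2 theta : R, 0 <= theta & forall a : 'I_s.+1 -> R, (forall i, 0 < a i) ->
    hv s (imx (dg a) phi) = theta * enorm (\row_i (cof a i * n 0 i)).
Proof.
move=> n0 cphi bphi hphi [z [r [r0 zn hz]]].
have [i ni] : exists i, n 0 i != 0.
  by apply/existsP; apply: contraNT n0 => /existsPn h; apply/eqP/rowP => j; rewrite mxE; apply/eqP/negPn.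
pose B := imx (drop_mx i) phi; pose g := slope i n.
have bB : has_ball B.
  have [L L0 hL] := norm_mulmx (graph_mx i g).
  exists (z *m drop_mx i), (r / L); split; first by rewrite divr_gt0.
  move=> y hy; exists (y *m graph_mx i g + (1 / n 0 i) *: delta_mx 0 i).
    apply: hz.
      rewrite dotvDl (dotv_lift i) mul_graph_i -mulmxA graph_drop mulmx1 dotvZl.
      have -> : dotv (delta_mx 0 i) n = n 0 i.
        rewrite /dotv (bigD1 i)//= big1 ?addr0 ?mxE ?eqxx ?mul1r//.
        by move=> j /negbTE ji; rewrite !mxE ji andbF mul0r.
      have -> : dotv y g = - dotv y (n *m drop_mx i) / n 0 i.
        rewrite /dotv -sumrN mulr_suml; apply: eq_bigr => k _.
        by rewrite !mul_drop mxE !mulNr mulrN mulrA.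
      by rewrite divfK// divfK// addNr add0r.
    rewrite [X in _ - X](plane_graph ni zn) opprD addrACA subrr addr0 -mulmxBl.
    by rewrite (le_trans (hL _))// -ler_pdivlMl// mulrC.
  rewrite mulmxDl -mulmxA graph_drop mulmx1 -scalemxAl.
  rewrite (_ : delta_mx 0 i *m drop_mx i = 0) ?scaler0 ?addr0//.
  by apply/rowP => k; rewrite mul_drop !mxE eqxx eq_sym (negbTE (neq_lift i k)).
have cB : cvx B by exact: imx_cvx.
have bndB : bnd B by exact: bnd_imx.
have kn0 : kap != 0 by rewrite gt_eqF.
exists (hv s B / `|n 0 i|); first by rewrite divr_ge0 ?hv_ge0.
move=> a a0; have an0 j : a j != 0 by rewrite gt_eqF.
rewrite {1}/hv (hv_plane a ni hphi) -/(hv s _) -/g -/B.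
pose g' := \row_k (g 0 k * a i / a (lift i k)).
have J1 : area_factor (graph_mx i g *m dg a) = kap * Num.sqrt (1 + dotv g' g') * \prod_k a (lift i k).
  rewrite graph_dg//; apply: (mulIf kn0).
  rewrite (area_comp _ (dgV (a := fun k => a (lift i k)) (fun k => an0 _))).
  rewrite (area_graph kap0 (graph_norm i _)) area_dg//.
  by rewrite -!/kap; ring.
apply: (mulIf kn0); rewrite area_law// J1.
have -> : enorm (\row_j (cof a j * n 0 j)) =
    `|n 0 i| * Num.sqrt (1 + dotv g' g') * \prod_k a (lift i k).
  have p0 : 0 < \prod_k a (lift i k) by apply: prodr_gt0.
  rewrite -cof_lift in p0 *.
  rewrite -(gtr0_norm p0) mulrAC -normrM -sqrtr_sqr -sqrtrM ?sqr_ge0//; congr Num.sqrt.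
  rewrite (dotv_lift i) mulrDr mulr1; congr (_ + _); first by rewrite mxE; ring.
  rewrite /dotv mulr_sumr; apply: eq_bigr => k _; rewrite mul_drop !mxE.
  have -> : cof a (lift i k) = a i * cof a i / a (lift i k).
    by rewrite cof_prod -(cof_prod a (lift i k)) mulrC mulKf.
  by field; rewrite ni an0.
by rewrite -!/kap; field; rewrite normr_eq0.
Qed.

(** Two different hyperplanes cut each other in a flat that projects into a
    hyperplane of R^s. *)
Lemma facet_null (n n' : 'rV[R]_s.+1) (phi : set 'rV[R]_s.+1) a : n != 0 -> n' != n ->
  bnd phi -> (forall x, phi x -> dotv x n = 1) -> (forall x, phi x -> dotv x n' = 1) ->
  hausdorff_measure s (imx (dg a) phi) = 0%E.
Proof.
move=> n0 nn bphi hphi hphi'.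
have [[x0 px0]|] := pselect (phi !=set0); last first.
  move=> e; have -> : phi = set0 by apply/eqP; apply: contrapT => /negP/set0P.
  rewrite (_ : imx _ _ = set0) ?H0//.
  by apply/seteqP; split => // ? [].
have [i ni] : exists i, n 0 i != 0.
  by apply/existsP; apply: contraNT n0 => /existsPn h; apply/eqP/rowP => j; rewrite mxE; apply/eqP/negPn.
rewrite (hv_plane a ni hphi).
pose w := n' - (n' 0 i / n 0 i) *: n.
apply: (@H_flat_null R s _ _ _ (w *m drop_mx i) (1 - n' 0 i / n 0 i)).
- exact: bnd_imx.
- apply: contra nn => /eqP w0.
  have e : w = 0.
    apply/rowP => j; rewrite [RHS]mxE; case: (unliftP i j) => [k|] ->.
      by have /rowP/(_ k) := w0; rewrite mul_drop => ->; rewrite mxE.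
    by rewrite !mxE divfK// subrr.
  have := dotv0r x0; rewrite -e /w dotvBr dotvZr hphi// hphi'// mulr1 => /eqP.
  rewrite subr_eq0 => /eqP e1.
  by rewrite -subr_eq0; move: e; rewrite /w -e1 scale1r => ->.
- move=> _ [x px <-].
  have := dotv_lift i x w; rewrite {1}/w dotvBr dotvZr hphi// hphi'// mulr1 => ->.
  by rewrite !mxE divfK// subrr mulr0 add0r.
Qed.

End FacetArea.

(** * Boundaries, and monotonicity of surface area *)

Section Boundary.
Context {R : realType}.

Lemma closureP d (A : set 'rV[R]_d) x :
  closure A x <-> forall e : R, 0 < e -> exists2 y, A y & `|x - y| < e.
Proof.
split=> [cA e e0|h B /nbhs_ballP[e /= e0 eB]].
  have [y [Ay]] := cA _ (nbhsx_ballx x e e0).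
  by rewrite -ball_normE /= => xy; exists y.
have [y Ay xy] := h e e0; exists y; split => //; apply: eB.
by rewrite -ball_normE.
Qed.

Lemma boundaryE d (A : set 'rV[R]_d) : boundary A = closure A `&` closure (~` A).
Proof. by rewrite /boundary setDE closure_setC. Qed.

(** Bi-Lipschitz bijections are homeomorphisms; stated with explicit
    constants so that it applies to linear and to affine maps. *)
Lemma closure_bilip d (f g : 'rV[R]_d -> 'rV[R]_d) (L : R) A : 0 < L ->
  (forall x y, `|f x - f y| <= L * `|x - y|) ->
  (forall x y, `|g x - g y| <= L * `|x - y|) -> cancel f g -> cancel g f ->
  closure (f @` A) = f @` closure A.
Proof.
move=> L0 fL gL fg gf; apply/seteqP; split=> [y /closureP h|_ [x /closureP h <-]].
  exists (g y) => //; apply/closureP => e e0.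
  have [|_ [x Ax <-] xy] := h (e / L); first by rewrite divr_gt0.
  exists x => //; rewrite -[x]fg (le_lt_trans (gL _ _))//.
  by rewrite mulrC -ltr_pdivlMr.
apply/closureP => e e0; have [|x' Ax' xx'] := h (e / L); first by rewrite divr_gt0.
exists (f x'); first by exists x'.
by rewrite (le_lt_trans (fL _ _))// mulrC -ltr_pdivlMr.
Qed.

Lemma boundary_bilip d (f g : 'rV[R]_d -> 'rV[R]_d) (L : R) A : 0 < L ->
  (forall x y, `|f x - f y| <= L * `|x - y|) ->
  (forall x y, `|g x - g y| <= L * `|x - y|) -> cancel f g -> cancel g f ->
  boundary (f @` A) = f @` boundary A.
Proof.
move=> L0 fL gL fg gf; rewrite !boundaryE.
have -> : ~` (f @` A) = f @` (~` A).
  apply/seteqP; split=> [y h|_ [x nAx <-] [x' Ax' e]].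
    by exists (g y) => // Ag; apply: h; exists (g y).
  by apply: nAx; rewrite -(fg x) -e fg.
rewrite !(closure_bilip A L0 fL gL fg gf) !(closure_bilip _ L0 fL gL fg gf).
apply/seteqP; split=> [_ [[x Ax <-] [x' Ax' e]]|_ [x [Ax Ax'] <-]].
  by exists x => //; split => //; rewrite -(fg x) -e fg.
by split; exists x.
Qed.

Lemma boundary_imx d (T T' : 'M[R]_d) A : T *m T' = 1%:M ->
  boundary (imx T A) = imx T (boundary A).
Proof.
move=> TT'; have T'T := mulmx1C TT'.
have [L1 L10 h1] := mulmx_lip T; have [L2 L20 h2] := mulmx_lip T'.
have lip (S : 'M[R]_d) (L : R) : 0 < L -> (forall x, enorm (x *m S) <= L * enorm x) ->
    L <= L1 + L2 -> forall x y : 'rV[R]_d, `|x *m S - y *m S| <= (L1 + L2) * d%:R * `|x - y|.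
  move=> L0 h LL x y; rewrite -mulmxBl (le_trans (norm_le_enorm _))// (le_trans (h _))//.
  rewrite -mulrA ler_pM ?enorm_ge0 ?(ltW L0)// enorm_le_norm//.
have LL0 : 0 < (L1 + L2) * d%:R + 1.
  by rewrite ltr_wpDl// mulr_ge0// addr_ge0// ltW.
apply: (@boundary_bilip d (mulmx^~ T) (mulmx^~ T') _ A LL0).
- move=> x y; rewrite (le_trans (lip T L1 L10 h1 _ x y))// ?lerDl ?(ltW L20)//.
  by rewrite ler_wpM2r// lerDl.
- move=> x y; rewrite (le_trans (lip T' L2 L20 h2 _ x y))// ?lerDr ?(ltW L10)//.
  by rewrite ler_wpM2r// lerDl.
- by move=> x; rewrite -mulmxA TT' mulmx1.
- by move=> x; rewrite -mulmxA T'T mulmx1.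
Qed.

Lemma affine_lip d (a : R) (t x y : 'rV[R]_d) :
  `|(a *: x + t) - (a *: y + t)| = `|a| * `|x - y|.
Proof. by rewrite opprD addrACA subrr addr0 -scalerBr normrZ. Qed.

Lemma boundary_affine d (a : R) (t : 'rV[R]_d) A : 0 < a ->
  boundary [set a *: x + t | x in A] = [set a *: x + t | x in boundary A].
Proof.
move=> a0; have a1 : a != 0 by rewrite gt_eqF.
have L0 : 0 < a + a^-1 by rewrite addr_gt0 ?invr_gt0.
apply: (@boundary_bilip d (fun x => a *: x + t) (fun x => a^-1 *: x - a^-1 *: t) _ A L0).
- by move=> x y; rewrite affine_lip gtr0_norm// ler_wpM2r// lerDl invr_ge0 ltW.
- by move=> x y; rewrite affine_lip gtr0_norm ?invr_gt0// ler_wpM2r// lerDr ltW.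
- by move=> x; rewrite -scalerBr addrK scalerA mulVf// scale1r.
- by move=> x; rewrite -scalerBr scalerA mulfV// scale1r subrK.
Qed.

Lemma closure_cvx d (K : set 'rV[R]_d) : cvx K -> cvx (closure K).
Proof.
move=> cK x y t /closureP hx /closureP hy t0 t1; apply/closureP => e e0.
have [x' Kx' xx'] := hx e e0; have [y' Ky' yy'] := hy e e0.
exists (t *: x' + (1 - t) *: y'); first exact: cK.
have -> : t *: x + (1 - t) *: y - (t *: x' + (1 - t) *: y') = t *: (x - x') + (1 - t) *: (y - y').
  by rewrite opprD addrACA -!scalerBr.
have t1' : 0 <= 1 - t by rewrite subr_ge0.
rewrite (le_lt_trans (ler_normD _ _))// !normrZ !ger0_norm//.
have [->|tn0] := eqVneq t 0; first by rewrite mul0r add0r subr0 mul1r.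
have tp : 0 < t by rewrite lt_neqAle eq_sym tn0.
have h1 : t * `|x - x'| < t * e by rewrite ltr_pM2l.
have h2 : (1 - t) * `|y - y'| <= (1 - t) * e by rewrite ler_wpM2l// ltW.
lra.
Qed.

Lemma closure_bnd d (K : set 'rV[R]_d) : bnd K -> bnd (closure K).
Proof.
move=> [M hM]; exists (M + 1) => x /closureP/(_ 1 ltr01)[y Ky xy].
rewrite -[x](subrK y) (le_trans (ler_normD _ _))// addrC lerD ?hM// ltW//.
Qed.

(** A point of the closure, moved towards an interior point [c], enters the
    set: the error of an approximation by a point of [K] is absorbed by the
    ball. *)
Lemma shrink_closure d (K : set 'rV[R]_d) c (r l : R) x : cvx K -> 0 < r ->
  (forall y, `|y - c| <= r -> K y) -> closure K x -> 0 <= l -> l < 1 ->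
  K (l *: x + (1 - l) *: c).
Proof.
move=> cK r0 hr /closureP hx l0 l1.
have l1' : 0 < 1 - l by rewrite subr_gt0.
have [|k Kk xk] := hx ((1 - l) * r); first by rewrite mulr_gt0.
have -> : l *: x + (1 - l) *: c = l *: k + (1 - l) *: (c + (l / (1 - l)) *: (x - k)).
  by apply/rowP => i; rewrite !mxE; field; rewrite gt_eqF.
apply: cK => //; last exact: ltW.
apply: hr; rewrite addrC addKr normrZ ger0_norm ?divr_ge0 ?(ltW l1')//.
rewrite mulrAC ler_pdivrMr// [leRHS]mulrC; apply: le_trans (ltW xk).
by rewrite ler_piMl// ltW.
Qed.

(** The nearest-point map. It is characterised by an obtuse angle, and
    adding the two obtuse angle inequalities for [z] and [w] shows that it
    does not increase distances. *)
Lemma proj_exists d (K : set 'rV[R]_d) : closed K -> cvx K -> K !=set0 ->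
  exists P : 'rV[R]_d -> 'rV[R]_d, [/\ forall z, K (P z),
    forall z p, K p -> (forall y, K y -> dotv (z - p) (y - p) <= 0) -> P z = p,
    forall z y, K y -> dotv (z - P z) (y - P z) <= 0 &
    forall z w, enorm (P z - P w) <= enorm (z - w)].
Proof.
move=> clK cK K0.
have /choice[P hP] z : exists p, K p /\ forall y, K y -> dotv (z - p) (y - p) <= 0.
  have [p [Kp pm]] := closest_exists z clK K0.
  by exists p; split => //; exact: closest_obtuse.
exists P; split => [z|z p Kp hp|z y Ky|z w].
- exact: (hP z).1.
- have [Kq hq] := hP z.
  apply/eqP; rewrite -subr_eq0 -dotv_eq0 eq_le dotv_ge0 andbT.
  have := hp _ Kq; have := hq _ Kp.
  by rewrite !(dotvBl, dotvBr) (dotvC p (P z)); lra.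
- by apply: (hP z).2.
- have [Kp hp] := hP z; have [Kq hq] := hP w.
  have h : dotv (P z - P w) (P z - P w) <= dotv (z - w) (P z - P w).
    have := hp _ Kq; have := hq _ Kp.
    by rewrite !(dotvBl, dotvBr); lra.
  have := le_trans h (cauchy_schwarz _ _).
  rewrite -enorm_sq expr2 => h2.
  have [->|p0] := eqVneq (enorm (P z - P w)) 0; first exact: enorm_ge0.
  by move: h2; rewrite ler_pM2r// lt_neqAle eq_sym p0 enorm_ge0.
Qed.

(** The last point of the ray in the closure of [L]. *)
Lemma exit_point d (L : set 'rV[R]_d) p v : bnd L -> closure L p -> v != 0 ->
  exists2 t : R, 0 <= t & boundary L (p + t *: v).
Proof.
move=> bL Lp v0; have [M hM] := closure_bnd bL.
have nv : 0 < `|v| by rewrite normr_gt0.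
pose f (t : R) := p + t *: v.
have fc : continuous f.
  move=> t; have sc : continuous (fun t : R => t *: v).
    by apply: scale_cont => u; exact: cvg_id.
  have cc : continuous (fun _ : R => p) by move=> u; exact: cst_continuous.
  exact: (continuousD (cc t) (sc t)).
pose S := [set t : R | 0 <= t] `&` f @^-1` closure L.
have bndt t : S t -> t <= (M + `|p|) / `|v|.
  move=> [t0 /hM h]; rewrite ler_pdivlMr// -[t]ger0_norm// -normrZ.
  rewrite (_ : t *: v = f t - p) ?(le_trans (ler_normB _ _)) ?lerD2r//.
  by rewrite /f addrC addKr.
have kS : compact S.
  apply: (@subclosed_compact _ S `[0, (M + `|p|) / `|v|]%classic).
  - apply: closedI; first exact: closed_ge.
    by apply: preimage_closed => [t _|]; [exact: fc|exact: closed_closure].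
  - exact: segment_compact.
  - by move=> t St; rewrite /= in_itv/= bndt// andbT; case: St.
have S0 : S !=set0 by exists 0; split; [exact: lexx|rewrite /f /= scale0r addr0].
have idc : continuous (id : R -> R) by move=> u; exact: cvg_id.
have [t] := compact_EVT_max S0 kS (continuous_subspaceT idc).
rewrite inE => -[t0 Lt] tm; exists t => //.
rewrite boundaryE; split => //; apply/closureP => e e0.
pose h := e / (2 * `|v|); have h0 : 0 < h by rewrite divr_gt0// mulr_gt0.
exists (f (t + h)).
  move=> Lf; have : t + h <= t.
    apply: tm; rewrite inE; split; first by rewrite /= addr_ge0// ltW.
    exact: subset_closure.
  by rewrite gerDl leNgt h0.
rewrite /f scalerDl addrA opprD addNKr normrN normrZ gtr0_norm//.
by rewrite /h invfM mulrA mulfVK ?gt_eqF// ltr_pdivrMr// ltr_pMr// ltr1n.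
Qed.

(** The nearest-point projection onto the closure of [K] does not increase
    distances and the image of the boundary of [L] covers the boundary of
    [K]: a point z just outside the closure of [K] lies on the ray from its
    projection P z to the exit point from [L], and the whole ray projects to
    P z. As the image of the boundary of [L] is compact, boundary points of
    [K] are reached as limits of such P z. *)
Lemma surf_mono s d (K L : set 'rV[R]_d) : cvx K -> has_ball K -> K `<=` L -> bnd L ->
  (hausdorff_measure s (boundary K) <= hausdorff_measure s (boundary L))%E.
Proof.
move=> cK [c [r [r0 hr]]] KL bL.
have Kc : K c by apply: hr; rewrite subrr normr0 ltW.
have cKne : closure K !=set0 by exists c; exact: subset_closure.
have [P [PK Puniq Pob Plip]] := proj_exists (@closed_closure _ K) (closure_cvx cK) cKne.
suff sub : boundary K `<=` P @` boundary L.
  apply: (le_trans (H_le s sub)).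
  have := @H_lipschitz R s _ (boundary L) d d P id 1 ltr01.
  rewrite expr1n mul1e image_id; apply.
  by move=> x y _ _; rewrite mul1r.
have Pc : continuous P.
  move=> x; apply/(@cvgrPdist_lt R 'rV[R]_d _ (nbhs x) (nbhs_filter x) P (P x)) => e e0.
  have de0 : 0 < e / (d%:R + 1) by rewrite divr_gt0// ltr_wpDl.
  have := nbhsx_ballx x _ de0; apply: filterS => y; rewrite -ball_normE /= => xy.
  rewrite (le_lt_trans (norm_le_enorm _))// (le_lt_trans (Plip _ _))//.
  rewrite (le_lt_trans (enorm_le_norm _))//.
  apply: (@le_lt_trans _ _ ((d%:R + 1) * `|x - y|)); first by rewrite ler_wpM2r// lerDl.
  by rewrite mulrC -ltr_pdivlMr ?ltr_wpDl.
have kP : compact (P @` boundary L).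
  apply: continuous_compact; first exact: continuous_subspaceT.
  apply: bounded_closed_compact.
    have [M hM] := closure_bnd bL; exists M; split; first exact: num_real.
    by move=> M' MM' x [/hM h _]; exact: le_trans h (ltW MM').
  by rewrite boundaryE; apply: closedI; exact: closed_closure.
have clP : closed (P @` boundary L) by apply: compact_closed => //; exact: norm_hausdorff.
have onK z : ~ closure K z -> (P @` boundary L) (P z).
  move=> nKz; have v0 : z - P z != 0.
    by apply: contra_notN nKz; rewrite subr_eq0 => /eqP ->; exact: PK.
  have [t t0 bt] := exit_point bL (closureS KL (PK z)) v0.
  exists (P z + t *: (z - P z)) => //; apply: Puniq; first exact: PK.
  move=> y Ky; rewrite addrC addKr dotvZl mulr_ge0_le0//; exact: Pob.
move=> y; rewrite boundaryE => -[Ky /closureP nKy].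
have Py : P y = y by apply: Puniq => // w _; rewrite subrr dotv0l.
apply: clP; apply/closureP => e e0.
have de0 : 0 < d%:R + 1 :> R by rewrite ltr_wpDl.
pose e1 := e / (d%:R + 1).
have e10 : 0 < e1 by rewrite divr_gt0.
have [|z0 nKz0 yz0] := nKy (e1 / 2); first by rewrite divr_gt0.
(* z0 is off K but possibly in its closure; pushed away from c it leaves it *)
pose tau := e1 / 2 / (`|z0 - c| + 1).
have z0c : 0 < `|z0 - c| + 1 by rewrite ltr_wpDl.
have tau0 : 0 < tau by rewrite !divr_gt0.
pose z := z0 + tau *: (z0 - c).
have nKz : ~ closure K z.
  move=> Kz; apply: nKz0.
  have := shrink_closure (l := (1 + tau)^-1) cK r0 hr Kz _ _.
  rewrite (_ : _ + _ = z0); last first.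
    by apply/rowP => i; rewrite /z !mxE; field; rewrite gt_eqF// addr_gt0.
  apply; first by rewrite invr_ge0 addr_ge0// ltW.
  by rewrite invf_lt1 ?ltrDl// addr_gt0.
exists (P z); first exact: onK.
rewrite -{1}Py (le_lt_trans (norm_le_enorm _))// (le_lt_trans (Plip _ _))//.
rewrite (le_lt_trans (enorm_le_norm _))//.
apply: (@le_lt_trans _ _ ((d%:R + 1) * `|y - z|)); first by rewrite ler_wpM2r// lerDl.
rewrite mulrC -ltr_pdivlMr// -/e1 /z opprD addrA (le_lt_trans (ler_normB _ _))//.
have h2 : `|tau *: (z0 - c)| <= e1 / 2.
  rewrite normrZ gtr0_norm// /tau.
  have q : `|z0 - c| / (`|z0 - c| + 1) <= 1 by rewrite ler_pdivrMr// mul1r lerDl.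
  have e12 : 0 <= e1 / 2 by rewrite divr_ge0// ltW.
  by have := ler_wpM2l e12 q; rewrite mulr1 mulrA mulrAC.
lra.
Qed.

End Boundary.

(** * Truncation of unbounded convex sets *)

Section Exhaust.
Context {R : realType} {d s : nat}.
Local Open Scope ereal_scope.
Variable (A : set 'rV[R]_d).

Let An (n : nat) : set 'rV[R]_d := A `&` [set x | (n%:R <= `|x| < n.+1%:R)%R].
Let BN (n : nat) : set 'rV[R]_d := A `&` [set x | (`|x| < n%:R)%R].
Let En (e n : nat) : set 'rV[R]_d :=
  A `&` [set x | exists2 i : nat, (i < n)%N & ((i.*2 + e)%:R <= `|x| < (i.*2 + e).+1%:R)%R].

(** Annuli of the same parity are at distance at least 1 from each other. *)
Lemma annuli_le (e n : nat) :
  \sum_(0 <= i < n) hausdorff_measure s (An (i.*2 + e)) <= hausdorff_measure s (En e n).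
Proof.
elim: n => [|n IH]; first by rewrite big_nil H_ge0.
rewrite big_nat_recr//=; apply: (le_trans (leeD2r _ IH)).
apply: (le_trans (@H_separated _ _ s 1%R (En e n) (An (n.*2 + e)) ltr01 _)).
  move=> a b [_ [i ilt /andP[_ ha]]] [_ /andP[hb _]].
  apply: (@le_trans _ _ (`|b| - `|a|)%R); last first.
    by rewrite (le_trans (lerB_dist _ _))// distrC norm_le_enorm.
  have : (((i.*2 + e).+2)%:R <= (n.*2 + e)%:R :> R)%R by rewrite ler_nat; lia.
  move: ha hb; rewrite -!natr1; lra.
apply: H_le => x [[Ax [i ilt hx]]|[Ax hx]]; split => //.
  by exists i => //; rewrite ltnS ltnW.
by exists n.
Qed.

(** The annuli of even index, and those of odd index, are separated, so
    their measures have a finite sum. The part of [A] far away is therefore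
    small. *)
Lemma H_exhaust (c : R) : (forall N, hausdorff_measure s (BN N) <= c%:E) ->
  hausdorff_measure s A <= c%:E.
Proof.
move=> hc.
have EB e N : (e <= 1)%N -> hausdorff_measure s (En e N) <= c%:E.
  move=> e1; apply: le_trans (hc N.*2); apply: H_le => x [Ax [i iN /andP[_ h]]].
  split => //=; apply: (lt_le_trans h); rewrite ler_nat; lia.
have part N : \sum_(0 <= i < N.*2) hausdorff_measure s (An i) <= (c + c)%:E.
  have -> : \sum_(0 <= i < N.*2) hausdorff_measure s (An i) =
     \sum_(0 <= i < N) hausdorff_measure s (An (i.*2 + 0)) +
     \sum_(0 <= i < N) hausdorff_measure s (An (i.*2 + 1)).
    elim: N => [|N IH]; first by rewrite !big_nil adde0.
    rewrite doubleS !big_nat_recr//= IH addn0 addn1.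
    by rewrite -!addeA; congr (_ + _); rewrite addeCA.
  by rewrite EFinD; apply: leeD; apply: (le_trans (annuli_le _ _)); exact: EB.
have tot : \sum_(0 <= i <oo) hausdorff_measure s (An i) <= (c + c)%:E.
  apply: lime_le; first by apply: is_cvg_nneseries => i _ _; exact: H_ge0.
  near=> n; apply: le_trans (part n).
  have -> : n.*2 = (n + n)%N by lia.
  rewrite [X in _ <= X](@big_cat_nat _ _ _ n) ?leq_addr//= leeDl// sume_ge0// => i _.
  exact: H_ge0.
have tail := @nneseries_tail_cvg R (fun i => hausdorff_measure s (An i)) xpredT (le_lt_trans tot (ltry _)) _.
apply/lee_addgt0Pr => e e0.
have [N hN] : exists N, \sum_(N <= i <oo) hausdorff_measure s (An i) <= e%:E.
  have /fine_cvgP[fN /cvgrPdist_lt/(_ e e0)] := tail (fun k _ => H_ge0 _ _).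
  move=> h; near \oo => N; exists N.
  have fin : \sum_(N <= i <oo) hausdorff_measure s (An i) \is a fin_num by near: N.
  rewrite -(fineK fin) lee_fin.
  have : (`|0 - fine (\sum_(N <= i <oo) hausdorff_measure s (An i))| < e)%R by near: N.
  rewrite sub0r normrN => /ltW; apply: le_trans; exact: ler_norm.
apply: (le_trans _ (leeD (hc N) hN)).
apply: (@le_trans _ _ (hausdorff_measure s (BN N `|` \bigcup_i An (i + N)))).
  apply: H_le => x Ax; have [lt|ge] := ltP `|x|%R (N%:R : R)%R; first by left.
  right; have /andP[h1 h2] := truncn_itv (normr_ge0 x).
  have NT : (N <= Num.truncn `|x|%R)%N.
    by rewrite -ltnS -(@ltr_nat R) (le_lt_trans ge).
  by exists (Num.truncn `|x|%R - N)%N => //; split => //; rewrite /= subnK//= h1.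
apply: (le_trans (H_U _ _ _)); rewrite leeD2l//.
apply: (le_trans (H_sigma _ _)).
rewrite (@nneseries_addn _ (fun i => hausdorff_measure s (An i)) N)// => i.
exact: H_ge0.
Unshelve. all: by end_near.
Qed.

End Exhaust.

(** Inside the ball of radius [N] the boundary of [K] is part of the
    boundary of the truncated set, and these parts exhaust the boundary of
    [K]. *)
Lemma truncation (R : realType) (d s : nat) (K : set 'rV[R]_d) (c1 c2 : R) : cvx K ->
  c2 < c1 -> (c1%:E <= hausdorff_measure s (boundary K))%E ->
  exists K', [/\ cvx K', bnd K', K' `<=` K & (c2%:E <= hausdorff_measure s (boundary K'))%E].
Proof.
move=> cK c12 hK; apply: contrapT => nex.
have : (hausdorff_measure s (boundary K) <= c2%:E)%E.
  apply: H_exhaust => N; rewrite leNgt; apply/negP => h; apply: nex.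
  exists (K `&` [set x | `|x| < N%:R]); split.
  - apply: cvxI => // x y t /= hx hy t0 t1.
    have t1' : 0 <= 1 - t by rewrite subr_ge0.
    rewrite (le_lt_trans (ler_normD _ _))// !normrZ !ger0_norm//.
    have [->|tn0] := eqVneq t 0; first by rewrite mul0r add0r subr0 mul1r.
    have tp : 0 < t by rewrite lt_neqAle eq_sym tn0.
    have h1 : t * `|x| < t * N%:R by rewrite ltr_pM2l.
    have h2 : (1 - t) * `|y| <= (1 - t) * N%:R by rewrite ler_wpM2l// ltW.
    lra.
  - by exists N%:R => x [_ /ltW].
  - by move=> x [].
  - apply: (le_trans (ltW h)); apply: H_le => x [bx xN].
    move: bx; rewrite !boundaryE => -[/closureP Kx nKx]; split; last first.
      by apply: closureS nKx => y nKy [].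
    apply/closureP => e e0; pose e' := Num.min e (N%:R - `|x|).
    have e'0 : 0 < e' by rewrite lt_min e0 subr_gt0.
    have [y Ky xy] := Kx e' e'0; exists y; last by rewrite (lt_le_trans xy)// ge_min lexx.
    split => //=; rewrite -[y](subrK x) (le_lt_trans (ler_normD _ _))// distrC.
    by rewrite -ltrBrDr (lt_le_trans xy)// ge_min lexx orbT.
by move=> /(le_trans hK); rewrite lee_fin leNgt c12.
Qed.

(** * Surface area of a polytope under a diagonal map *)

Section Polytopes.
Context {R : realType}.

(** Normals are scaled so that all facets lie at level 1. *)
Definition polytope d (I : finType) (n : I -> 'rV[R]_d) : set 'rV[R]_d :=
  [set x | forall k, dotv x (n k) <= 1].

Lemma polytope_cvx d (I : finType) (n : I -> 'rV[R]_d) : cvx (polytope n).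
Proof.
move=> x y t Px Py t0 t1 k; rewrite dotvDl !dotvZl.
have t1' : 0 <= 1 - t by rewrite subr_ge0.
have := ler_wpM2l t0 (Px k); have := ler_wpM2l t1' (Py k); lra.
Qed.

Lemma finite_pos_lb (I : finType) (f : I -> R) : (forall i, 0 < f i) ->
  exists2 r, 0 < r & forall i, r <= f i.
Proof.
move=> f0; exists (\big[Num.min/1]_i f i); last by move=> i; exact: bigmin_le.
by apply: (big_ind (fun x => 0 < x)) => // x y x0 y0; rewrite lt_min x0.
Qed.

Lemma H_separated_seq (d s : nat) (I : eqType) (r : seq I) (E : I -> set 'rV[R]_d) (eta : R) :
  0 < eta -> uniq r ->
  (forall j k a b, j != k -> E j a -> E k b -> eta <= enorm (a - b)) ->
  (\sum_(k <- r) hausdorff_measure s (E k) <=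
   hausdorff_measure s [set x | exists2 k, k \in r & E k x])%E.
Proof.
move=> eta0 + sep; elim: r => [|j r IH]; first by rewrite big_nil H_ge0.
rewrite big_cons /= => /andP[jr ur].
apply: (le_trans (leeD2l _ (IH ur))).
apply: (le_trans (@H_separated _ _ s eta (E j) _ eta0 _)).
  move=> a b Ea [k kr Eb]; apply: sep Ea Eb.
  by apply: contraNneq jr => ->.
apply: H_le => x [Ex|[k kr Ex]]; first by exists j => //; rewrite inE eqxx.
by exists k => //; rewrite inE kr orbT.
Qed.

Lemma dotv_small d (x n : 'rV[R]_d) : `|dotv x n| <= d%:R * enorm n * `|x|.
Proof.
rewrite (le_trans (cauchy_schwarz_abs _ _))// mulrC [leRHS]mulrAC.
by rewrite mulrC ler_wpM2r ?enorm_ge0// enorm_le_norm.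
Qed.

Section Surface.
Context {s : nat} {I : finType} (n : I -> 'rV[R]_s.+1).
Hypothesis kap0 : 0 < hv s (@cube R s).
Hypothesis ninj : injective n.
Hypothesis n0 : forall k, n k != 0.
Hypothesis bP : bnd (polytope n).

Let phi k := polytope n `&` [set x | dotv x (n k) = 1].

Lemma phi_cvx k : cvx (phi k).
Proof.
apply: cvxI; first exact: polytope_cvx.
by move=> x y t /= hx hy _ _; rewrite dotvDl !dotvZl hx hy; ring.
Qed.

Lemma phi_bnd k : bnd (phi k).
Proof. by have [M hM] := bP; exists M => x [/hM]. Qed.

Lemma boundary_polytope x : boundary (polytope n) x <-> exists k, phi k x.
Proof.
rewrite boundaryE; split=> [[/closureP cP /closureP cN]|[k [Px xk]]].
  have Px : polytope n x.
    move=> k; rewrite leNgt; apply/negP => h.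
    have D0 : 0 < s.+1%:R * enorm (n k) by rewrite mulr_gt0// enorm_gt0.
    have [|y Py xy] := cP ((dotv x (n k) - 1) / (s.+1%:R * enorm (n k))).
      by rewrite divr_gt0// subr_gt0.
    have := dotv_small (x - y) (n k); rewrite dotvBl leNgt => /negP; apply.
    apply: (@lt_le_trans _ _ (dotv x (n k) - 1)); first by rewrite mulrC -ltr_pdivlMr.
    by rewrite (le_trans _ (ler_norm _))// lerD2l lerN2.
  apply: contrapT => /forallNP nphi.
  have lt1 k : dotv x (n k) < 1.
    by rewrite lt_neqAle Px andbT; apply/eqP => e; apply: (nphi k).
  have D0 k : 0 < s.+1%:R * enorm (n k) by rewrite mulr_gt0// enorm_gt0.
  have [r r0 hr] : exists2 r, 0 < r & forall k, r <= (1 - dotv x (n k)) / (s.+1%:R * enorm (n k)).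
    by apply: finite_pos_lb => k; rewrite divr_gt0// subr_gt0.
  have [y + xy] := cN r r0; apply => k.
  have h1 : s.+1%:R * enorm (n k) * `|y - x| <= 1 - dotv x (n k).
    by rewrite distrC mulrC -ler_pdivlMr// (le_trans (ltW xy)).
  by have := le_trans (ler_norm _) (dotv_small (y - x) (n k)); rewrite dotvBl; lra.
split; first exact: subset_closure.
apply/closureP => e e0; pose t := e / (`|x| + 1).
have x1 : 0 < `|x| + 1 by rewrite ltr_wpDl.
have t0 : 0 < t / 2 by rewrite !divr_gt0.
exists (x + (t / 2) *: x).
  by move=> /(_ k); rewrite dotvDl dotvZl xk; lra.
rewrite opprD addNKr normrN normrZ gtr0_norm//.
have -> : t / 2 * `|x| = e / 2 * (`|x| / (`|x| + 1)) by rewrite /t; field; rewrite gt_eqF.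
have q : `|x| / (`|x| + 1) <= 1 by rewrite ler_pdivrMr// mul1r lerDl.
have e2 : 0 <= e / 2 by rewrite divr_ge0// ltW.
by have := ler_wpM2l e2 q; lra.
Qed.

(** A facet has a point off all the other facet hyperplanes, or is
    negligible: if no other constraint is tight on the whole facet, the
    barycentre of points where the various constraints are slack is such a
    point. *)
Lemma facet_dichotomy k :
  (exists2 z, phi k z & forall j, j != k -> dotv z (n j) < 1) \/
  (phi k = set0 \/ exists2 j, j != k & forall z, phi k z -> dotv z (n j) = 1).
Proof.
have [[z0 pz0]|] := pselect (phi k !=set0); last first.
  by move=> e; right; left; apply/eqP; apply: contrapT => /negP/set0P.
have [[j jk hj]|noj] := pselect (exists2 j, j != k & forall z, phi k z -> dotv z (n j) = 1).
  by right; right; exists j.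
left.
have /choice[z hz] j : exists z, phi k z /\ (j != k -> dotv z (n j) < 1).
  have [->|jk] := eqVneq j k; first by exists z0.
  apply: contrapT => /forallNP h; apply: noj; exists j => // w pw.
  apply/eqP; rewrite eq_le pw.1/= leNgt; apply/negP => lt.
  by apply: (h w).
have N0 : 0 < #|I|%:R :> R by rewrite ltr0n; apply/card_gt0P; exists k.
pose c := (#|I|%:R)^-1 : R.
have c0 : 0 < c by rewrite invr_gt0.
have c1 : \sum_(j : I) c = 1 by rewrite sumr_const -[_ *+ _]mulr_natr mulVf// gt_eqF.
exists (\sum_j c *: z j).
  apply: cvx_sum => //; first exact: phi_cvx.
  - by move=> _; exact: ltW.
  - by move=> j _; exact: (hz j).1.
move=> j jk.
have dsum (r : seq I) : dotv (\sum_(l <- r) c *: z l) (n j) = \sum_(l <- r) c * dotv (z l) (n j).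
  elim: r => [|l r IH]; first by rewrite !big_nil dotv0l.
  by rewrite !big_cons dotvDl dotvZl IH.
rewrite dsum -c1 (bigD1 j)//= [ltRHS](bigD1 j)//= ltr_leD//.
  by rewrite gtr_pMr//; exact: (hz j).2.
by apply: ler_sum => l _; rewrite ler_piMr ?(ltW c0)//; exact: (hz l).1.1.
Qed.

Lemma facet_measure k : exists2 theta : R, 0 <= theta & forall a : 'I_s.+1 -> R,
  (forall i, 0 < a i) -> hv s (imx (dg a) (phi k)) = theta * enorm (\row_i (cof a i * n k 0 i)).
Proof.
have [[z [Pz zk] hz]|[e|[j jk hj]]] := facet_dichotomy k.
- apply: facet_area => //; [exact: phi_cvx|exact: phi_bnd|by move=> x []|].
  have D0 j : 0 < s.+1%:R * enorm (n j) by rewrite mulr_gt0// enorm_gt0.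
  have [r r0 hr] : exists2 r, 0 < r & forall j,
      r <= (if j == k then 1 else (1 - dotv z (n j)) / (s.+1%:R * enorm (n j))).
    apply: finite_pos_lb => j; case: eqP => // /eqP jk.
    by rewrite divr_gt0// subr_gt0 hz.
  exists z, r; split => // y yk yz; split => // j.
  have [->|jk] := eqVneq j k; first by rewrite yk.
  have := hr j; rewrite (negbTE jk) => hrj.
  have := dotv_small (y - z) (n j); rewrite dotvBl.
  have : s.+1%:R * enorm (n j) * `|y - z| <= 1 - dotv z (n j).
    by rewrite mulrC -ler_pdivlMr// (le_trans yz).
  by move=> h1 /(le_trans (ler_norm _)); lra.
- exists 0 => // a a0; rewrite mul0r e /hv (_ : imx _ _ = set0) ?H0//.
  by apply/seteqP; split => // ? [].
- exists 0 => // a a0; rewrite mul0r /hv (@facet_null R s (n k) (n j))//.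
  + by rewrite (inj_eq ninj).
  + exact: phi_bnd.
  + by move=> x [].
Qed.

(** Subadditivity over the facets gives one inequality. For the other,
    shrink each facet towards a relative interior point: the shrunken facets
    are at positive distance from each other, so their areas add up by
    [H_separated], and shrinking costs an arbitrarily small proportion of
    the area. *)
Lemma polytope_surface : exists theta : I -> R, (forall k, 0 <= theta k) /\
  forall a : 'I_s.+1 -> R, (forall i, 0 < a i) ->
    hausdorff_measure s (boundary (imx (dg a) (polytope n))) =
    (\sum_k theta k * enorm (\row_i (cof a i * n k 0 i)))%:E.
Proof.
have /choice[theta htheta] : forall k, exists theta : R, 0 <= theta /\ forall a : 'I_s.+1 -> R,
    (forall i, 0 < a i) -> hv s (imx (dg a) (phi k)) = theta * enorm (\row_i (cof a i * n k 0 i)).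
  by move=> k; have [t t0 ht] := facet_measure k; exists t.
exists theta; split=> [k|a a0]; first exact: (htheta k).1.
under eq_bigr => k _ do rewrite -((htheta k).2 a a0).
have an0 i : a i != 0 by rewrite gt_eqF.
have VA := dgV an0; have AV := mulmx1C VA.
rewrite (boundary_imx _ AV).
have fphi k : (hausdorff_measure s (imx (dg a) (phi k)) < +oo)%E.
  have [i ni] : exists i, n k 0 i != 0.
    apply/existsP; apply: contraNT (n0 k) => /existsPn h.
    by apply/eqP/rowP => j; rewrite mxE; apply/eqP/negPn.
  rewrite (hv_plane (c := 1) a ni) => [|x []//].
  exact/H_bnd_finite/bnd_imx/phi_bnd.
have up : (hausdorff_measure s (imx (dg a) (boundary (polytope n))) <=
    (\sum_k hv s (imx (dg a) (phi k)))%:E)%E.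
  rewrite -sumEFin (eq_bigr (fun k => hausdorff_measure s (imx (dg a) (phi k)))).
    by apply: H_le_sum => _ [x /boundary_polytope[k xk] <-]; exists k; exists x.
  by move=> k _; rewrite hvE.
have fb := le_lt_trans up (ltry _).
rewrite (hvE fb); congr EFin.
apply/le_anti/andP; split; first by rewrite -lee_fin -hvE.
apply: (@le_of_shrink R s); first by apply: sumr_ge0 => k _; exact: hv_ge0.
move=> l l0 l1; have l1' : 0 < 1 - l by rewrite subr_gt0.
have /choice[F hF] k : exists F : set 'rV[R]_s.+1, [/\ F `<=` phi k,
    hv s (imx (dg a) F) = l ^+ s * hv s (imx (dg a) (phi k)) &
    exists2 eta : R, 0 < eta & forall j x, j != k -> F x -> dotv x (n j) <= 1 - eta].
  have null : hausdorff_measure s (imx (dg a) (phi k)) = 0%E ->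
      exists F : set 'rV[R]_s.+1, [/\ F `<=` phi k,
      hv s (imx (dg a) F) = l ^+ s * hv s (imx (dg a) (phi k)) &
      exists2 eta : R, 0 < eta & forall j x, j != k -> F x -> dotv x (n j) <= 1 - eta].
    move=> h0; exists set0; split => //; last by exists 1.
    rewrite /hv h0 mulr0 (_ : imx _ _ = set0) ?H0//.
    by apply/seteqP; split => // ? [].
  have [[z pz hz]|[e|[j jk hj]]] := facet_dichotomy k; last 2 first.
  - apply: null; rewrite e (_ : imx _ _ = set0) ?H0//.
    by apply/seteqP; split => // ? [].
  - apply: null; apply: (@facet_null R s (n k) (n j)) => //.
    + by rewrite (inj_eq ninj).
    + exact: phi_bnd.
    + by move=> x [].
  have [r r0 hr] : exists2 r, 0 < r & forall j, r <= (if j == k then 1 else 1 - dotv z (n j)).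
    by apply: finite_pos_lb => j; case: eqP => // /eqP jk; rewrite subr_gt0 hz.
  exists [set l *: x + (1 - l) *: z | x in phi k]; split.
  - move=> _ [x px <-]; apply: phi_cvx => //; exact: ltW.
  - by rewrite hv_affine.
  - exists ((1 - l) * r); first by rewrite mulr_gt0.
    move=> j _ jk [x [Px _] <-]; rewrite dotvDl !dotvZl.
    have := hr j; rewrite (negbTE jk) => hrj.
    have := ler_wpM2l (ltW l0) (Px j); have := ler_wpM2l (ltW l1') hrj; lra.
have /choice[eta heta] k : exists eta : R, 0 < eta /\
    forall j x, j != k -> F k x -> dotv x (n j) <= 1 - eta.
  by have [_ _ [e e0 he]] := hF k; exists e.
have [L L0 hL] := mulmx_lip (dg (fun i => (a i)^-1)).
have [eps eps0 heps] : exists2 eps, 0 < eps & forall jk : I * I,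
    eps <= eta jk.2 / (L * enorm (n jk.1)).
  apply: finite_pos_lb => -[j k] /=; rewrite divr_gt0 ?(heta k).1//.
  by rewrite mulr_gt0// enorm_gt0.
have := @H_separated_seq _ s I (index_enum I) (fun k => imx (dg a) (F k)) eps eps0 (index_enum_uniq _).
move=> /(_ _)/le_trans h.
rewrite mulr_sumr -lee_fin -sumEFin -hvE//.
rewrite (eq_bigr (fun k => hausdorff_measure s (imx (dg a) (F k)))); last first.
  move=> k _; have [Fphi <- _] := hF k; rewrite hvE//.
  by apply: le_lt_trans (fphi k); apply: H_le; exact: imx_sub.
apply: h => [j k _ _ jk [x Fx <-] [y Fy <-]|].
  have [Fj _ _] := hF j; have [_ xj] := Fj x Fx.
  have hy := (heta k).2 j y jk Fy.
  apply: (le_trans (heps (j, k))) => /=.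
  rewrite ler_pdivrMr ?mulr_gt0 ?enorm_gt0//.
  apply: (@le_trans _ _ (dotv (x - y) (n j))); first by rewrite dotvBl xj; lra.
  rewrite (le_trans (cauchy_schwarz _ _))// mulrA ler_wpM2r ?enorm_ge0//.
  rewrite mulrC; have := hL ((x - y) *m dg a).
  by rewrite -mulmxA AV mulmx1 mulmxBl.
apply: H_le => _ [k _ [x Fx <-]]; exists x => //.
by apply/boundary_polytope; exists k; have [Fk _ _] := hF k; exact: Fk.
Qed.

End Surface.
End Polytopes.

(** * Approximation by finitely many polytopes *)

Section Nets.
Context {R : realType}.

Lemma enorm_unit d (x : 'rV[R]_d) : x != 0 -> enorm ((enorm x)^-1 *: x) = 1.
Proof.
move=> x0; have p : 0 < enorm x by rewrite enorm_gt0.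
by rewrite enormZ gtr0_norm ?invr_gt0// mulVf// gt_eqF.
Qed.

(** One unit vector in each cell of a fine subdivision of the cube
    containing the sphere. *)
Lemma unit_net d (tau : R) : 0 < tau -> exists U : seq 'rV[R]_d,
  (forall u, u \in U -> enorm u = 1) /\
  forall w, enorm w = 1 -> exists2 u, u \in U & enorm (w - u) <= tau.
Proof.
move=> tau0; pose n := (Num.bound (d%:R * 2 / tau)).+1.
have n0 : 0 < n%:R :> R by rewrite ltr0n.
have ntau : d%:R * (2 / n%:R) <= tau.
  rewrite mulrA ler_pdivrMr// [leRHS]mulrC -ler_pdivrMr// ltW//.
  apply: lt_le_trans (archi_boundP _) _; first by rewrite divr_ge0 ?mulr_ge0// ltW.
  by rewrite ler_nat.
pose sh (w : 'rV[R]_d) : 'rV[R]_d := 2^-1 *: w + const_mx 2^-1.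
pose P (k : {ffun 'I_d -> 'I_n}) w := enorm w = 1 /\ cell k (sh w).
have /choice[u hu] k : exists u, (exists w, P k w) -> P k u.
  by have [[w hw]|h] := pselect (exists w, P k w); [exists w|exists 0].
exists [seq u k | k <- enum {ffun 'I_d -> 'I_n} & `[< exists w, P k w >]]; split.
  by move=> v /mapP[k]; rewrite mem_filter => /andP[/asboolP/hu[uk _] _] ->.
move=> w w1; have cw : cube (sh w).
  move=> i; rewrite !mxE; have := coord_le_enorm w i; rewrite w1 ler_norml => /andP[? ?].
  by apply/andP; split; lra.
have [k kw] := @cube_grid R d n (sh w) isT cw.
have hk : exists w, P k w by exists w.
exists (u k).
  by apply/mapP; exists k => //; rewrite mem_filter mem_enum andbT; exact/asboolP.
have [_ ku] := hu k hk.
have := cell_close kw ku.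
rewrite /sh opprD addrACA subrr addr0 -scalerBr normrZ ger0_norm// => h.
rewrite (le_trans (enorm_le_norm _))//; apply: le_trans ntau; rewrite ler_wpM2l//.
by move: h; lra.
Qed.

(** The direction from the projection of [y] to [y] separates. *)
Lemma separation d (K : set 'rV[R]_d) y : cvx K -> K !=set0 -> ~ closure K y ->
  exists w : 'rV[R]_d, enorm w = 1 /\ forall x, K x -> dotv x w <= dotv y w.
Proof.
move=> cK [x0 Kx0] nKy.
have ne : closure K !=set0 by exists x0; exact: subset_closure.
have [P [PK _ Pob _]] := proj_exists (@closed_closure _ K) (closure_cvx cK) ne.
have v0 : y - P y != 0.
  by apply: contra_notN nKy; rewrite subr_eq0 => /eqP ->; exact: PK.
have p : 0 < enorm (y - P y) by rewrite enorm_gt0.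
exists ((enorm (y - P y))^-1 *: (y - P y)); split; first exact: enorm_unit.
move=> x Kx; rewrite !dotvZr ler_pM2l ?invr_gt0//.
have := Pob y x (subset_closure Kx); have := dotv_ge0 (y - P y).
by rewrite !(dotvBl, dotvBr) (dotvC (P y) y) (dotvC (P y) x) (dotvC y x); lra.
Qed.

(** The polytope of [K] has as normals the vectors of a fine net of the
    sphere, and as heights the support function of [K], slightly reduced and
    rounded down to a grid, which leaves finitely many polytopes. It is
    contained in [K] because a point outside [K] is separated from it by a
    direction close to one of the net, and the error in direction is smaller
    than the reduction. *)
Lemma polytope_approx d (r M eta : R) : 0 < r -> 0 < M -> 0 < eta -> eta < 1 ->
  exists (F J : finType) (n : F -> J -> 'rV[R]_d), (forall f j, n f j != 0) /\
    forall K : set 'rV[R]_d, cvx K -> (forall y, enorm y <= r -> K y) ->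
      (forall y, K y -> enorm y <= M) ->
      exists f, polytope (n f) `<=` K /\ forall x, K x -> polytope (n f) ((1 - eta) *: x).
Proof.
move=> r0 M0 eta0 eta1.
(* two factors 1 - e and one rounding step of size e r: 1 - 3 e = 1 - eta *)
pose e := eta / 3.
have e0 : 0 < e by rewrite divr_gt0.
have e1 : e < 1 by rewrite /e; lra.
pose tau := e * r / (6 * M).
have tau0 : 0 < tau by rewrite divr_gt0// mulr_gt0.
have [U [U1 Unet]] := @unit_net d tau tau0.
pose sg := e * r.
have sg0 : 0 < sg by rewrite mulr_gt0.
pose J : finType := 'I_(size U).
pose u (j : J) := tnth (in_tuple U) j.
have u1 j : enorm (u j) = 1 by apply: U1; exact: mem_tnth.
pose B := (Num.bound (M / sg)).+1.
pose F : finType := {ffun J -> 'I_B}.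
pose n (f : F) (j : J) := ((f j).+1%:R * sg)^-1 *: u j.
have fp (f : F) j : 0 < (f j).+1%:R * sg by rewrite mulr_gt0.
have nP (f : F) j x : (dotv x (n f j) <= 1) = (dotv x (u j) <= (f j).+1%:R * sg).
  by rewrite /n dotvZr ler_pdivrMl// mulr1.
exists F, J, n; split.
  move=> f j; rewrite scaler_eq0 invr_eq0 gt_eqF//= -enorm_gt0 u1.
  exact: ltr01.
move=> K cK rK KM.
have K0 : K !=set0 by exists 0; apply: rK; rewrite enorm0 ltW.
pose h j := sup [set dotv x (u j) | x in K].
have hsup j : has_sup [set dotv x (u j) | x in K].
  split; first by have [x Kx] := K0; exists (dotv x (u j)); exists x.
  exists M => _ [x Kx <-]; rewrite (le_trans (cauchy_schwarz _ _))// u1 mulr1.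
  exact: KM.
have hle j x : K x -> dotv x (u j) <= h j.
  by move=> Kx; apply: sup_ubound; [exact: (hsup j).2|exists x].
have hM j : h j <= M.
  apply: ge_sup; first exact: (hsup j).1.
  move=> _ [x Kx <-]; rewrite (le_trans (cauchy_schwarz _ _))// u1 mulr1.
  exact: KM.
have hr j : r <= h j.
  apply: le_trans (hle j (r *: u j) _).
    by rewrite dotvZl -enorm_sq u1 expr1n mulr1.
  by apply: rK; rewrite enormZ u1 mulr1 ger0_norm// ltW.
have inK y : (forall j, dotv y (u j) <= (1 - e) * h j) -> closure K y.
  move=> hy; apply: contrapT => nKy.
  have [y' [hy' nKy' y'M]] : exists y', [/\ forall j, dotv y' (u j) <= (1 - e) * h j,
      ~ closure K y' & enorm y' <= 2 * M].
    have [yM|yM] := leP (enorm y) (2 * M); first by exists y.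
    have yp : 0 < enorm y by apply: lt_trans yM; rewrite mulr_gt0.
    pose rho := 2 * M / enorm y.
    have rho0 : 0 < rho by rewrite divr_gt0// mulr_gt0.
    have rho1 : rho <= 1 by rewrite ler_pdivrMr// mul1r ltW.
    have e2 : enorm (rho *: y) = 2 * M by rewrite enormZ gtr0_norm// divfK// gt_eqF.
    exists (rho *: y); split; last by rewrite e2.
    - move=> j; rewrite dotvZl.
      apply: (@le_trans _ _ (rho * ((1 - e) * h j))); first by rewrite ler_wpM2l// ltW.
      rewrite ler_piMl// mulr_ge0 ?subr_ge0 ?(ltW e1)//.
      by apply: le_trans (hr j); exact: ltW.
    - move=> /closureP/(_ (M / (d%:R + 1)))[|k Kk hk].
        by rewrite divr_gt0// ltr_wpDl.
      have := enorm_le_norm (rho *: y - k).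
      have : d%:R * `|rho *: y - k| < M.
        apply: (@le_lt_trans _ _ ((d%:R + 1) * `|rho *: y - k|)); first by rewrite ler_wpM2r// lerDl.
        by rewrite mulrC -ltr_pdivlMr// ltr_wpDl.
      have := enormD (rho *: y - k) k; rewrite subrK e2.
      have := KM k Kk.
      lra.
  have [w [w1 hw]] := separation cK K0 nKy'.
  have [_ /(nthP 0)[j0 j0s <-] wu] := Unet w w1.
  pose j : J := Ordinal j0s.
  have uE : nth 0 U j0 = u j by rewrite /u (tnth_nth 0).
  rewrite uE in wu.
  have hj : h j <= (1 - e) * h j + 3 * M * tau.
    apply: ge_sup; first exact: (hsup j).1.
    move=> _ [x Kx <-].
    have a1 : dotv x (u j - w) <= M * tau.
      rewrite (le_trans (cauchy_schwarz _ _))// enorm_distC.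
      by apply: ler_pM => //; [exact: enorm_ge0|exact: enorm_ge0|exact: KM].
    have a2 : dotv y' (w - u j) <= 2 * M * tau.
      rewrite (le_trans (cauchy_schwarz _ _))//.
      by apply: ler_pM => //; exact: enorm_ge0.
    have := hw x Kx; have := hy' j; move: a1 a2; rewrite !dotvBr; lra.
  have : 3 * M * tau = e * r / 2 by rewrite /tau; field; rewrite gt_eqF.
  have := hr j; have := ler_wpM2l (ltW e0) (hr j); nra.
have kP j : exists k : 'I_B, (k.+1%:R * sg <= (1 - e) ^+ 2 * h j) /\
    (1 - e) ^+ 2 * h j < k.+2%:R * sg.
  pose t := (1 - e) ^+ 2 * h j / sg.
  have e13 : e <= (1 - e) ^+ 2 by rewrite /e; nra.
  have t1 : 1 <= t.
    by rewrite ler_pdivlMr// mul1r /sg ler_pM ?(ltW e0) ?(ltW r0).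
  have /andP[h1 h2] := truncn_itv (le_trans ler01 t1).
  have T0 : (0 < Num.truncn t)%N by rewrite -ltnS -(@ltr_nat R) (le_lt_trans t1).
  have kB : ((Num.truncn t).-1 < B)%N.
    rewrite prednK// leqW// -(@ler_nat R) (le_trans h1)//.
    apply: (@le_trans _ _ (M / sg)); last first.
      by apply/ltW/archi_boundP; rewrite divr_ge0// ltW.
    rewrite ler_pM2r ?invr_gt0//; apply: le_trans (hM j).
    rewrite ler_piMl ?(le_trans (ltW r0) (hr j))//.
    by rewrite exprn_ile1// ?subr_ge0 ?(ltW e1)// gerBl ltW.
  exists (Ordinal kB); rewrite /= (prednK T0).
  by split; [rewrite -ler_pdivlMr|rewrite -ltr_pdivrMr].
have /choice[f hf] := kP.
exists [ffun j => f j]; split.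
  move=> x Px.
  have -> : x = (1 - e) *: ((1 - e)^-1 *: x) + (1 - (1 - e)) *: 0.
    by rewrite scaler0 addr0 scalerA mulfV ?scale1r// subr_eq0 gt_eqF.
  apply: (@shrink_closure R d K 0 (r / (d%:R + 1))) => //.
  - by rewrite divr_gt0// ltr_wpDl.
  - move=> y; rewrite subr0 ler_pdivlMr ?ltr_wpDl// => hy; apply: rK.
    rewrite (le_trans (enorm_le_norm _))//; apply: le_trans hy.
    by rewrite mulrC ler_wpM2l// lerDl.
  - apply: inK => j; rewrite dotvZl ler_pdivrMl ?subr_gt0//.
    have := Px j; rewrite nP ffunE => /le_trans; apply.
    by apply: le_trans (hf j).1 _; rewrite expr2 mulrA.
  - by rewrite subr_ge0 ltW.
  - by rewrite ltrBlDr ltrDl.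
move=> x Kx j; rewrite nP ffunE dotvZl.
have := (hf j).2; rewrite -natr1 mulrDl mul1r => hj.
have := hle j x Kx; have := hr j; rewrite /sg in hj * => h1 h2.
have h3 : (1 - eta) * dotv x (u j) <= (1 - eta) * h j by rewrite ler_wpM2l// subr_ge0 ltW.
apply: (le_trans h3).
have : e * r <= e * h j by rewrite ler_wpM2l// ltW.
have : (1 - e) ^+ 2 * h j = h j - 2 * e * h j + e * e * h j by ring.
have hj0 : 0 <= h j := le_trans (ltW r0) h1.
have : 0 <= e * e * h j by apply: mulr_ge0 => //; apply: mulr_ge0; exact: ltW.
have : eta = 3 * e by rewrite /e; field.
move=> ->; lra.
Qed.

End Nets.

(** * Adapted frames of bounded convex sets *)

Section Adapted.
Context {R : realType}.

(** For row vectors: each coordinate of the image is perturbed by the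
    coordinates of smaller index only. *)
Definition near_unitriangular d (delta : R) (N : 'M[R]_d) :=
  forall i j : 'I_d, [/\ i = j -> N i j = 1, (j < i)%N -> N i j = 0 &
    (i < j)%N -> `|N i j| <= delta].

(** [X] in an adapted frame: [a] holds the scales of [X] along the rows of
    [N *m f], and [k] is the dimension of [X]; the scales beyond [k] are
    arbitrary. In these coordinates [X] lies in a fixed box of the first [k]
    axes and contains a ball of radius [r] there, with centre [g]. *)
Definition adapted d (delta r : R) (f N : 'M[R]_d) (a : 'rV[R]_d) (k : nat) (X : set 'rV[R]_d) :=
  [/\ (forall i, 0 < a 0 i), near_unitriangular delta N, (k <= d)%N,
    forall x, X x -> exists c : 'rV[R]_d, [/\ x = c *m diag_mx a *m N *m f,
      forall i, `|c 0 i| <= 3 & forall i : 'I_d, (k <= i)%N -> c 0 i = 0] &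
    exists g : 'rV[R]_d, forall e : 'rV[R]_d, (forall i : 'I_d, (k <= i)%N -> e 0 i = 0) ->
      `|e| <= r -> X ((g + e) *m diag_mx a *m N *m f)].

Definition adaptable d := forall delta : R, 0 < delta -> exists (r : R) (Fr : seq 'M[R]_d),
  [/\ 0 < r, forall f, f \in Fr -> f *m f^T = 1%:M &
  forall X : set 'rV[R]_d, cvx X -> bnd X -> X 0 ->
    exists2 f, f \in Fr & exists N a k, adapted delta r f N a k X].

Lemma adaptable0 : adaptable 0.
Proof.
move=> delta delta0; exists 1, [:: 1%:M]; split => //.
  by move=> f; rewrite inE => /eqP ->; rewrite trmx1 mulmx1.
move=> X cX bX X0; exists 1%:M; first by rewrite inE.
exists 1%:M, 0, 0%N; split => //.
- by case.
- by case.
- by move=> x Xx; exists 0; split; [rewrite !mul0mx; apply/rowP => -[]|case|case].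
- by exists 0 => e _ _; rewrite (_ : _ *m _ = 0)//; apply/rowP => -[].
Qed.

Lemma adapted_zero d (delta r : R) (f : 'M[R]_d) (X : set 'rV[R]_d) : 0 < delta ->
  X 0 -> (forall x, X x -> x = 0) -> adapted delta r f 1%:M (const_mx 1) 0 X.
Proof.
move=> delta0 X0 hX; split => //.
- by move=> i; rewrite mxE.
- move=> i j; rewrite mxE; split => [->|ji|ij]; rewrite ?eqxx//.
    by rewrite -val_eqE /= gtn_eqF.
  by rewrite -val_eqE /= ltn_eqF//= normr0 ltW.
- move=> x /hX ->; exists 0; split; first by rewrite !mul0mx.
    by move=> i; rewrite mxE normr0.
  by move=> i; rewrite mxE.
- exists 0 => e he _; rewrite (_ : e = 0) ?add0r ?mul0mx//.
  by apply/rowP => i; rewrite he// mxE.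
Qed.

Lemma dotv_row d (x1 y1 : 'rV[R]_1) (x2 y2 : 'rV[R]_d) :
  dotv (row_mx x1 x2) (row_mx y1 y2) = x1 0 0 * y1 0 0 + dotv x2 y2.
Proof.
rewrite /dotv (@big_split_ord _ _ _ 1 d)/= big_ord1 !row_mxEl; congr (_ + _).
by apply: eq_bigr => i _; rewrite !row_mxEr.
Qed.

(** The first axis is a point [q] of [X] of almost the largest norm, after a
    reflection from a finite list that makes [q] almost parallel to the
    first basis vector. The map [T] projects along [q] onto the remaining
    coordinates, and an adapted frame of the projection of [X] is completed
    by [q], whose other coordinates are small compared with the first. For
    the inscribed ball: [X] contains 0, [q] and points [x] projecting onto a
    ball, and the combinations x / 16 + (15 / 16) s q with 0 <= s <= 1 fill
    a ball in the new coordinates. *)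
Lemma adaptableS d : adaptable d -> adaptable (1 + d)%N.
Proof.
move=> IH delta delta0; have [r' [Fr' [r'0 orth' hFr']]] := IH delta delta0.
pose tau := Num.min (3^-1) (delta / 2).
have tau0 : 0 < tau by rewrite lt_min invr_gt0 ltr0n divr_gt0.
have tau3 : tau <= 3^-1 by rewrite ge_min lexx.
have taud : tau <= delta / 2 by rewrite ge_min lexx orbT.
have [U [U1 Unet]] := @unit_net R (1 + d) tau tau0.
pose e0 : 'rV[R]_(1 + d) := row_mx 1%:M 0.
have de0 : dotv e0 e0 = 1 by rewrite /e0 dotv_row dotv0l mxE mulr1 addr0.
have ne0 : enorm e0 = 1 by rewrite /enorm de0 sqrtr1.
have /choice[rho hrho] u : exists rho : 'M[R]_(1 + d), enorm u = 1 ->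
    [/\ rho *m rho = 1%:M, rho^T = rho & u *m rho = e0].
  have [u1|u1] := pselect (enorm u = 1); last by exists 0.
  have [|rho h] := @reflection R _ u e0; last by exists rho.
  by rewrite de0 -enorm_sq u1 expr1n.
pose ext (f : 'M[R]_d) : 'M[R]_(1 + d) := block_mx 1%:M 0 0 f.
pose r := Num.min (4^-1) (r' / 16).
have r0 : 0 < r by rewrite lt_min invr_gt0 ltr0n divr_gt0.
have r4 : r <= 4^-1 by rewrite ge_min lexx.
have r16 : 16 * r <= r' by rewrite mulrC -ler_pdivlMr// ge_min lexx orbT.
exists r, [seq ext p.1 *m rho p.2 | p <- [seq (f, u) | f <- Fr', u <- U]]; split => //.
  move=> _ /mapP[_ /allpairsP[[f u] /= [fF uU ->]] ->] /=.
  have [rr rT _] := hrho u (U1 u uU).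
  rewrite trmx_mul rT mulmxA -(mulmxA (ext f)) rr mulmx1.
  rewrite /ext tr_block_mx mulmx_block !trmx0 trmx1 orth'// !mulmx0 !mul0mx mulmx1.
  by rewrite !addr0 add0r -scalar_mx_block.
move=> X cX bX X0.
have inF f u : f \in Fr' -> u \in U ->
    ext f *m rho u \in [seq ext p.1 *m rho p.2 | p <- [seq (f, u) | f <- Fr', u <- U]].
  move=> fF uU; apply/mapP; exists (f, u) => //.
  by apply/allpairsP; exists (f, u).
have [hz|hnz] := pselect (forall x, X x -> x = 0).
  have [u0 u0U _] := Unet e0 ne0.
  have [| | |f' f'F _] := hFr' [set 0].
  - by move=> x y t -> -> _ _; rewrite !scaler0 addr0.
  - by exists 0 => x ->; rewrite normr0.
  - by [].
  exists (ext f' *m rho u0); first exact: inF.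
  by exists 1%:M, (const_mx 1), 0%N; exact: adapted_zero.
have [q Xq hq] : exists2 q, X q & q != 0 /\ forall x, X x -> enorm x <= 2 * enorm q.
  have [x0 Xx0 x00] : exists2 x, X x & x != 0.
    apply: contra_notP hnz => h x Xx; apply/eqP; apply: contrapT => /negP x0.
    by apply: h; exists x.
  pose S := [set enorm x | x in X].
  have hS : has_sup S.
    split; first by exists (enorm x0); exists x0.
    have [M hM] := bX; exists ((1 + d)%:R * M) => _ [x Xx <-].
    by rewrite (le_trans (enorm_le_norm _))// ler_wpM2l// hM.
  have up x : X x -> enorm x <= sup S by move=> Xx; apply: sup_ubound; [exact: hS.2|exists x].
  have sp : 0 < sup S by apply: lt_le_trans (up x0 Xx0); rewrite enorm_gt0.
  have s2 : 0 < sup S / 2 by rewrite divr_gt0.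
  have [_ [q Xq <-] hq] := sup_adherent s2 hS.
  exists q => //; split; last by move=> x /up h; lra.
  by rewrite -enorm_gt0; lra.
have [q0 q2] := hq.
have qp : 0 < enorm q by rewrite enorm_gt0.
pose w := (enorm q)^-1 *: q.
have w1 : enorm w = 1 by exact: enorm_unit.
have [u uU wu] := Unet w w1.
have [rr rT ur] := hrho u (U1 u uU).
have orth_rho x : enorm (x *m rho u) = enorm x.
  by apply: orth_enorm; rewrite rT.
have wr : enorm (w *m rho u - e0) <= tau by rewrite -ur -mulmxBl orth_rho.
have qw : q = enorm q *: w by rewrite /w scalerA mulfV ?scale1r// gt_eqF.
pose q1 := lsubmx (q *m rho u) 0 0; pose q' : 'rV[R]_d := rsubmx (q *m rho u).
have qE : q *m rho u = row_mx q1%:M q' by rewrite /q1 -mx11_scalar hsubmxK.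
have wrE : w *m rho u = row_mx (q1 / enorm q)%:M ((enorm q)^-1 *: q').
  rewrite /w -scalemxAl qE scale_row_mx; congr row_mx.
  by rewrite scale_scalar_mx mulrC.
have sq : (q1 / enorm q - 1) ^+ 2 + enorm ((enorm q)^-1 *: q') ^+ 2 <= tau ^+ 2.
  have : enorm (w *m rho u - e0) ^+ 2 <= tau ^+ 2 by rewrite lerXn2r ?nnegrE ?enorm_ge0 ?(ltW tau0).
  rewrite enorm_sq wrE /e0 opp_row_mx add_row_mx oppr0 addr0 dotv_row -enorm_sq.
  by rewrite !mxE -expr2.
have q1b : enorm q * (1 - tau) <= q1.
  have h : (q1 / enorm q - 1) ^+ 2 <= tau ^+ 2.
    by apply: le_trans sq; rewrite lerDl sqr_ge0.
  have : 1 - tau <= q1 / enorm q.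
    rewrite leNgt; apply/negP => lt.
    have y1 : tau < 1 - q1 / enorm q by lra.
    have := ltr_pM (ltW tau0) (ltW tau0) y1 y1; move: h; rewrite !expr2; lra.
  by rewrite ler_pdivlMr// mulrC.
have q1p : 0 < q1 by apply: lt_le_trans q1b; rewrite mulr_gt0//; lra.
have q'b : enorm q' <= delta * q1.
  have h : enorm ((enorm q)^-1 *: q') ^+ 2 <= tau ^+ 2.
    by apply: le_trans sq; rewrite lerDr sqr_ge0.
  have : enorm ((enorm q)^-1 *: q') <= tau.
    by move: h; rewrite ler_sqr ?nnegrE ?enorm_ge0 ?(ltW tau0).
  rewrite enormZ gtr0_norm ?invr_gt0// mulrC ler_pdivrMr// => h2.
  have k1 := ler_wpM2r (ltW qp) taud.
  have k2 := ler_wpM2l (ltW delta0) q1b.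
  have k4 : 0 <= delta * enorm q by rewrite mulr_ge0// ltW.
  have k3 : 0 <= delta * enorm q * (3^-1 - tau) by rewrite mulr_ge0// subr_ge0.
  lra.
pose T : 'M[R]_(1 + d, d) := rho u *m col_mx (- q1^-1 *: q') 1%:M.
pose X' := imx T X.
have [f f'F [N' [a' [k' [a'0 N'tri k'd cov' [g' ball']]]]]] := hFr' X' (imx_cvx cX) (bnd_imx T bX)
  (ex_intro2 _ _ 0 X0 (mul0mx _ _)).
have fTf : f^T *m f = 1%:M by apply: mulmx1C; exact: orth'.
pose N : 'M[R]_(1 + d) := block_mx 1%:M (q1^-1 *: (q' *m f^T)) 0 N'.
pose a : 'rV[R]_(1 + d) := row_mx q1%:M a'.
have assemble (c0 : R) (c' : 'rV[R]_d) :
    row_mx c0%:M c' *m diag_mx a *m N *m (ext f *m rho u) =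
    row_mx (c0 * q1)%:M (c0 *: q' + c' *m diag_mx a' *m N' *m f) *m rho u.
  rewrite !mulmxA; congr (_ *m _).
  rewrite /a diag_mx_row mul_row_block !mulmx0 addr0 add0r.
  rewrite (_ : diag_mx q1%:M = q1%:M); last by apply/matrixP => i j; rewrite !ord1 !mxE.
  rewrite -scalar_mxM /N mul_row_block mulmx0 addr0 mulmx1.
  rewrite /ext mul_row_block !mulmx0 mulmx1 addr0 add0r; congr row_mx.
  rewrite mulmxDl mul_scalar_mx scalerA -mulrA mulfV ?gt_eqF// mulr1.
  by rewrite -scalemxAl -mulmxA fTf mulmx1.
have coords x : X x -> exists c0 : R, `|c0| <= 3 /\ forall c' : 'rV[R]_d,
    x *m T = c' *m diag_mx a' *m N' *m f ->
    x = row_mx c0%:M c' *m diag_mx a *m N *m (ext f *m rho u).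
  move=> Xx; pose x1 := lsubmx (x *m rho u) 0 0; pose x' : 'rV[R]_d := rsubmx (x *m rho u).
  have xE : x *m rho u = row_mx x1%:M x' by rewrite /x1 -mx11_scalar hsubmxK.
  exists (x1 / q1); split.
    have : `|x1| <= enorm x.
      by rewrite -(orth_rho x); have := coord_le_enorm (x *m rho u) (lshift d 0); rewrite xE row_mxEl mxE.
    have := q2 x Xx => h1 h2.
    rewrite normrM [X in _ * X]gtr0_norm ?invr_gt0// ler_pdivrMr//.
    nra.
  move=> c' xT; rewrite assemble -xT divfK ?gt_eqF//.
  have -> : (x1 / q1) *: q' + x *m T = x'.
    rewrite /T mulmxA xE mul_row_col mulmx1 -scalemxAr mul_scalar_mx scalerA.
    by rewrite addrA mulNr mulrC -scalerDl subrr scale0r add0r.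
  by rewrite -xE -mulmxA rr mulmx1.
exists (ext f *m rho u); first exact: inF.
exists N, a, k'.+1; split.
- move=> i; rewrite /a; case: (split_ordP i) => j ->.
    by rewrite row_mxEl !ord1 mxE.
  by rewrite row_mxEr.
- move=> i j; rewrite /N; case: (split_ordP i) => i' ->; case: (split_ordP j) => j' ->.
  + by rewrite block_mxEul !ord1 mxE; split => //=; rewrite ltnn.
  + rewrite block_mxEur; split => /=; [by move=> /eqP; rewrite eq_lrshift|by rewrite ord1|].
    move=> _; rewrite ord1 mxE normrM gtr0_norm ?invr_gt0// mulrC ler_pdivrMr//.
    apply: le_trans q'b; rewrite -(@orth_enorm R d f^T q') ?trmxK//.
    exact: coord_le_enorm.
  + rewrite block_mxEdl mxE; split => //=; last by rewrite ord1.
    by move=> /eqP; rewrite eq_rlshift.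
  + rewrite block_mxEdr; have [h1 h2 h3] := N'tri i' j'; split => /=.
    * by move=> /rshift_inj.
    * by rewrite ltn_add2l.
    * by rewrite ltn_add2l.
- by rewrite ltnS.
- move=> x Xx; have [c0 [c03 hc0]] := coords x Xx.
  have [c' [xT c'3 c'k]] := cov' (x *m T) (ex_intro2 _ _ x Xx erefl).
  exists (row_mx c0%:M c'); split; first exact: hc0.
    by move=> i; case: (split_ordP i) => j ->; rewrite ?row_mxEl ?row_mxEr// ord1 mxE.
  by move=> i; case: (split_ordP i) => j -> h; [move: h; rewrite ord1|rewrite row_mxEr c'k].
have Xmid (s t : R) x : X x -> 0 <= s -> s <= 1 -> 0 <= t -> t <= 1 ->
    X (t *: x + ((1 - t) * s) *: q).
  move=> Xx s0 s1 t0 t1; rewrite -scalerA; apply: (cX) => //.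
  by have := cX _ _ s Xq X0 s0 s1; rewrite scaler0 addr0.
exists (row_mx (2^-1)%:M (16^-1 *: g')) => e ek er.
pose e1 := e 0 (lshift d 0); pose e' : 'rV[R]_d := rsubmx e.
have eE : e = row_mx e1%:M e'.
  apply/rowP => i; case: (split_ordP i) => j ->.
    by rewrite row_mxEl ord1 mxE.
  by rewrite row_mxEr mxE.
have e1r : `|e1| <= r by apply: le_trans er; exact: coord_le_norm.
have e'r : `|16 *: e'| <= r'.
  rewrite normrZ ger0_norm//; apply: le_trans r16; rewrite ler_pM2l//.
  apply: le_trans er; apply: norm_le_coord => // i.
  by have := coord_le_norm e (rshift 1 i); rewrite mxE.
have [|x Xx xT] := ball' (16 *: e') _ e'r.
  by move=> i ki; rewrite !mxE ek ?mulr0.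
have [c0 [c03 /(_ _ xT) xE]] := coords x Xx.
have qEE : q = row_mx 1%:M 0 *m diag_mx a *m N *m (ext f *m rho u).
  by rewrite assemble !mul0mx addr0 mul1r scale1r -qE -mulmxA rr mulmx1.
pose t : R := 16^-1; pose s := (2^-1 + e1 - t * c0) / (1 - t).
have -> : (row_mx (2^-1)%:M (16^-1 *: g') + e) *m diag_mx a *m N *m (ext f *m rho u) =
    t *: x + ((1 - t) * s) *: q.
  rewrite {1}xE {1}qEE !scalemxAl -!mulmxDl; congr (_ *m _ *m _ *m _).
  rewrite eE add_row_mx !scale_row_mx add_row_mx scaler0 addr0; congr row_mx.
    rewrite !scale_scalar_mx -!raddfD/=; congr (_%:M).
    by rewrite mulr1 /s /t; field.
  by rewrite /t scalerDr scalerA mulVf ?scale1r// pnatr_eq0.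
have /andP[e1a e1b] : - r <= e1 <= r by rewrite -ler_norml.
have /andP[c0a c0b] : - 3 <= c0 <= 3 by rewrite -ler_norml.
apply: Xmid => //; rewrite /s /t ?invr_ge0//.
- by rewrite divr_ge0//; lra.
- by rewrite ler_pdivrMr; lra.
- lra.
Qed.

Lemma adaptable_all d : adaptable d.
Proof. by elim: d => [|d IH]; [exact: adaptable0|exact: (adaptableS IH)]. Qed.

End Adapted.

(** * Quantitative estimates *)

Section Quantitative.
Context {R : realType}.

(** By Bernoulli's inequality (1 - t)^(2 s) is at least 1 - 2 s t. *)
Lemma power_near_one (s : nat) (u v : R) : 0 < u -> u < v ->
  exists2 t : R, 0 < t < 1 & u <= v * (1 - t) ^+ (s + s).
Proof.
move=> u0 uv; have v0 : 0 < v by exact: lt_trans uv.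
have bern (t : R) k : 0 <= t -> t <= 1 -> 1 - k%:R * t <= (1 - t) ^+ k.
  move=> t0 t1; elim: k => [|k IH]; first by rewrite mul0r subr0 expr0.
  have t1' : 0 <= 1 - t by rewrite subr_ge0.
  rewrite exprS -natr1; have := ler_wpM2l t1' IH.
  have : 0 <= k%:R * (t * t) by rewrite !mulr_ge0.
  lra.
have den : 0 < v * ((s + s)%:R + 1) by rewrite mulr_gt0// ltr_wpDl.
pose t := Num.min (2^-1) ((v - u) / (v * ((s + s)%:R + 1))).
have t0 : 0 < t by rewrite lt_min invr_gt0 ltr0n divr_gt0// subr_gt0.
have t2 : t <= 2^-1 by rewrite ge_min lexx.
have tv : t * (v * ((s + s)%:R + 1)) <= v - u by rewrite -ler_pdivlMr// ge_min lexx orbT.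
exists t; first by apply/andP; split; lra.
have := ler_wpM2l (ltW v0) (bern t (s + s)%N (ltW t0) _).
have := mulr_ge0 (ltW v0) (ltW t0); lra.
Qed.

Lemma near_unitriangular_dist d (delta : R) (N : 'M[R]_d) : 0 <= delta ->
  near_unitriangular delta N ->
  forall x : 'rV[R]_d, enorm (x *m N - x) <= d%:R * (d%:R * delta) * enorm x.
Proof.
move=> delta0 hN x.
have -> : x *m N - x = x *m (N - 1%:M) by rewrite mulmxBr mulmx1.
rewrite mulmx_sum_row (le_trans (enorm_sum _ _))//.
have -> : d%:R * (d%:R * delta) * enorm x = \sum_(i < d) (d%:R * delta) * enorm x.
  by rewrite sumr_const card_ord -[RHS]mulr_natl -[LHS]mulrA.
apply: ler_sum => i _.
rewrite enormZ mulrC ler_pM ?enorm_ge0//; last exact: coord_le_enorm.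
rewrite (le_trans (enorm_le_norm _))// ler_wpM2l//.
apply: norm_le_coord => // j; rewrite !mxE.
have [h1 h2 h3] := hN i j.
have [ij|ij|ij] := ltngtP i j.
- rewrite (_ : i == j = false) ?subr0 ?h3//.
  by apply/eqP => e; rewrite e ltnn in ij.
- rewrite (_ : i == j = false) ?subr0 ?h2 ?normr0//.
  by apply/eqP => e; rewrite e ltnn in ij.
- by have e := val_inj ij; rewrite (h1 e) e eqxx subrr normr0.
Qed.

(** Superlevel sets of a product of positive numbers are convex, by
    concavity of the logarithm. *)
Lemma prod_concave (I : finType) (P : pred I) (a b : I -> R) (c t : R) :
  (forall i, 0 < a i) -> (forall i, 0 < b i) -> 0 <= t -> t <= 1 ->
  c <= \prod_(i | P i) a i -> c <= \prod_(i | P i) b i ->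
  c <= \prod_(i | P i) (t * a i + (1 - t) * b i).
Proof.
move=> a0 b0 t0 t1 ca cb.
have t1' : 0 <= 1 - t by rewrite subr_ge0.
have m0 i : 0 < t * a i + (1 - t) * b i.
  have [->|tn0] := eqVneq t 0; first by rewrite mul0r add0r subr0 mul1r.
  apply: ltr_pwDl; last by rewrite mulr_ge0// ltW.
  by rewrite mulr_gt0// lt_neqAle eq_sym tn0.
have [c0|c0] := leP c 0; first by rewrite (le_trans c0)// prodr_ge0// => i _; exact: ltW.
have lnprod (f : I -> R) : (forall i, 0 < f i) ->
    ln (\prod_(i | P i) f i) = \sum_(i | P i) ln (f i).
  move=> f0; suff [] : 0 < \prod_(i | P i) f i /\
      ln (\prod_(i | P i) f i) = \sum_(i | P i) ln (f i) by [].
  apply: (big_rec2 (fun p s => 0 < p /\ ln p = s)); first by rewrite ln1.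
  by move=> i p s _ [s0 <-]; rewrite mulr_gt0// lnM ?posrE.
rewrite -ler_ln ?posrE ?prodr_gt0// lnprod//.
rewrite -ler_ln ?posrE ?prodr_gt0// lnprod// in ca.
rewrite -ler_ln ?posrE ?prodr_gt0// lnprod// in cb.
have -> : ln c = t * ln c + (1 - t) * ln c by ring.
apply: (@le_trans _ _ (\sum_(i | P i) (t * ln (a i) + (1 - t) * ln (b i)))).
  by rewrite big_split/= -!mulr_sumr lerD// ler_wpM2l.
apply: ler_sum => i _.
have t01 : 0%R <= t <= 1%R by rewrite t0 t1.
exact: (@concave_ln R (Itv01 t0 t1) (a i) (b i)).
Qed.

Section Grid.
Context {d : nat} {I : finType} (theta : I -> R) (n : I -> 'rV[R]_d).
Hypothesis theta0 : forall k, 0 <= theta k.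

(** The area of a polytope with facet constants [theta] and normals [n],
    stretched by a diagonal map with cofactors [m]. *)
Definition facet_sum (m : 'I_d -> R) : R := \sum_k theta k * enorm (\row_i (m i * n k 0 i)).

Let e (i : 'I_d) := \sum_k theta k * `|n k 0 i|.

Lemma facet_sum_mono m m' : (forall i, 0 <= m i) -> (forall i, m i <= m' i) ->
  facet_sum m <= facet_sum m'.
Proof.
move=> m0 mm; apply: ler_sum => k _; rewrite ler_wpM2l//.
rewrite /enorm ler_wsqrtr//; apply: ler_sum => i _.
rewrite !mxE -!expr2 !exprMn ler_wpM2r ?sqr_ge0//.
by rewrite lerXn2r ?nnegrE//; exact: le_trans (mm i).
Qed.

Lemma facet_sum_ge m i : (forall i, 0 <= m i) -> m i * e i <= facet_sum m.
Proof.
move=> m0; rewrite mulr_sumr; apply: ler_sum => k _.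
rewrite mulrCA ler_wpM2l//; have := coord_le_enorm (\row_i (m i * n k 0 i)) i.
by rewrite mxE normrM (ger0_norm (m0 i)).
Qed.

Lemma facet_sum_lip m m' : facet_sum m <= facet_sum m' + \sum_i `|m i - m' i| * e i.
Proof.
have -> : \sum_i `|m i - m' i| * e i = \sum_k theta k * \sum_i `|m i - m' i| * `|n k 0 i|.
  under eq_bigr do rewrite mulr_sumr.
  rewrite exchange_big/=; apply: eq_bigr => k _; rewrite mulr_sumr.
  by apply: eq_bigr => i _; rewrite mulrCA.
rewrite -big_split/=; apply: ler_sum => k _; rewrite -mulrDr ler_wpM2l//.
set x := \row_i (m i * n k 0 i); set y := \row_i (m' i * n k 0 i).
rewrite -[x](subrK y) addrC (le_trans (enormD _ _))// lerD2l.
rewrite {1}[x - y]row_sum_delta (le_trans (enorm_sum _ _))//; apply: ler_sum => i _.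
rewrite enormZ !mxE -mulrBl normrM -[leRHS]mulr1 ler_wpM2l ?mulr_ge0//.
rewrite /enorm /dotv (bigD1 i)//= big1 ?addr0 ?mxE ?eqxx ?mulr1 ?sqrtr1//.
by move=> j /negbTE ji; rewrite mxE ji andbF mulr0.
Qed.

(** Round the cofactors down to multiples of a small [tau], and cap them at
    [tau * L], where one coordinate alone makes the sum at least [c2].
    Without capping, rounding changes the sum by at most c3 - c2, since the
    sum is Lipschitz. *)
Lemma facet_grid (c2 c3 : R) : 0 < c2 -> c2 < c3 ->
  exists (Z : finType) (z : Z -> 'I_d -> R), (forall k, c2 <= facet_sum (z k)) /\
    (forall k i, 0 <= z k i) /\
    forall m, (forall i, 0 <= m i) -> c3 <= facet_sum m -> exists k, forall i, z k i <= m i.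
Proof.
move=> c20 c23.
have e0 i : 0 <= e i by apply: sumr_ge0 => k _; rewrite mulr_ge0.
have E0 : 0 <= \sum_i e i by exact: sumr_ge0.
pose tau := (c3 - c2) / (\sum_i e i + 1).
have tau0 : 0 < tau by rewrite divr_gt0 ?subr_gt0// ltr_wpDl.
have tauE : tau * \sum_i e i <= c3 - c2.
  rewrite /tau mulrAC ler_pdivrMr ?ltr_wpDl//.
  by rewrite ler_wpM2l ?subr_ge0 ?(ltW c23)// lerDl.
(* e i is the rate at which the sum grows with the i-th cofactor *)
have [L hL] : exists L : nat, forall i, e i != 0 -> c2 <= (tau * L%:R) * e i.
  have [r r0 hr] : exists2 r, 0 < r & forall i, r <= (if e i == 0 then 1 else tau * e i / c2).
    apply: finite_pos_lb => i; case: ifPn => // h.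
    by rewrite divr_gt0// mulr_gt0// lt_neqAle eq_sym h e0.
  exists (Num.bound r^-1) => i ei.
  have := hr i; rewrite (negbTE ei) => hri.
  have rL : 1 <= r * (Num.bound r^-1)%:R.
    rewrite mulrC -ler_pdivrMr// div1r ltW// archi_boundP// invr_ge0 ltW//.
  have ei0 : 0 < e i by rewrite lt_neqAle eq_sym ei e0.
  move: hri; rewrite ler_pdivlMr// => hri.
  have B0 : 0 <= (Num.bound r^-1)%:R :> R by [].
  have h1 := ler_wpM2r B0 hri; have h2 := ler_wpM2l (ltW c20) rL; lra.
pose zz (g : {ffun 'I_d -> 'I_L.+1}) (i : 'I_d) : R := tau * (g i)%:R.
exists {g : {ffun 'I_d -> 'I_L.+1} | c2 <= facet_sum (zz g)}, (fun k => zz (val k)).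
split; first by move=> k; exact: (valP k).
split; first by move=> k i; rewrite mulr_ge0// ltW.
move=> m m0 hm.
pose g : {ffun 'I_d -> 'I_L.+1} := [ffun i => inord (minn (Num.truncn (m i / tau)) L)].
have gE i : (g i : nat) = minn (Num.truncn (m i / tau)) L by rewrite ffunE inordK// ltnS geq_minr.
have zm i : zz g i <= m i.
  rewrite /zz gE mulrC -ler_pdivlMr//.
  have /andP[h _] := truncn_itv (divr_ge0 (m0 i) (ltW tau0)).
  by apply: le_trans h; rewrite ler_nat geq_minl.
have z0 i : 0 <= zz g i by rewrite mulr_ge0// ltW.
suff hg : c2 <= facet_sum (zz g) by exists (Sub g hg).
have [/existsP[i /andP[ei Li]]|/existsPn small] :=
    boolP [exists i, (e i != 0) && (L <= Num.truncn (m i / tau))%N].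
  apply: le_trans (facet_sum_ge i z0); apply: (le_trans (hL i ei)).
  by rewrite /zz gE (minn_idPr Li).
have := facet_sum_lip m (zz g); suff : \sum_i `|m i - zz g i| * e i <= c3 - c2 by lra.
apply: le_trans tauE; rewrite mulr_sumr; apply: ler_sum => i _.
have [->|ei] := eqVneq (e i) 0; first by rewrite !mulr0.
rewrite ler_wpM2r// ger0_norm ?subr_ge0//.
have := small i; rewrite ei/= -ltnNge => lt.
rewrite /zz gE (minn_idPl (ltnW lt)).
have /andP[_ h] := truncn_itv (divr_ge0 (m0 i) (ltW tau0)).
move: h; rewrite ltr_pdivrMr// -natr1; lra.
Qed.

End Grid.
End Quantitative.

(** * Finitely many shapes *)

Section Shapes.
Context {R : realType} {s : nat}.

(** The cofactor thresholds [n0] guarantee the area [c] for every diagonal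
    stretch of [C] respecting them. *)
Definition shape_ok (c : R) (C : set 'rV[R]_s.+1) (n0 : 'I_s.+1 -> R) :=
  [/\ cvx C, bnd C, C 0 & forall a : 'I_s.+1 -> R, (forall i, 0 < a i) ->
    (forall i, n0 i <= cof a i) ->
    (c%:E <= hausdorff_measure s (imx (dg a) (boundary C)))%E /\
    (hausdorff_measure s (imx (dg a) (boundary C)) < +oo)%E].

Definition shapes_for (c2 c3 : R) (C : set 'rV[R]_s.+1) (J : finType)
    (n0 : J -> 'I_s.+1 -> R) :=
  forall a : 'I_s.+1 -> R, (forall i, 0 < a i) ->
    (c3%:E <= hausdorff_measure s (imx (dg a) (boundary C)))%E ->
    exists j, forall i, n0 j i <= cof a i.

(** Finitely many polytopes, each with its finite list of thresholds, form
    one finite list. *)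
Lemma shapes_assemble (c2 c3 : R) (F : finType) (P : F -> set 'rV[R]_s.+1) :
  (forall f, exists (Z : finType) (z : Z -> 'I_s.+1 -> R),
     (forall k, shape_ok c2 (P f) (z k)) /\ (bnd (P f) -> shapes_for c2 c3 (P f) z)) ->
  exists (J : finType) (C : J -> set 'rV[R]_s.+1) (n0 : J -> 'I_s.+1 -> R),
    (forall j, shape_ok c2 (C j) (n0 j)) /\
    forall f a, bnd (P f) -> (forall i, 0 < a i) ->
      (c3%:E <= hausdorff_measure s (imx (dg a) (boundary (P f))))%E ->
      exists j, C j = P f /\ forall i, n0 j i <= cof a i.
Proof.
move=> hF.
have /choice[zz hzz] f : exists zz : {Z : finType & Z -> 'I_s.+1 -> R},
    (forall k, shape_ok c2 (P f) (projT2 zz k)) /\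
    (bnd (P f) -> shapes_for c2 c3 (P f) (projT2 zz)).
  by have [Z [z hz]] := hF f; exists (existT _ Z z).
pose T (f : F) : finType := projT1 (zz f).
exists {f : F & T f}, (fun j => P (tag j)), (fun j => projT2 (zz (tag j)) (tagged j)).
split; first by move=> [f k]; exact: (hzz f).1.
move=> f a bP a0 hc; have [k hk] := (hzz f).2 bP a a0 hc.
by exists (Tagged T k).
Qed.

(** Repeated normals would count a facet several times. *)
Lemma polytope_undup d (J : finType) (n : J -> 'rV[R]_d) :
  exists (J' : finType) (n' : J' -> 'rV[R]_d), [/\ injective n',
    polytope n' = polytope n & forall k, exists j, n' k = n j].
Proof.
pose L := undup [seq n j | j <- enum J].
have inL k : nth 0 L (k : 'I_(size L)) \in [seq n j | j <- enum J].
  by rewrite -mem_undup; exact: mem_nth.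
exists 'I_(size L), (fun k : 'I_(size L) => nth 0 L k); split.
- move=> i j /eqP; rewrite nth_uniq ?undup_uniq// => /eqP; exact: val_inj.
- apply/seteqP; split=> x hx k.
    have : n k \in L by rewrite mem_undup; apply/mapP; exists k; rewrite ?mem_enum.
    move=> /(nthP 0)[i iL <-]; exact: (hx (Ordinal iL)).
  by have /mapP[j _ ->] := inL k; exact: hx.
- by move=> k; have /mapP[j _ ->] := inL k; exists j.
Qed.

Lemma polytope_closed d (J : finType) (n : J -> 'rV[R]_d) : closed (polytope n).
Proof.
rewrite (_ : polytope n = \bigcap_j [set x | dotv x (n j) <= 1]).
  apply: closed_bigI => j _.
  by apply: (@preimage_closed _ _ (dotv^~ (n j)) [set t | t <= 1]) => [x _|]; [exact: dotv_cont|exact: closed_le].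
by apply/seteqP; split=> [x h j _|x h j]; exact: h.
Qed.

Lemma polytope_ball d (J : finType) (n : J -> 'rV[R]_d) : has_ball (polytope n).
Proof.
have [r r0 hr] : exists2 r, 0 < r & forall j, r <= (d%:R * enorm (n j) + 1)^-1.
  by apply: finite_pos_lb => j; rewrite invr_gt0 ltr_wpDl// mulr_ge0 ?enorm_ge0.
exists 0, r; split => // y; rewrite subr0 => yr j.
have D0 : 0 < d%:R * enorm (n j) + 1 by rewrite ltr_wpDl// mulr_ge0 ?enorm_ge0.
apply: le_trans (ler_norm _) _; apply: (le_trans (dotv_small _ _)).
apply: (@le_trans _ _ ((d%:R * enorm (n j) + 1) * `|y|)); first by rewrite ler_wpM2r// lerDl.
rewrite -ler_pdivlMl// mulr1; exact: le_trans (hr j).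
Qed.

(** The polytopes of [polytope_approx] with the thresholds of [facet_grid].
    If the cube has measure zero, so has the boundary of every polytope, and
    the empty list of shapes will do. *)
Lemma body_shapes (r M t c2 c3 : R) : 0 < r -> 0 < M -> 0 < t -> t < 1 -> 0 < c2 -> c2 < c3 ->
  exists (J : finType) (C : J -> set 'rV[R]_s.+1) (n0 : J -> 'I_s.+1 -> R),
    (forall j, shape_ok c2 (C j) (n0 j)) /\
    forall K : set 'rV[R]_s.+1, cvx K -> (forall y, enorm y <= r -> K y) ->
      (forall y, K y -> enorm y <= M) ->
      exists P, [/\ P `<=` K, forall x, K x -> P ((1 - t) *: x) &
        forall a, (forall i, 0 < a i) ->
        (c3%:E <= hausdorff_measure s (imx (dg a) (boundary P)))%E ->
        exists j, C j = P /\ forall i, n0 j i <= cof a i].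
Proof.
move=> r0 M0 t0 t1 c20 c23.
have [F [J [n [n0 approx]]]] := @polytope_approx R s.+1 r M t r0 M0 t0 t1.
have [|J' [C [m [hC cov]]]] := @shapes_assemble c2 c3 F (fun f => polytope (n f)).
  move=> f; have [bP|nbP] := pselect (bnd (polytope (n f))); last first.
    by exists void, (fun k : void => of_void _ k); split => // -[].
  have [kap0|k0] := ltP 0 (hv s (@cube R s)); last first.
    exists void, (fun k : void => of_void _ k); split => [[]|_ a a0].
    rewrite leNgt => /negP[]; apply: (@le_lt_trans _ _ 0%E); last by rewrite lte_fin (lt_trans c20).
    pose phi j := polytope (n f) `&` [set x | dotv x (n f j) = 1].
    have z j : hausdorff_measure s (imx (dg a) (phi j)) = 0%E.
      have [i ni] : exists i, n f j 0 i != 0.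
        apply/existsP; apply: contraNT (n0 f j) => /existsPn h.
        by apply/eqP/rowP => i; rewrite mxE; apply/eqP/negPn.
      rewrite (@hv_plane _ _ i (n f j) 1) => [|//|x []//].
      apply: H_bnd_null; first by apply/le_anti; rewrite k0 hv_ge0.
      by apply: bnd_imx; have [M' hM'] := bP; exists M' => x [/hM'].
    apply: (@le_trans _ _ (\sum_j hausdorff_measure s (imx (dg a) (phi j)))%E); last first.
      by rewrite big1// => j _; exact: z.
    apply: H_le_sum => _ [x bx <-].
    by have [j jx] := (boundary_polytope (n0 f) x).1 bx; exists j; exists x.
  have [K [n' [n'inj n'P n'n]]] := polytope_undup (n f); rewrite -n'P in bP *.
  have n'0 k : n' k != 0 by have [j ->] := n'n k; exact: n0.
  have [theta [theta0 surfE]] := polytope_surface kap0 n'inj n'0 bP.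
  have [Z [z [zc [z0 zcov]]]] := @facet_grid R s.+1 K theta n' theta0 c2 c3 c20 c23.
  have sE a : (forall i, 0 < a i) -> hausdorff_measure s (imx (dg a) (boundary (polytope n'))) =
      (facet_sum theta n' (cof a))%:E.
    move=> a0; have an0 i : a i != 0 by rewrite gt_eqF.
    by rewrite -(boundary_imx _ (mulmx1C (dgV an0))) surfE.
  exists Z, z; split.
    move=> k; split => //.
    - exact: polytope_cvx.
    - by move=> j; rewrite dotv0l.
    - move=> a a0 za; rewrite sE// ltry lee_fin; split => //.
      by apply: le_trans (zc k) _; exact: facet_sum_mono.
  move=> _ a a0; rewrite sE// lee_fin => hc.
  by apply: zcov => // i; apply: prodr_ge0 => j _; exact: ltW.
exists J', C, m; split => // K cK rK KM.
have [f [PK KP]] := approx K cK rK KM.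
exists (polytope (n f)); split => // a a0; apply: cov => //.
by exists M => x /PK/KM h; exact: le_trans (norm_le_enorm x) h.
Qed.

(** R^s as the hyperplane where the last coordinate vanishes. *)
Definition flat_mx : 'M[R]_(s, s.+1) := graph_mx ord_max 0.

Lemma flat_norm (y : 'rV[R]_s) : dotv (y *m flat_mx) (y *m flat_mx) = dotv y y.
Proof. by rewrite graph_norm dotv0r expr0n addr0. Qed.

Lemma flat_enorm (y : 'rV[R]_s) : enorm (y *m flat_mx) = enorm y.
Proof. by rewrite /enorm flat_norm. Qed.

Lemma flat_drop (x : 'rV[R]_s.+1) : x 0 ord_max = 0 -> x *m drop_mx ord_max *m flat_mx = x.
Proof.
move=> x0; apply/rowP => j; case: (unliftP ord_max j) => [k|] ->.
  by rewrite mul_graph_lift mul_drop.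
by rewrite mul_graph_i dotv0r x0.
Qed.

Lemma flat_last (y : 'rV[R]_s) : (y *m flat_mx) 0 ord_max = 0.
Proof. by rewrite mul_graph_i dotv0r. Qed.

Lemma closure_flat (B : set 'rV[R]_s) : closure (imx flat_mx B) `<=` imx flat_mx (closure B).
Proof.
move=> x /closureP cx.
have x0 : x 0 ord_max = 0.
  apply/eqP; rewrite -normr_eq0 eq_le normr_ge0 andbT; apply/ler_addgt0Pr => e e0.
  have [_ [y By <-] xy] := cx e e0; rewrite add0r.
  have -> : x 0 ord_max = (x - y *m flat_mx) 0 ord_max.
    by rewrite [RHS]mxE [X in _ + X]mxE flat_last subr0.
  by rewrite (le_trans (coord_le_norm _ _))// ltW.
exists (x *m drop_mx ord_max); last exact: flat_drop.
apply/closureP => e e0; have [_ [y By <-] xy] := cx e e0; exists y => //.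
apply: le_lt_trans xy; apply: norm_le_coord => // k.
have -> : x *m drop_mx ord_max - y = (x - y *m flat_mx) *m drop_mx ord_max.
  by rewrite mulmxBl -mulmxA graph_drop mulmx1.
by rewrite mul_drop; exact: coord_le_norm.
Qed.

(** A subset of a hyperplane has empty interior. *)
Lemma boundary_flat (B : set 'rV[R]_s) : closed B -> boundary (imx flat_mx B) = imx flat_mx B.
Proof.
move=> cB; rewrite boundaryE; apply/seteqP; split=> [x [/closure_flat[y]]|_ [y By <-]].
  by move=> /cB By <- _; exists y.
split; first by apply: subset_closure; exists y.
apply/closureP => e e0; exists (y *m flat_mx + (e / 2) *: delta_mx 0 ord_max).
  move=> [z Bz /rowP/(_ ord_max)]; rewrite flat_last [RHS]mxE flat_last add0r [RHS]mxE mxE !eqxx mulr1 => h.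
  by move: e0; rewrite -(@pmulr_lgt0 _ 2^-1) ?invr_gt0// -h ltxx.
rewrite opprD addNKr normrN normrZ gtr0_norm ?divr_gt0//.
apply: (@le_lt_trans _ _ (e / 2 * 1)).
  rewrite ler_pM2l ?divr_gt0//; apply: norm_le_coord => // i; rewrite mxE.
  by case: (_ && _); rewrite ?normr1 ?normr0.
by rewrite mulr1 ltr_pdivrMr// ltr_pMr// ltr1n.
Qed.

Lemma H_flat_stretch (a : 'I_s.+1 -> R) (B : set 'rV[R]_s) : (forall i, 0 < a i) ->
  cvx B -> bnd B -> has_ball B ->
  hausdorff_measure s (imx (dg a) (imx flat_mx B)) = (cof a ord_max * hv s B)%:E.
Proof.
move=> a0 cB bB hB; rewrite imx_comp.
have an0 i : a i != 0 by rewrite gt_eqF.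
pose a' (k : 'I_s) := a (lift ord_max k).
have -> : hausdorff_measure s (imx (flat_mx *m dg a) B) = hausdorff_measure s (imx (dg a') B).
  apply: H_same_norm => x; rewrite graph_dg// mulmxA -/(dg a').
  rewrite (_ : \row_k _ = 0) ?flat_enorm//.
  by apply/rowP => k; rewrite !mxE !mul0r.
have [k0|kap0] := leP (hv s (@cube R s)) 0.
  have k00 : hv s (@cube R s) = 0 by apply/le_anti; rewrite k0 hv_ge0.
  by rewrite H_bnd_null// -(imx1 B) /hv H_bnd_null//= mulr0.
rewrite hvE; last exact: H_bnd_finite.
congr EFin; have kn0 : hv s (@cube R s) != 0 by rewrite gt_eqF.
apply: (mulIf kn0); rewrite (area_law (dg a')) // (area_dg kap0) ?cof_lift//.
  by rewrite -/(a' _); ring.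
by move=> k; exact: a0.
Qed.

(** A flat polytope has one facet only, so its area is the last cofactor
    times a constant, and a single threshold is enough. *)
Lemma flat_shapes (r M t c2 c3 : R) : 0 < r -> 0 < M -> 0 < t -> t < 1 -> 0 < c2 -> c2 < c3 ->
  exists (J : finType) (C : J -> set 'rV[R]_s.+1) (n0 : J -> 'I_s.+1 -> R),
    (forall j, shape_ok c2 (C j) (n0 j)) /\
    forall K : set 'rV[R]_s, cvx K -> (forall y, enorm y <= r -> K y) ->
      (forall y, K y -> enorm y <= M) ->
      exists P : set 'rV[R]_s, [/\ P `<=` K, closed P, forall x, K x -> P ((1 - t) *: x) &
        forall a, (forall i, 0 < a i) ->
        (c3%:E <= hausdorff_measure s (imx (dg a) (imx flat_mx P)))%E ->
        exists j, C j = imx flat_mx P /\ forall i, n0 j i <= cof a i].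
Proof.
move=> r0 M0 t0 t1 c20 c23.
have [F [J [n [n0 approx]]]] := @polytope_approx R s r M t r0 M0 t0 t1.
have bE f : boundary (imx flat_mx (polytope (n f))) = imx flat_mx (polytope (n f)).
  by apply: boundary_flat; exact: polytope_closed.
have [|J' [C [m [hC cov]]]] := @shapes_assemble c2 c3 F (fun f => imx flat_mx (polytope (n f))).
  move=> f; have [[bP hP]|nbP] := pselect (bnd (polytope (n f)) /\ 0 < hv s (polytope (n f))).
    exists unit, (fun _ i => if i == ord_max then c2 / hv s (polytope (n f)) else 0).
    have sE a : (forall i, 0 < a i) -> hausdorff_measure s (imx (dg a) (imx flat_mx (polytope (n f)))) =
        (cof a ord_max * hv s (polytope (n f)))%:E.
      move=> a0; apply: H_flat_stretch => //; [exact: polytope_cvx|exact: polytope_ball].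
    split=> [_|_ a a0].
      split; [exact/imx_cvx/polytope_cvx|exact: bnd_imx| |].
      - by exists 0; [move=> j; rewrite dotv0l|rewrite mul0mx].
      - move=> a a0 /(_ ord_max); rewrite eqxx bE sE// ltry lee_fin => h; split => //.
        by rewrite -ler_pdivrMr.
    rewrite bE sE// lee_fin => h; exists tt => i; case: eqP => [->|_].
      by rewrite ler_pdivrMr// (le_trans (ltW c23)).
    by apply: prodr_ge0 => j _; exact: ltW.
  exists void, (fun k : void => of_void _ k); split => [[]|bF a a0].
  have bP : bnd (polytope (n f)).
    have [M' hM'] := bF; exists M' => x Px; have := hM' _ (ex_intro2 _ _ x Px erefl).
    apply: le_trans; apply: norm_le_coord => // k.
    by have := coord_le_norm (x *m flat_mx) (lift ord_max k); rewrite mul_graph_lift.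
  rewrite bE H_flat_stretch//; [|exact: polytope_cvx|exact: polytope_ball].
  rewrite lee_fin leNgt => /negP[]; apply: le_lt_trans (lt_trans c20 c23).
  rewrite (_ : hv s _ = 0) ?mulr0//; apply/eqP; rewrite eq_le hv_ge0 andbT leNgt.
  by apply/negP => h; apply: nbP.
exists J', C, m; split => // K cK rK KM.
have [f [PK KP]] := approx K cK rK KM.
have bP : bnd (polytope (n f)).
  by exists M => x /PK/KM h; exact: le_trans (norm_le_enorm x) h.
exists (polytope (n f)); split => //; first exact: polytope_closed.
move=> a a0 hc; apply: cov => //; [exact: bnd_imx|by rewrite bE].
Qed.

End Shapes.

(** * Pieces: shapes in adapted frames *)

Section Pieces.
Context {R : realType} {s : nat}.
Let d := s.+1.

(** The set of parameters of the pieces with thresholds [n0]: matrices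
    diag(a) N, [N] unitriangular and close to the identity, with large
    cofactors of [a]. Written in terms of the entries of the product so that
    it is convex. *)
Definition frame_cond (delta : R) (n0 : 'I_d -> R) (M : 'M[R]_d) :=
  [/\ forall i, 0 < M i i, forall i j : 'I_d, (j < i)%N -> M i j = 0,
      forall i j : 'I_d, (i < j)%N -> `|M i j| <= delta * M i i &
      forall i, n0 i <= cof (fun i => M i i) i].

(** A linear map bounded below is injective. *)
Lemma coercive_unit m (N : 'M[R]_m) (L : R) :
  (forall x, enorm x <= L * enorm (x *m N)) -> N \in unitmx.
Proof.
move=> h; rewrite -row_free_unit -kermx_eq0; apply/eqP/row_matrixP => i.
rewrite row0; apply/eqP; rewrite -enorm_eq0 eq_le enorm_ge0 andbT.
have := h (row i (kermx N)); rewrite -row_mul mulmx_ker row0.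
by rewrite enorm0 mulr0.
Qed.

Lemma triangular_bounds (delta t : R) (N : 'M[R]_d) : 0 <= delta ->
  d%:R * (d%:R * delta) <= t -> near_unitriangular delta N ->
  forall x : 'rV[R]_d, (1 - t) * enorm x <= enorm (x *m N) /\ enorm (x *m N) <= (1 + t) * enorm x.
Proof.
move=> delta0 dt hN x.
have h := near_unitriangular_dist delta0 hN x.
have h2 := ler_wpM2r (enorm_ge0 x) dt.
have h3 : enorm (x *m N) <= enorm (x *m N - x) + enorm x.
  by rewrite -{1}[x *m N](subrK x) enormD.
have h4 : enorm x <= enorm (x *m N - x) + enorm (x *m N).
  by rewrite enorm_distC -{1}[x](subrK (x *m N)) enormD.
by split; lra.
Qed.

(** The frame changes distances by factors between 1 - t and 1 + t, hence
    areas by the powers of these factors. *)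
Lemma frame_dist (delta t : R) (a : 'I_d -> R) (N f : 'M[R]_d) (Q : set 'rV[R]_d) :
  0 <= delta -> 0 < t -> t < 1 -> d%:R * (d%:R * delta) <= t -> near_unitriangular delta N ->
  f *m f^T = 1%:M ->
  (hausdorff_measure s (imx (dg a) Q) <=
    (((1 - t)^-1) ^+ s)%:E * hausdorff_measure s (imx (dg a *m N *m f) Q))%E /\
  (hausdorff_measure s (imx (dg a *m N *m f) Q) <=
    ((1 + t) ^+ s)%:E * hausdorff_measure s (imx (dg a) Q))%E.
Proof.
move=> delta0 t0 t1 dt hN ff; have b := triangular_bounds delta0 dt hN.
have t1' : 0 < 1 - t by rewrite subr_gt0.
split; apply: H_le_mx.
- by rewrite invr_gt0.
- by move=> x; rewrite !mulmxA (orth_enorm _ ff) ler_pdivlMl//; exact: (b _).1.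
- by rewrite addr_gt0.
- move=> x; by rewrite !mulmxA (orth_enorm _ ff); exact: (b _).2.
Qed.

Lemma frame_unit (delta t : R) (a : 'I_d -> R) (N f : 'M[R]_d) :
  0 <= delta -> t < 1 -> d%:R * (d%:R * delta) <= t -> near_unitriangular delta N ->
  f *m f^T = 1%:M -> (forall i, 0 < a i) -> dg a *m N *m f \in unitmx.
Proof.
move=> delta0 t1 dt hN ff a0; have b := triangular_bounds delta0 dt hN.
have t1' : 0 < 1 - t by rewrite subr_gt0.
rewrite !unitmx_mul; apply/andP; split; [apply/andP; split|].
- have an0 i : a i != 0 by rewrite gt_eqF.
  by have [_ ->] := mulmx1_unit (dgV an0).
- apply: (@coercive_unit _ _ ((1 - t)^-1)) => x.
  by rewrite ler_pdivlMl//; exact: (b _).1.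
- by have [-> _] := mulmx1_unit ff.
Qed.

Definition frame_image (C : set 'rV[R]_d) (M f : 'M[R]_d) (p : 'rV[R]_d) : set 'rV[R]_d :=
  [set y *m M *m f + p | y in C].

Lemma frame_imageE C M f p : frame_image C M f p = [set 1 *: x + p | x in imx (M *m f) C].
Proof.
apply/seteqP; split=> [_ [y Cy <-]|_ [_ [y Cy <-] <-]].
  by exists (y *m (M *m f)); [exists y|rewrite scale1r mulmxA].
by exists y => //; rewrite scale1r mulmxA.
Qed.

Lemma frame_split (delta : R) n0 M : frame_cond delta n0 M ->
  exists2 N, near_unitriangular delta N & M = dg (fun i => M i i) *m N.
Proof.
move=> [M0 Mlow Mup _]; pose a i := M i i.
have an0 i : a i != 0 by rewrite gt_eqF// M0.
exists (dg (fun i => (a i)^-1) *m M).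
  move=> i j; rewrite /dg mul_diag_mx !mxE; split => [<-|ji|ij].
  - by rewrite mulVf// an0.
  - by rewrite Mlow ?mulr0.
  - rewrite normrM gtr0_norm ?invr_gt0 ?M0// ler_pdivrMl ?M0// mulrC.
    exact: Mup.
by rewrite mulmxA dgM (eq_dg (b := fun=> 1)) ?dg1 ?mul1mx// => i; rewrite mulfV// an0.
Qed.

(** The thresholds bound the area of the diagonally stretched shape, and the
    rest of the frame changes it by a factor close to 1. *)
Lemma piece_ok (delta t c2 c : R) (C : set 'rV[R]_d) n0 M f p :
  0 <= delta -> 0 < t -> t < 1 -> d%:R * (d%:R * delta) <= t -> 0 <= c2 ->
  c <= c2 * (1 - t) ^+ (s + s) ->
  shape_ok c2 C n0 -> f *m f^T = 1%:M -> frame_cond delta n0 M ->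
  let A := frame_image C M f p in
  [/\ cvx A, bnd A, A !=set0, (c%:E <= hausdorff_measure s (boundary A))%E &
      (hausdorff_measure s (boundary A) < +oo)%E].
Proof.
move=> delta0 t0 t1 dt c20 cc2 [cC bC C0 hC] ff fc A.
have [M0 _ _ hn0] := fc; have [N hN ME] := frame_split fc.
have [lo hi] := hC _ M0 hn0.
set Q := imx (dg _) _ in lo hi.
have [d1 d2] := @frame_dist delta t (fun i => M i i) N f (boundary C) delta0 t0 t1 dt hN ff.
have u := @frame_unit delta t (fun i => M i i) N f delta0 t1 dt hN ff M0.
rewrite -ME in d1 d2 u.
have bE : boundary A = [set 1 *: x + p | x in imx (M *m f) (boundary C)].
  by rewrite /A frame_imageE boundary_affine// (boundary_imx _ (mulmxV u)).
have HE : hausdorff_measure s (boundary A) = hausdorff_measure s (imx (M *m f) (boundary C)).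
  by rewrite bE H_scale// expr1n mul1e.
have t1' : 0 < 1 - t by rewrite subr_gt0.
split.
- by rewrite /A frame_imageE; apply/affine_cvx/imx_cvx.
- by rewrite /A frame_imageE; apply/bnd_affine/bnd_imx.
- by exists (0 *m M *m f + p); exists 0.
- rewrite HE; have := le_trans lo d1; rewrite exprVn.
  rewrite lee_pdivlMl ?exprn_gt0// -EFinM; apply: le_trans; rewrite lee_fin.
  apply: (le_trans cc2); rewrite mulrC ler_wpM2r// exprD ler_piMl ?exprn_ge0 ?(ltW t1')//.
  by rewrite exprn_ile1 ?(ltW t1')// gerBl ltW.
- rewrite HE; apply: (le_lt_trans d2); rewrite -/Q.
  by rewrite (hvE hi) -EFinM ltry.
Qed.

(** The frame and the approximation by a shape together keep at least the
    proportion ((1 - t) / (1 + t))^s >= (1 - t)^(2 s) of the area. *)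
Lemma spread_bound (t c1 c3 : R) (x : \bar R) : 0 < t -> t < 1 -> 0 <= c1 ->
  c3 <= c1 * (1 - t) ^+ (s + s) ->
  (c1%:E <= (((1 - t)^-1) ^+ s)%:E * (((1 + t) ^+ s)%:E * x))%E -> (c3%:E <= x)%E.
Proof.
move=> t0 t1 c10 cc.
have t1' : 0 < 1 - t by rewrite subr_gt0.
have p1 : 0 < (1 - t) ^+ s by rewrite exprn_gt0.
have p2 : 0 < (1 + t) ^+ s by rewrite exprn_gt0// addr_gt0.
rewrite exprVn lee_pdivlMl// -lee_pdivrMl// -!EFinM; apply: le_trans.
rewrite lee_fin (le_trans cc)// mulrC exprD -mulrA [leRHS]mulrC mulrC.
rewrite [leRHS]mulrC mulrC ler_wpM2r ?mulr_ge0 ?(ltW p1)//.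
rewrite -[leRHS]mul1r ler_pdivlMr// -exprMn exprn_ile1//; nra.
Qed.

Lemma closure_shrunk m (B P : set 'rV[R]_m) (t : R) : 0 < t -> t < 1 -> closed P ->
  (forall x, B x -> P ((1 - t) *: x)) -> forall x, closure B x -> P ((1 - t) *: x).
Proof.
move=> t0 t1 cP h x /closureP cx; apply: cP; apply/closureP => e e0.
have t1' : 0 < 1 - t by rewrite subr_gt0.
have [y By xy] := cx e e0; exists ((1 - t) *: y); first exact: h.
rewrite -scalerBr normrZ gtr0_norm//; apply: le_lt_trans xy.
by rewrite ler_piMl// gerBl ltW.
Qed.

(** In an adapted frame of [K], approximate the coordinate body [K0] from
    inside by a shape [P]. As [K] is contained in the image of [P] enlarged
    by 1 / (1 - t), the area of the image of [P] is almost that of [K] (by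
    [surf_mono] for bodies, by inclusion for flat sets), so some thresholds
    for [P] are met. *)
Lemma cover_bounded (delta t c1 c3 r : R) (Fr : seq 'M[R]_d) (K : set 'rV[R]_d) :
  0 <= delta -> 0 < t -> t < 1 -> d%:R * (d%:R * delta) <= t -> 0 < c1 ->
  c3 <= c1 * (1 - t) ^+ (s + s) ->
  0 < r ->
  (forall f, f \in Fr -> f *m f^T = 1%:M) ->
  (forall X : set 'rV[R]_d, cvx X -> bnd X -> X 0 ->
    exists2 f, f \in Fr & exists N a k, adapted delta r f N a k X) ->
  forall (J1 J2 : finType) (C1 : J1 -> set 'rV[R]_d) (C2 : J2 -> set 'rV[R]_d) n1 n2,
  (forall K : set 'rV[R]_d, cvx K -> (forall y, enorm y <= r -> K y) ->
      (forall y, K y -> enorm y <= d%:R * 6) ->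
      exists P, [/\ P `<=` K, forall x, K x -> P ((1 - t) *: x) &
        forall a, (forall i, 0 < a i) ->
        (c3%:E <= hausdorff_measure s (imx (dg a) (boundary P)))%E ->
        exists j, C1 j = P /\ forall i, n1 j i <= cof a i]) ->
  (forall K : set 'rV[R]_s, cvx K -> (forall y, enorm y <= r -> K y) ->
      (forall y, K y -> enorm y <= d%:R * 6) ->
      exists P : set 'rV[R]_s, [/\ P `<=` K, closed P, forall x, K x -> P ((1 - t) *: x) &
        forall a, (forall i, 0 < a i) ->
        (c3%:E <= hausdorff_measure s (imx (dg a) (imx flat_mx P)))%E ->
        exists j, C2 j = imx flat_mx P /\ forall i, n2 j i <= cof a i]) ->
  cvx K -> bnd K -> (c1%:E <= hausdorff_measure s (boundary K))%E ->
  exists f M p, f \in Fr /\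
    ((exists j, frame_cond delta (n1 j) M /\ frame_image (C1 j) M f p `<=` K) \/
     (exists j, frame_cond delta (n2 j) M /\ frame_image (C2 j) M f p `<=` K)).
Proof.
move=> delta0 t0 t1 dt c10 cc3 r0 orth adapt J1 J2 C1 C2 n1 n2 body flat cK bK hK.
have t1' : 0 < 1 - t by rewrite subr_gt0.
have [p0 Kp0] : K !=set0.
  apply/set0P/eqP => K0; move: hK; rewrite K0 boundaryE closure0 set0I H0 lee_fin.
  by rewrite leNgt c10.
pose X := [set 1 *: x + (- p0) | x in K].
have XK x : X x -> K (x + p0) by move=> [y Ky <-]; rewrite scale1r subrK.
have KX x : K (x + p0) -> X x by move=> Kx; exists (x + p0) => //; rewrite scale1r addrK.
have X0 : X 0 by apply: KX; rewrite add0r.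
have bX : bnd X by exact: bnd_affine.
have cX : cvx X by exact: affine_cvx.
have [f fF [N [av [k [a0 hN kd cov [g ball]]]]]] := adapt X cX bX X0.
pose a (i : 'I_d) := av 0 i.
have aE : diag_mx av = dg a by congr diag_mx; apply/rowP => i; rewrite mxE.
rewrite aE in cov ball.
have ff := orth f fF.
pose T := dg a *m N *m f.
have u : T \in unitmx by exact: (@frame_unit delta t).
(* the coordinates of X, with the centre of the ball at the origin *)
pose K0 : set 'rV[R]_d := [set c | X ((c + g) *m T)].
have coord c : X (c *m T) -> (forall i, `|c 0 i| <= 3) /\ forall i : 'I_d, (k <= i)%N -> c 0 i = 0.
  move=> /cov[c' [e h1 h2]]; suff -> : c = c' by [].
  by apply: (can_inj (mulmxK u)); rewrite e /T !mulmxA.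
have Xg : X (g *m T).
  have := ball 0; rewrite addr0 /T !mulmxA; apply; last by rewrite normr0 ltW.
  by move=> i _; rewrite mxE.
have [g3 gk] := coord g Xg.
have K0k c : K0 c -> forall i : 'I_d, (k <= i)%N -> c 0 i = 0.
  by move=> /coord[_ h] i ki; have := h i ki; rewrite mxE gk// addr0.
have K06 c : K0 c -> forall i, `|c 0 i| <= 6.
  move=> /coord[h _] i; rewrite -[c](addrK g) mxE [(- g) _ _]mxE.
  rewrite (le_trans (ler_normB _ _))//; have := h i; have := g3 i; lra.
have cK0 : cvx K0.
  move=> x y l Kx Ky l0 l1; rewrite /K0 /=.
  have -> : l *: x + (1 - l) *: y + g = l *: (x + g) + (1 - l) *: (y + g).
    by apply/rowP => i; rewrite !mxE; ring.
  by rewrite mulmxDl -!scalemxAl; exact: cX.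
have ball0 (e : 'rV[R]_d) : (forall i : 'I_d, (k <= i)%N -> e 0 i = 0) -> `|e| <= r -> K0 e.
  by move=> h1 h2; rewrite /K0 /= addrC /T !mulmxA; exact: ball.
have M6 m (c : 'rV[R]_m) : (m <= d)%N -> (forall i, `|c 0 i| <= 6) -> enorm c <= d%:R * 6.
  move=> md h; rewrite (le_trans (enorm_le_norm _))// ler_pM ?ler_nat//.
  exact: norm_le_coord.
have KT : K = [set 1 *: x + (g *m T + p0) | x in imx T K0].
  apply/seteqP; split=> [x Kx|_ [_ [c Kc <-] <-]].
    have Xx : X (x - p0) by apply: KX; rewrite subrK.
    exists ((x - p0) - g *m T); last by rewrite scale1r addrA subrK subrK.
    exists ((x - p0) *m invmx T - g).
      by rewrite /K0 /= subrK mulmxKV.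
    by rewrite mulmxBl mulmxKV.
  by rewrite scale1r addrA -mulmxDl; exact: XK.
have bdK : hausdorff_measure s (boundary K) = hausdorff_measure s (imx T (boundary K0)).
  by rewrite KT boundary_affine// (boundary_imx _ (mulmxV u)) H_scale// expr1n mul1e.
have bK0 : bnd K0 by exists 6 => c Kc; apply: norm_le_coord => //; exact: K06.
have fin Q : (hausdorff_measure s (imx T Q) <= ((1 + t) ^+ s)%:E * hausdorff_measure s (imx (dg a) Q))%E.
  exact: (@frame_dist delta t a N f Q delta0 t0 t1 dt hN ff).2.
have conclude (C : set 'rV[R]_d) n0 : C `<=` K0 -> (forall i, n0 i <= cof a i) ->
    frame_cond delta n0 (dg a *m N) /\ frame_image C (dg a *m N) f (g *m T + p0) `<=` K.
  move=> CK hn0; split.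
    have MN i j : (dg a *m N) i j = a i * N i j by rewrite /dg mul_diag_mx !mxE.
    have Mii i : (dg a *m N) i i = a i by rewrite MN; have [-> // _ _] := hN i i; rewrite mulr1.
    split => [i|i j ji|i j ij|i].
    - by rewrite Mii; exact: a0.
    - by rewrite MN; have [_ -> // _] := hN i j; rewrite mulr0.
    - rewrite MN Mii normrM gtr0_norm; last exact: a0.
      rewrite mulrC ler_wpM2r//; first by apply: ltW; exact: a0.
      by have [_ _ ->] := hN i j.
    - rewrite (_ : cof _ i = cof a i) ?hn0//.
      by apply: eq_bigr => j _; rewrite Mii.
  move=> _ [y Cy <-]; rewrite addrA; apply: XK.
  by rewrite -mulmxA -/T -mulmxDl; exact: CK.
exists f, (dg a *m N), (g *m T + p0); split => //.
have sc P : hausdorff_measure s (imx T [set (1 - t)^-1 *: x + 0 | x in P]) =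
    ((((1 - t)^-1) ^+ s)%:E * hausdorff_measure s (imx T P))%E.
  by rewrite imx_affine H_scale// invr_gt0.
have inv (x : 'rV[R]_d) : (1 - t)^-1 *: ((1 - t) *: x) + 0 = x.
  by rewrite scalerA mulVf ?gt_eqF// scale1r addr0.
have [kE|kd'] := eqVneq k s.+1.
  left.
  have kF (i : 'I_d) : (k <= i)%N = false by rewrite kE leqNgt ltn_ord.
  have [| |P [PK KP hP]] := body K0 cK0.
  - move=> y yr; apply: ball0; first by move=> i; rewrite kF.
    exact: le_trans (norm_le_enorm y) yr.
  - by move=> y Ky; apply: M6 => //; exact: K06.
  have bP : bnd P by have [m hm] := bK0; exists m => x /PK/hm.
  have [|j [Cj nj]] := hP a a0.
    apply: (spread_bound t0 t1 (ltW c10) cc3).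
    apply: (le_trans hK); rewrite bdK -(boundary_imx _ (mulmxV u)).
    apply: (@le_trans _ _ (hausdorff_measure s (boundary (imx T [set (1 - t)^-1 *: x + 0 | x in P])))).
      apply: surf_mono.
      - exact: imx_cvx.
      - apply: (has_ball_imx (mulVmx u)).
        exists 0, r; split => // y; rewrite subr0 => yr.
        by apply: ball0 => // i; rewrite kF.
      - by apply: imx_sub => x Kx; exists ((1 - t) *: x); [exact: KP|exact: inv].
      - exact/bnd_imx/bnd_affine.
    rewrite (boundary_imx _ (mulmxV u)) boundary_affine ?invr_gt0// sc.
    by rewrite lee_wpmul2l ?lee_fin ?exprn_ge0 ?invr_ge0 ?(ltW t1').
  exists j; apply: conclude => //; rewrite Cj; exact: PK.
have ks : (k <= s)%N by rewrite -ltnS ltn_neqAle kd' kd.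
pose B : set 'rV[R]_s := [set y | K0 (y *m flat_mx)].
have KB : K0 = imx flat_mx B.
  apply/seteqP; split=> [c Kc|_ [y By <-]//].
  have e := flat_drop (K0k c Kc ord_max ks).
  by exists (c *m drop_mx ord_max) => //; rewrite /B /= e.
have B6 y : B y -> forall i, `|y 0 i| <= 6.
  by move=> /K06 h i; have := h (lift ord_max i); rewrite mul_graph_lift.
have bB : bnd B by exists 6 => y /B6 h; exact: norm_le_coord.
have bcl : (hausdorff_measure s (boundary K) <=
    hausdorff_measure s (imx T (imx flat_mx (closure B))))%E.
  rewrite bdK; apply: H_le; apply: imx_sub => x; rewrite boundaryE => -[cx _].
  by apply: closure_flat; rewrite -KB.
have [kE|ks'] := eqVneq k s.
  right.
  have cB : cvx B.
    move=> x y l Bx By l0 l1; rewrite /B /= mulmxDl -!scalemxAl; exact: cK0.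
  have [| |P [PB clP BP hP]] := flat B cB.
  - move=> y yr; apply: ball0.
      move=> i; rewrite kE => si.
      have -> : i = ord_max by apply/val_inj/anti_leq; rewrite si /= -ltnS ltn_ord.
      exact: flat_last.
    by rewrite (le_trans (norm_le_enorm _))// flat_enorm.
  - by move=> y By; apply: M6; [exact: leqnSn|exact: B6].
  have [|j [Cj nj]] := hP a a0.
    apply: (spread_bound t0 t1 (ltW c10) cc3).
    apply: (le_trans hK); apply: (le_trans bcl).
    apply: (@le_trans _ _ (hausdorff_measure s (imx T [set (1 - t)^-1 *: x + 0 | x in imx flat_mx P]))).
      apply: H_le; apply: imx_sub => _ [y cy <-].
      exists ((1 - t) *: (y *m flat_mx)); last exact: inv.
      exists ((1 - t) *: y); last by rewrite scalemxAl.
      exact: (closure_shrunk t0 t1 clP BP).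
    rewrite sc.
    by rewrite lee_wpmul2l ?lee_fin ?exprn_ge0 ?invr_ge0 ?(ltW t1').
  exists j; apply: conclude => //; rewrite Cj KB; exact: imx_sub.
exfalso.
have lts : (k < s)%N by rewrite ltn_neqAle ks' ks.
have z : hausdorff_measure s (imx T (imx flat_mx (closure B))) = 0%E.
  rewrite imx_comp; apply: (@H_flat_null R s _ _ _ (delta_mx 0 (Ordinal lts)) 0).
  - exact: closure_bnd.
  - apply/eqP => /rowP/(_ (Ordinal lts)); rewrite !mxE !eqxx => /eqP.
    by rewrite oner_eq0.
  - move=> x /closureP cx; rewrite /dotv (bigD1 (Ordinal lts))//= big1 ?addr0.
      rewrite mxE !eqxx mulr1; apply/eqP; rewrite -normr_eq0 eq_le normr_ge0 andbT.
      apply/ler_addgt0Pr => e e0; have [y By xy] := cx e e0; rewrite add0r.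
      have y0 : y 0 (Ordinal lts) = 0.
        have := K0k _ By (lift ord_max (Ordinal lts)); rewrite mul_graph_lift; apply.
        exact: leq_addl.
      have := coord_le_norm (x - y) (Ordinal lts); rewrite !mxE y0 subr0 => /le_trans; apply.
      exact: ltW.
    by move=> j /negbTE jk; rewrite mxE jk andbF mulr0.
by have := le_trans hK (le_trans bcl _); rewrite z => /(_ _ (lexx _)); rewrite lee_fin leNgt c10.
Qed.

End Pieces.

(** * The covering family *)

Section Covering.
Context {R : realType} {s : nat}.
Let d := s.+1.

Lemma frame_cond_cvx (delta : R) (n0 : 'I_d -> R) (M M' : 'M[R]_d) (l : R) :
  frame_cond delta n0 M -> frame_cond delta n0 M' -> 0 <= l -> l <= 1 ->
  frame_cond delta n0 (l *: M + (1 - l) *: M').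
Proof.
move=> [M0 Mz Mb Mc] [M'0 M'z M'b M'c] l0 l1; have l1' : 0 <= 1 - l by rewrite subr_ge0.
have E i j : (l *: M + (1 - l) *: M') i j = l * M i j + (1 - l) * M' i j by rewrite !mxE.
have pos (x y : R) : 0 < x -> 0 < y -> 0 < l * x + (1 - l) * y.
  move=> x0 y0; have [->|ln0] := eqVneq l 0; first by rewrite mul0r add0r subr0 mul1r.
  by rewrite ltr_pwDl ?mulr_ge0 ?(ltW y0)// mulr_gt0// lt_neqAle eq_sym ln0.
split=> [i|i j ij|i j ij|i]; rewrite ?E.
- exact: pos.
- by rewrite Mz// M'z// !mulr0 addr0.
- rewrite (le_trans (ler_normD _ _))// !normrM (ger0_norm l0) (ger0_norm l1').
  rewrite mulrDr lerD// mulrCA ler_wpM2l//; [exact: Mb|exact: M'b].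
- rewrite /cof; under eq_bigr do rewrite E.
  exact: prod_concave.
Qed.

Lemma frame_image_mix (C : set 'rV[R]_d) (M M' f : 'M[R]_d) (p p' : 'rV[R]_d) (l : R) F :
  cvx F -> 0 <= l -> l <= 1 -> frame_image C M f p `<=` F -> frame_image C M' f p' `<=` F ->
  frame_image C (l *: M + (1 - l) *: M') f (l *: p + (1 - l) *: p') `<=` F.
Proof.
move=> cF l0 l1 hF hF' _ [y Cy <-].
have -> : y *m (l *: M + (1 - l) *: M') *m f + (l *: p + (1 - l) *: p') =
    l *: (y *m M *m f + p) + (1 - l) *: (y *m M' *m f + p').
  by rewrite mulmxDr mulmxDl -!scalemxAr -!scalemxAl !scalerDr addrACA.
by apply: cF => //; [apply: hF; exists y|apply: hF'; exists y].
Qed.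

(** The smaller of two admissible values of [t] serves for both
    inequalities. *)
Lemma power_near_one2 (u v u' v' : R) : 0 < u -> u < v -> 0 < u' -> u' < v' ->
  exists t : R, [/\ 0 < t, t < 1, u <= v * (1 - t) ^+ (s + s) & u' <= v' * (1 - t) ^+ (s + s)].
Proof.
move=> u0 uv u'0 u'v'.
have [t1 /andP[t10 t11] h1] := power_near_one s u0 uv.
have [t2 /andP[t20 t21] h2] := power_near_one s u'0 u'v'.
have mono (t t' v0 : R) : t <= t' -> t' < 1 -> 0 <= v0 ->
    v0 * (1 - t') ^+ (s + s) <= v0 * (1 - t) ^+ (s + s).
  move=> tt t'1 v00; rewrite ler_wpM2l// lerXn2r ?nnegrE ?subr_ge0 ?(ltW t'1)//.
    exact: le_trans tt (ltW t'1).
  by rewrite lerB.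
exists (Num.min t1 t2); split.
- by rewrite lt_min t10.
- by rewrite gt_min t11.
- apply: (le_trans h1); apply: mono => //; first by rewrite ge_min lexx.
  by rewrite ltW// (lt_trans u0).
- apply: (le_trans h2); apply: mono => //; first by rewrite ge_min lexx orbT.
  by rewrite ltW// (lt_trans u'0).
Qed.

(** The losses are distributed as 1 > c1 > c3 > c2 > 1 - eps: from 1 to c1
    by truncation, from c1 to c3 by the frame and the approximation, from c3
    to c2 by rounding the cofactors, from c2 to 1 - eps by the frame of the
    piece. *)
Lemma covering_family (eps : R) : 0 < eps -> eps < 1 ->
  exists (J : finType) (C : J -> 'rV[R]_(d * d + d) -> set 'rV[R]_d)
    (S : J -> set 'rV[R]_(d * d + d)),
  [/\ forall j, cvx (S j),
      forall j x, S j x -> [/\ cvx (C j x), C j x !=set0,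
        ((1 - eps)%:E <= hausdorff_measure s (boundary (C j x)))%E &
        (hausdorff_measure s (boundary (C j x)) < +oo)%E],
      forall j F, cvx F -> cvx [set x | S j x /\ C j x `<=` F] &
      forall K : set 'rV[R]_d, cvx K -> (1%:E <= hausdorff_measure s (boundary K))%E ->
        exists j x, S j x /\ C j x `<=` K].
Proof.
move=> e0 e1.
pose c1 : R := 1 - eps / 4; pose c3 : R := 1 - eps / 2; pose c2 : R := 1 - 3 * eps / 4.
have [||||t [t0 t1 h1 h2]] := @power_near_one2 c3 c1 (1 - eps) c2; rewrite /c1 /c2 /c3; try lra.
have c20 : 0 < c2 by rewrite /c2; lra.
have c10 : 0 < c1 by rewrite /c1; lra.
have c23 : c2 < c3 by rewrite /c2 /c3; lra.
pose delta := t / (d%:R * d%:R).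
have dd : 0 < d%:R * d%:R :> R by rewrite mulr_gt0.
have delta0 : 0 < delta by rewrite divr_gt0.
have dt : d%:R * (d%:R * delta) <= t by rewrite mulrA mulrC divfK// gt_eqF.
have [r [Fr [r0 orth adapt]]] := adaptable_all d delta0.
have M0 : 0 < d%:R * 6 :> R by rewrite mulr_gt0.
have [J1 [C1 [n1 [ok1 body]]]] := @body_shapes R s r (d%:R * 6) t c2 c3 r0 M0 t0 t1 c20 c23.
have [J2 [C2 [n2 [ok2 flat]]]] := @flat_shapes R s r (d%:R * 6) t c2 c3 r0 M0 t0 t1 c20 c23.
pose J : finType := ('I_(size Fr) * (J1 + J2))%type.
pose shape (j : J) := match j.2 with inl k => C1 k | inr k => C2 k end.
pose low (j : J) := match j.2 with inl k => n1 k | inr k => n2 k end.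
pose rot (j : J) : 'M[R]_d := nth 0 Fr j.1.
have ok j : shape_ok c2 (shape j) (low j) by case: j => i [k|k]; [exact: ok1|exact: ok2].
(* a parameter is a matrix followed by a translation vector *)
pose mat (x : 'rV[R]_(d * d + d)) : 'M[R]_d := vec_mx (lsubmx x).
pose pos (x : 'rV[R]_(d * d + d)) : 'rV[R]_d := rsubmx x.
have matD l x y : mat (l *: x + (1 - l) *: y) = l *: mat x + (1 - l) *: mat y.
  by rewrite /mat !linearD !linearZ.
have posD l x y : pos (l *: x + (1 - l) *: y) = l *: pos x + (1 - l) *: pos y.
  by rewrite /pos !linearD !linearZ.
pose S j := [set x | frame_cond delta (low j) (mat x)].
have cS j : cvx (S j) by move=> x y l Sx Sy l0 l1; rewrite /S /= matD; exact: frame_cond_cvx.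
exists J, (fun j x => frame_image (shape j) (mat x) (rot j) (pos x)), S; split => //.
- move=> j x Sx.
  have ff : rot j *m (rot j)^T = 1%:M by apply: orth; exact: mem_nth.
  by have [] := piece_ok (pos x) (ltW delta0) t0 t1 dt (ltW c20) h2 (ok j) ff Sx.
- move=> j F cF x y l [Sx Fx] [Sy Fy] l0 l1; split; first exact: cS.
  by rewrite matD posD; exact: frame_image_mix.
- move=> K cK hK.
  have [|K' [cK' bK' K'K hK']] := @truncation R d s K 1 c1 cK _ hK.
    by rewrite /c1; lra.
  have [f [M [p [fF [[k [fc sub]]|[k [fc sub]]]]]]] := @cover_bounded R s delta t c1 c3 r Fr K' (ltW delta0) t0 t1 dt c10 h1 r0 orth adapt J1 J2 C1 C2 n1 n2 body flat cK' bK' hK'.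
  all: move: fF => /(nthP 0)[i iF fE].
    exists (Ordinal iF, inl k), (row_mx (mxvec M) p).
  2: exists (Ordinal iF, inr k), (row_mx (mxvec M) p).
  all: rewrite /S /mat /pos /rot /= row_mxKl row_mxKr mxvecK fE.
  all: by split => //; apply: subset_trans K'K.
Qed.

End Covering.

(** * The quantitative (p,q) theorem for surface area *)

Section Exact.
Context {R : realType} {s : nat}.
Let d := s.+1.

(** A homothety of ratio l multiplies the area by l^s; with centre in [A]
    and l <= 1 it maps [A] into itself. *)
Lemma shrink_exact (c : R) (A : set 'rV[R]_d) : 0 < c -> (0 < s)%N ->
  cvx A -> A !=set0 -> (c%:E <= hausdorff_measure s (boundary A))%E ->
  (hausdorff_measure s (boundary A) < +oo)%E ->
  exists E, [/\ cvx E, E `<=` A & hausdorff_measure s (boundary E) = c%:E].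
Proof.
move=> c0 s0 cA [z Az] hA fA; rewrite (hvE fA) lee_fin in hA *.
set v := hv s (boundary A) in hA *; have v0 : 0 < v by exact: lt_le_trans hA.
have s0' : s%:R != 0 :> R by rewrite pnatr_eq0 -lt0n.
pose l := (c / v) `^ (s%:R^-1).
have l0 : 0 < l by rewrite powR_gt0// divr_gt0.
have lE : l ^+ s = c / v.
  rewrite -powR_mulrn ?(ltW l0)// -powRrM mulVf// powRr1// divr_ge0 ?(ltW c0) ?(ltW v0)//.
have l1 : l <= 1 by rewrite -(@ler_pXn2r _ s) ?nnegrE ?(ltW l0)// expr1n lE ler_pdivrMr// mul1r.
exists [set l *: x + (1 - l) *: z | x in A]; split.
- exact: affine_cvx.
- by move=> _ [x Ax <-]; apply: cA => //; exact: ltW.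
- by rewrite boundary_affine// H_scale// (hvE fA) -EFinM lE divfK// gt_eqF.
Qed.

Definition good_piece (eps : R) (A : set 'rV[R]_d) :=
  [/\ convex_set A, ((1 - eps)%:E <= surf A)%E & (1 < d)%N -> surf A = (1 - eps)%:E].

(** In dimension 1 the area counts boundary points and cannot be adjusted by
    scaling; there the piece is kept as it is. *)
Lemma good_subpiece (eps : R) (A : set 'rV[R]_d) : eps < 1 ->
  cvx A -> A !=set0 -> ((1 - eps)%:E <= hausdorff_measure s (boundary A))%E ->
  (hausdorff_measure s (boundary A) < +oo)%E ->
  exists2 E, good_piece eps E & E `<=` A.
Proof.
move=> e1 cA A0 hA fA; have [s0|] := posnP s.
  exists A => //; split => //; first exact/cvxP.
  by rewrite ltnS => /leq_trans/(_ (eq_leq s0)).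
move=> s0; have [|E [cE EA hE]] := @shrink_exact (1 - eps) A _ s0 cA A0 hA fA.
  by rewrite subr_gt0.
by exists E => //; split => //; [exact/cvxP|rewrite /surf hE].
Qed.

End Exact.

(* For d = 1 surface area is integer valued (it counts endpoints), so no set
   has surface area exactly 1 - eps; there only the lower bound is asserted. *)
Theorem corollary1p4 (R : realType) (d : nat) (eps : R) :
  (0 < d)%N -> 0 < eps -> eps < 1 ->
  exists n2 : nat, forall p q : nat,
    (0 < p)%N -> (0 < q)%N -> (q <= p)%N -> (n2 <= q)%N ->
    exists c_surf : nat, forall FF : {fset (set 'rV[R]_d)},
      (forall F, F \in FF -> convex_set F /\ (1 <= surf F)%E) ->
      (forall P : {fset (set 'rV[R]_d)},
        (P `<=` FF)%fset -> #|` P| = p ->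
        exists Q : {fset (set 'rV[R]_d)},
          [/\ (Q `<=` P)%fset, #|` Q| = q
            & (1 <= surf (\bigcap_(F in [set` Q]) F))%E]) ->
      exists C : 'I_c_surf -> set 'rV[R]_d,
        (forall i, [/\ convex_set (C i), ((1 - eps)%:E <= surf (C i))%E
                     & (1 < d)%N -> surf (C i) = (1 - eps)%:E]) /\
        (forall F, F \in FF -> exists i, C i `<=` F).
Proof.
case: d => // s _ e0 e1; set d := s.+1.
have [J [C [S [cS piece cvxC cover]]]] := @covering_family R s eps e0 e1.
exists (d * d + d).+1 => p q p0 q0 qp nq.
have [c net_of] := @pq_coloured R (d * d + d) #|J| p q nq qp.
pose colour (j : 'I_#|J|) : J := enum_val j.
have /choice[E hE] : forall e : 'I_#|J| * 'rV[R]_(d * d + d), exists A : set 'rV[R]_d,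
    S (colour e.1) e.2 -> good_piece eps A /\ A `<=` C (colour e.1) e.2.
  move=> [j x]; have [Sx|nSx] := pselect (S (colour j) x); last by exists set0.
  have [cA A0 hA fA] := piece _ _ Sx.
  by have [A gA sub] := good_subpiece e1 cA A0 hA fA; exists A.
have cover' (K : set 'rV[R]_d) : cvx K -> (1%:E <= hausdorff_measure s (boundary K))%E ->
    exists j x, S (colour j) x /\ C (colour j) x `<=` K.
  move=> cK hK; have [j [x h]] := cover K cK hK.
  by exists (enum_rank j), x; rewrite /colour enum_rankK.
(* A piece is needed to fill the unused indices.  If no convex set has area
   at least 1, the family is empty and no index is needed. *)
have [[K [cK hK]]|none] := pselect (exists K : set 'rV[R]_d, cvx K /\ (1%:E <= hausdorff_measure s (boundary K))%E); last first.
  exists 0%N => FF hFF _; exists (fun=> set0); split => [[]//|F FFF].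
  by have [/cvxP cF hF] := hFF F FFF; exfalso; apply: none; exists F.
have [j0 [x0 [S0 _]]] := cover' K cK hK.
exists c => FF hFF pq.
have cF (F : FF) : cvx (val F) by have [/cvxP] := hFF _ (valP F).
pose G (F : FF) (j : 'I_#|J|) := [set x | S (colour j) x /\ C (colour j) x `<=` val F].
have [||f finj|net [size_net hG cov]] := net_of FF G.
- by move=> F j; apply: cvxC.
- by move=> F; apply: cover' => //; have [] := hFF _ (valP F).
- pose P := [fset val (f a) | a in 'I_p]%fset.
  have [|| Q [QP cQ hQ]] := pq P.
  + by apply/fsubsetP => _ /imfsetP[a _ ->]; exact: valP.
  + rewrite card_imfset/=; first by rewrite -cardE card_ord.
    by move=> a b /val_inj/finj.
  exists [set a | val (f a) \in Q]%SET; split.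
    rewrite -cQ -[RHS](_ : #|` [fset val (f a) | a in [set a | val (f a) \in Q]%SET]%fset| = _).
      rewrite card_imfset/= ?cardE//.
      by move=> a b /val_inj/finj.
    congr (#|` _|); apply/fsetP => F; apply/imfsetP/idP => [[a]|FQ].
      by rewrite /= inE => h ->.
    have /imfsetP[a _ Fa] := fsubsetP QP F FQ.
    by exists a => //=; rewrite inE -Fa.
  have [|j [x [Sx sub]]] := cover' (\bigcap_(F in [set` Q]) F) _ hQ.
    apply: cvx_bigcap => F FQ; have /imfsetP[a _ ->] := fsubsetP QP F FQ; exact: cF.
  by exists j, x => a; rewrite inE => aQ; split => // y /sub; apply.
pose L := [seq E e | e <- net].
exists (fun i : 'I_c => nth (E (j0, x0)) L i); split => [i|F FFF].
  suff [] : good_piece eps (nth (E (j0, x0)) L i) by [].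
  have [lt|ge] := ltnP i (size L); last by rewrite nth_default//; have [] := hE (j0, x0) S0.
  have /mapP[e enet ->] := mem_nth (E (j0, x0)) lt.
  by have [F [Se _]] := hG e enet; have [] := hE e Se.
have [e enet [Se sub]] := cov [` FFF]%fset.
have lt : (index e net < size net)%N by rewrite index_mem.
exists (Ordinal (leq_trans lt size_net)).
rewrite /= (nth_map e)// nth_index//.
by have [_] := hE e Se; move/subset_trans; apply.
Qed.
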